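(* Let $\rho\in(1,2)\cup(2,+\infty)$. Let $\mu\le_{cx}\nu$ be such that there exist $\underline y<\overline y<\underline x<\overline x<\underline z<\overline z$ with $\mu([\underline x,\overline x])=1$ and $\nu([\underline y,\overline y]\cup[\underline z,\overline z])=1$. Let $\alpha_\rho\in(0,\frac12)$ be the unique solution of $\psi_\rho(\alpha)=0$, where $\psi_\rho:(0,1]\to\mathbb R$ is defined by $$\psi_\rho(\alpha)=\alpha+\alpha^{2-\rho}(1-\alpha)^{\rho-1}+1-\rho.$$ If $$\underline x-\overline y\ge\alpha_\rho(\overline z-\overline y)\quad\text{and}\quad\underline z-\overline x\ge\alpha_\rho(\underline z-\underline y),$$ then the unique non-decreasing coupling $\pi^\uparrow$ (resp. the unique non-increasing coupling $\pi^\downarrow$) in $\Pi_M(\mu,\nu)$ is the unique optimal coupling in $\Pi_M(\mu,\nu)$ that attains $\overline{\mathcal M}_\rho(\mu,\nu)$ (resp. $\underline{\mathcal M}_\rho(\mu,\nu)$) when $\rho\in(1,2)$, and $\underline{\mathcal M}_\rho(\mu,\nu)$ (resp. $\overline{\mathcal M}_\rho(\mu,\nu)$) when $\rho>2$.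
   Context: $\mu,\nu$ are probability measures on $\mathbb R$ with finite first moment; $\mu\le_{cx}\nu$ (convex order) means $\int\varphi\,d\mu\le\int\varphi\,d\nu$ for every convex $\varphi:\mathbb R\to\mathbb R$. $\Pi(\mu,\nu)$ is the set of probability measures on $\mathbb R\times\mathbb R$ with first marginal $\mu$ and second marginal $\nu$; $\Pi_M(\mu,\nu)$ is the set of martingale couplings, i.e. of $\pi(dx,dy)=\mu(dx)\pi_x(dy)\in\Pi(\mu,\nu)$ such that $\int_{\mathbb R} y\,\pi_x(dy)=x$ for $\mu(dx)$-almost every $x$. For $\rho>0$, $\overline{\mathcal M}_\rho^\rho(\mu,\nu)$ and $\underline{\mathcal M}_\rho^\rho(\mu,\nu)$ denote respectively the supremum and the infimum of $\int_{\mathbb R\times\mathbb R}|x-y|^\rho\,\pi(dx,dy)$ over $\pi\in\Pi_M(\mu,\nu)$; a coupling attains $\overline{\mathcal M}_\rho$ (resp. $\underline{\mathcal M}_\rho$) if it attains this supremum (resp. infimum). A martingale coupling $\pi\in\Pi_M(\mu,\nu)$ is called non-decreasing if there exists a Borel set $\Gamma\subseteq\mathbb R\times\mathbb R$ such that $\pi(\Gamma)=1$ and: (a) if $(x_-,y_-),(x_+,y_+)\in\Gamma$ with $y_-\le x_-$, $y_+\le x_+$ and $x_-<x_+$, then $y_-\le y_+$; (b) if $(x_-,z_-),(x_+,z_+)\in\Gamma$ with $x_-\le z_-$, $x_+\le z_+$ and $x_-<x_+$, then $z_-\le z_+$. It is called non-increasing if there exists a Borel set $\Gamma\subseteq\mathbb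 R\times\mathbb R$ such that $\pi(\Gamma)=1$ and: (c) if $(x_-,y_+),(x_+,y_-)\in\Gamma$ with $y_+\le x_-$, $y_-\le x_+$ and $x_-<x_+$, then $y_-\le y_+$; (d) if $(x_-,z_+),(x_+,z_-)\in\Gamma$ with $x_-\le z_+$, $x_+\le z_-$ and $x_-<x_+$, then $z_-\le z_+$. Under the stated support assumption on $\mu$ and $\nu$, there is a unique non-decreasing coupling $\pi^\uparrow$ and a unique non-increasing coupling $\pi^\downarrow$ in $\Pi_M(\mu,\nu)$ (since $\mu([a,b])=1$ and $\nu((a,b))=0$ with $a=\underline x$, $b=\overline x$). *)

(* Defs.v *)
From HB Require Import structures.
From mathcomp Require Import all_boot all_order all_algebra.
From mathcomp Require Import all_classical all_reals all_analysis.

Set Implicit Arguments.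
Unset Strict Implicit.
Unset Printing Implicit Defensive.

Import Order.TTheory GRing.Theory Num.Theory.
Import numFieldNormedType.Exports.

Local Open Scope classical_set_scope.
Local Open Scope ring_scope.

Section MartingaleOptimalTransport.
Context {R : realType}.
Implicit Types (mu nu : probability R R) (pi : probability (R * R)%type R)
  (G : set (R * R)).

Definition finite_first_moment mu : Prop :=
  mu.-integrable [set: R] (fun x => x%:E).

(* A convex function has an affine minorant, so under finite first moments both
   integrals are well defined in ]-oo, +oo]. *)
Definition le_cx mu nu : Prop :=
  forall phi : R -> R, convex_function [set: R] phi ->
    (\int[mu]_x (phi x)%:E <= \int[nu]_x (phi x)%:E)%E.

Definition coupling mu nu pi : Prop :=
  (forall A : set R, measurable A -> pi (A `*` [set: R]) = mu A) /\
  (forall B : set R, measurable B -> pi ([set: R] `*` B) = nu B).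

(* pi(dx, dy) = mu(dx) k_x(dy) *)
Definition disintegration mu pi (k : R.-pker R ~> R) : Prop :=
  forall C : set (R * R), measurable C ->
    pi C = (\int[mu]_x k x (xsection C x))%E.

Definition martingale_coupling mu nu pi : Prop :=
  coupling mu nu pi /\
  exists2 k : R.-pker R ~> R, disintegration mu pi k &
    {ae mu, forall x, (k x).-integrable [set: R] (fun y => y%:E) /\
                      (\int[k x]_y y%:E = x%:E)%E}.

Definition cost (rho : R) pi : \bar R :=
  (\int[pi]_p (`|p.1 - p.2| `^ rho)%:E)%E.

(* The suprema and infima of the cost itself, i.e. the rho-th powers of
   the quantities M_rho. *)
Definition Mup (rho : R) mu nu : \bar R :=
  ereal_sup [set cost rho pi | pi in martingale_coupling mu nu].

Definition Mdown (rho : R) mu nu : \bar R :=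
  ereal_inf [set cost rho pi | pi in martingale_coupling mu nu].

Definition attains_Mup (rho : R) mu nu pi : Prop :=
  martingale_coupling mu nu pi /\ cost rho pi = Mup rho mu nu.

Definition attains_Mdown (rho : R) mu nu pi : Prop :=
  martingale_coupling mu nu pi /\ cost rho pi = Mdown rho mu nu.

Definition nondecreasing_set G : Prop :=
  (forall xm ym xp yp : R, G (xm, ym) -> G (xp, yp) ->
     ym <= xm -> yp <= xp -> xm < xp -> ym <= yp) /\
  (forall xm zm xp zp : R, G (xm, zm) -> G (xp, zp) ->
     xm <= zm -> xp <= zp -> xm < xp -> zm <= zp).

Definition nonincreasing_set G : Prop :=
  (forall xm yp xp ym : R, G (xm, yp) -> G (xp, ym) ->
     yp <= xm -> ym <= xp -> xm < xp -> ym <= yp) /\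
  (forall xm zp xp zm : R, G (xm, zp) -> G (xp, zm) ->
     xm <= zp -> xp <= zm -> xm < xp -> zm <= zp).

Definition nondecreasing_coupling mu nu pi : Prop :=
  martingale_coupling mu nu pi /\
  exists G, [/\ measurable G, pi G = 1%E & nondecreasing_set G].

Definition nonincreasing_coupling mu nu pi : Prop :=
  martingale_coupling mu nu pi /\
  exists G, [/\ measurable G, pi G = 1%E & nonincreasing_set G].

(* Measures are functions on all subsets, with unconstrained values outside the
   sigma-algebra, hence equality on measurable sets instead of [=]. *)
Definition the_unique (P : probability (R * R)%type R -> Prop) pi : Prop :=
  P pi /\ forall pi', P pi' ->
    forall C : set (R * R), measurable C -> pi' C = pi C.

Definition psi (rho alpha : R) : R :=
  alpha + alpha `^ (2 - rho) * (1 - alpha) `^ (rho - 1) + 1 - rho.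

End MartingaleOptimalTransport.

(* Main.v *)
Require Import Defs.
From HB Require Import structures.
From mathcomp Require Import all_boot all_order all_algebra.
From mathcomp Require Import all_classical all_reals all_analysis.
From mathcomp Require Import measurable_realfun ring lra.

Import Order.TTheory GRing.Theory Num.Theory.
Import numFieldNormedType.Exports.

Local Open Scope classical_set_scope.
Local Open Scope ring_scope.

(** Write [c(x, v) = |x - v|^rho], [L = [yl, yu]], [U = [zl, zu]]; the source
    sits between [L] and [U].  The four extremal problems are treated at once:
    a direction [tau] ([1] for non-decreasing couplings, [-1] for non-increasing
    ones) and the sign of [rho - 2] turn each of them into the minimization of
    [sgn * c] with [sgn = tau * sg (rho - 2)].

    _The monotone coupling._  Parametrize [nu] by a function [w] on ]0,1] that
    is monotone in the direction [tau] on ]0,a], with values in [L], and on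
    ]a,1], with values in [U], where [a = nu L].  Let [q x] be the mass that
    the sources [<= x] send to [L], so that [r x = mu ]-oo,x] - q x] goes to [U].
    In a [tau]-monotone coupling these sources fill ]0,q x] and ]a,a + r x] in
    the parameter of [nu]; preservation of the mean then reads
    [W (q x) + (W (a + r x) - W a) = A x], with [W] a primitive of [w] and [A x]
    the first moment of [mu] on ]-oo,x].  As [w] is below every source on ]0,a]
    and above every source on ]a,1], this equation has exactly one solution, and
    [q] and [r] are nondecreasing ([splitting_exists], [splitting_mono]).
    Inverting [q] and [r] gives the coupling; the equation determining [q] gives
    its uniqueness ([exists_monotone_coupling]).  The definition of a martingale
    coupling asks for a disintegration; it is obtained from conditional
    distribution functions ([exists_disintegration]), and the martingale property
    is used only through moments ([martingale_moment], [martingale_of_moment]).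

    _Optimality._  Let [T s v] be [T1 s = w (q s)] or [T2 s = w (a + r s)],
    according to the side of [v].  For a source [s], let [dgap s v] be the
    difference between [sgn * d/ds c(s, v)] and its chord, as a function of [v],
    through [T1 s] and [T2 s].  The two geometric conditions are what is needed
    for [dgap s v] to have the sign of [tau * (T s v - v)] ([chord_sign]): the
    inequality reduces to the tangent inequality for the power [rho - 1] and to
    the sign of [psi] on one side of its root ([bracket_gt0]).  Integrating
    [d/ds c] from [xl] to [x] yields
      [sgn * c(x, v) = A0 x + A1 x * v + A2 v + gap (x, v)] ([duality])
    with [gap (x, v)] the integral of the positive part of [dgap s v] over
    [s < x] plus that of its negative part over [s > x].  The first three terms
    have the same integral under all martingale couplings, so that the problem is
    to minimize the integral of [gap >= 0].  The set where [gap] vanishes is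
    [tau]-monotone: two of its points [(x, v)], [(x', v')] on the same side with
    [x < x'] are separated by [T s v] for almost every [s] between [x] and [x']
    ([contact_set_monotone]).  It carries the monotone coupling
    ([mono_graph_contact]), which is therefore optimal; and any optimal coupling
    is concentrated on it, hence is [tau]-monotone, hence is that coupling. *)

(** * Powers and the threshold *)

Section PowerInequalities.
Context {R : realType}.
Implicit Types p t x y z A B : R.

Lemma sgr_powRB p B A : p != 1 -> 0 < B -> B < A ->
  0 < Num.sg (p - 1) * (A `^ (p - 1) - B `^ (p - 1)).
Proof.
move=> p1 B0 BA; have A0 : 0 < A by exact: lt_trans BA.
have [p1'|p1'] : p < 1 \/ 1 < p by case: (ltgtP p 1) p1; auto.
  rewrite ltr0_sg ?subr_lt0// mulN1r opprB subr_gt0.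
  have -> : p - 1 = - (1 - p) by ring.
  rewrite !powRN ltf_pV2 ?posrE ?powR_gt0//.
  by apply: gt0_ltr_powR; rewrite ?subr_gt0 ?nnegrE ?ltW.
rewrite gtr0_sg ?subr_gt0// mul1r subr_gt0.
by apply: gt0_ltr_powR; rewrite ?subr_gt0 ?nnegrE ?ltW.
Qed.

Lemma is_derive_powR p x : 0 < x -> is_derive x 1 (@powR R ^~ p) (p * x `^ (p - 1)).
Proof.
move=> x0.
have xP : x \in `]0, +oo[ by rewrite in_itv/= x0.
apply: DeriveDef; first exact: derivable_powR.
by rewrite -derive1E powR_derive1.
Qed.

(** The power is strictly convex for [p > 1] and strictly concave for [p < 1];
    the sign factor lets one statement serve both cases. *)
Lemma powR_tangent p B A : 0 < p -> p != 1 -> 0 < B -> B < A ->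
  0 < Num.sg (p - 1) * (A `^ p - B `^ p - p * B `^ (p - 1) * (A - B)).
Proof.
move=> p0 p1 B0 BA.
have [||c] := @MVT _ (@powR R ^~ p) (fun x => p * x `^ (p - 1)) B A BA.
- by move=> x /[!in_itv]/= /andP[Bx _]; apply: is_derive_powR; exact: lt_trans Bx.
- apply: derivable_within_continuous => x /[!in_itv]/= /andP[Bx _].
  by have := @is_derive_powR p x (lt_le_trans B0 Bx) => -[].
rewrite in_itv/= => /andP[Bc cA] ->.
have := sgr_powRB _ _ _ p1 B0 Bc.
set u := c `^ _; set v := B `^ _; set e := Num.sg _ => h.
have -> : e * (p * u * (A - B) - p * v * (A - B)) = p * (A - B) * (e * (u - v)) by ring.
by rewrite mulr_gt0// mulr_gt0 ?subr_gt0.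
Qed.

(** The function [psi] up to the factor [alpha], for [rho = p + 1], in the
    variable [t = (1 - alpha) / alpha]. *)
Definition hfun p t := t `^ p - p * t + 1 - p.

Lemma sgr_cases p : p != 1 -> (p < 1 /\ Num.sg (p - 1) = -1) \/ (1 < p /\ Num.sg (p - 1) = 1).
Proof.
case: (ltgtP p 1) => // h _; [left|right]; split => //.
  by rewrite ltr0_sg ?subr_lt0.
by rewrite gtr0_sg ?subr_gt0.
Qed.

(** Replacing [t `^ p] by [t] leaves [(1 - p) * (1 + t)]. *)
Lemma hfun_lt0 p t : 0 < p -> p != 1 -> 0 <= t <= 1 -> Num.sg (p - 1) * hfun p t < 0.
Proof.
move=> p0 p1 /andP[t0 t1]; rewrite /hfun.
have [->|tn0] := eqVneq t 0.
  rewrite powR0 ?gt_eqF//.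
  by case: (sgr_cases _ p1) => -[h ->]; lra.
have tgt0 : 0 < t by rewrite lt_def tn0.
have t01 : 0 < t <= 1 by rewrite tgt0.
case: (sgr_cases _ p1) => -[h ->].
  have : t <= t `^ p by apply: ger1_powR => //; exact: ltW.
  have : 0 < (1 - p) * (1 + t) by rewrite mulr_gt0 ?subr_gt0 ?addr_gt0.
  lra.
have : t `^ p <= t by apply: ge1r_powR => //; exact: ltW.
have : 0 < (p - 1) * (1 + t) by rewrite mulr_gt0 ?subr_gt0 ?addr_gt0.
lra.
Qed.

(** The slope [p * (t `^ (p - 1) - 1)] at [t] has the sign of [p - 1], and so does
    the deviation from the tangent. *)
Lemma hfun_incr p t u : 0 < p -> p != 1 -> 1 <= t -> t < u ->
  Num.sg (p - 1) * hfun p t < Num.sg (p - 1) * hfun p u.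
Proof.
move=> p0 p1 t1 tu; have t0 : 0 < t by lra.
have := powR_tangent _ _ _ p0 p1 t0 tu; rewrite /hfun.
have : 0 <= Num.sg (p - 1) * (t `^ (p - 1) - 1).
  move: t1; rewrite le_eqVlt => /predU1P[<-|t1]; first by rewrite powR1 subrr mulr0.
  by have := sgr_powRB _ _ _ p1 ltr01 t1; rewrite powR1 => /ltW.
set e := Num.sg _; set v := t `^ (p-1); move=> h1 h2.
have h3 : 0 <= p * (u - t) * (e * (v - 1)).
  by rewrite mulr_ge0// mulr_ge0 ?subr_ge0// ltW.
rewrite -subr_gt0.
have -> : e * (u `^ p - p * u + 1 - p) - e * (t `^ p - p * t + 1 - p) =
  e * (u `^ p - t `^ p - p * v * (u - t)) + p * (u - t) * (e * (v - 1)) by ring.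
by rewrite ltr_wpDr.
Qed.

Lemma hfun_large p : 0 < p -> p != 1 ->
  exists2 t, 1 < t & 0 < Num.sg (p - 1) * hfun p t.
Proof.
move=> p0 p1; rewrite /hfun; case: (sgr_cases _ p1) => -[h ->].
  have q0 : 0 < 1 - p by lra.
  (* The witness [t] is chosen such that [t `^ p = t * (p / 2)]. *)
  have p2 : 2 / p <= (2 / p) `^ (1 - p)^-1.
    apply: le1r_powR; first by rewrite ler_pdivlMr//; lra.
    by rewrite invf_ge1//; lra.
  set t := (2 / p) `^ _ in p2.
  have t1 : 1 < t by apply: lt_le_trans p2; rewrite ltr_pdivlMr//; lra.
  have t0 : 0 < t by lra.
  exists t => //.
  have -> : t `^ p = t * (p / 2).
    rewrite -(@mulr_powRB1 _ t p) ?ltW//; congr (_ * _).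
    rewrite /t -powRrM.
    have -> : (1 - p)^-1 * (p - 1) = -1 by field; lra.
    by rewrite powR_inv1 ?divr_ge0 ?ltW// invf_div.
  have tp : 2 <= t * p by move: p2; rewrite ler_pdivrMr.
  nra.
have q0 : 0 < p - 1 by lra.
(* Here [t `^ p = t * (2 * p)]. *)
pose t := (2 * p) `^ (p - 1)^-1.
have t1 : 1 < t.
  have : 1 `^ (p - 1)^-1 < t.
    by apply: gt0_ltr_powR; rewrite ?invr_gt0// ?nnegrE; lra.
  by rewrite powR1.
exists t => //.
have t0 : 0 < t by lra.
have -> : t `^ p = t * (2 * p).
  rewrite -(@mulr_powRB1 _ t p) ?ltW//; congr (_ * _).
  by rewrite /t -powRrM mulVf ?gt_eqF// powRr1// mulr_ge0 ?ltW.
nra.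
Qed.

Lemma continuous_hfun p t : 0 < t -> {for t, continuous (hfun p)}.
Proof.
move=> t0; rewrite /hfun; apply: cvgB; last exact: cvg_cst.
apply: cvgD; last exact: cvg_cst.
apply: cvgB; last by apply: cvgM; [exact: cvg_cst|exact: cvg_id].
have [d _] := is_derive_powR p t t0.
exact: (differentiable_continuous ((derivable1_diffP _ _).1 d)).
Qed.

Lemma hfun_root p : 0 < p -> p != 1 -> exists ts, [/\ 1 < ts, hfun p ts = 0,
  forall t, 0 <= t -> hfun p t = 0 -> t = ts &
  forall t, 0 <= t <= ts -> Num.sg (p - 1) * hfun p t <= 0].
Proof.
move=> p0 p1; have [u u1 hu] := hfun_large _ p0 p1.
have h1 := hfun_lt0 _ 1 p0 p1 (introT andP (conj ler01 (lexx 1))).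
have [ts] : exists2 ts, ts \in `[1, u] & Num.sg (p - 1) * hfun p ts = 0.
  apply: (@IVT _ (fun t => Num.sg (p - 1) * hfun p t) 1 u 0 (ltW u1)).
    apply: continuous_in_subspaceT => t; rewrite inE/= in_itv/= => /andP[t1 _].
    apply: cvgM; [exact: cvg_cst|apply: continuous_hfun; lra].
  by rewrite minEle maxEle !(le_trans (ltW h1) (ltW hu)) (ltW h1) (ltW hu).
rewrite in_itv/= => /andP[t1 tu] ets.
have sg0 : Num.sg (p - 1) != 0 by rewrite sgr_eq0 subr_eq0.
have ts1 : 1 < ts.
  by rewrite lt_neqAle t1 andbT; apply/eqP => e; move: ets; rewrite -e => ets; rewrite ets ltxx in h1.
exists ts; split => //.
- by move/eqP: ets; rewrite mulf_eq0 (negbTE sg0) => /eqP.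
- move=> t t0 ht; have [tle1|tgt1] := leP t 1.
    by have := hfun_lt0 _ t p0 p1; rewrite t0 tle1 ht mulr0 ltxx => /(_ isT).
  case: (ltgtP t ts) => // h.
    by have := hfun_incr _ _ _ p0 p1 (ltW tgt1) h; rewrite ets ht mulr0 ltxx.
  by have := hfun_incr _ _ _ p0 p1 t1 h; rewrite ets ht mulr0 ltxx.
- move=> t /andP[t0 tts]; have [tle1|tgt1] := leP t 1.
    by apply/ltW/hfun_lt0 => //; rewrite t0.
  move: tts; rewrite le_eqVlt => /predU1P[->|h]; first by rewrite ets.
  by have := hfun_incr _ _ _ p0 p1 (ltW tgt1) h; rewrite ets => /ltW.
Qed.

Lemma psi_hfun rho alpha : 0 < alpha <= 1 ->
  psi rho alpha = alpha * hfun (rho - 1) ((1 - alpha) / alpha).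
Proof.
move=> /andP[a0 a1]; rewrite /psi /hfun powRM ?subr_ge0 ?invr_ge0 ?(ltW a0)//.
have -> : alpha `^ (2 - rho) = alpha * (alpha^-1) `^ (rho - 1).
  rewrite -(powR_inv1 (ltW a0)) -powRrM -{2}(powRr1 (ltW a0)) -powRD.
    by congr (_ `^ _); ring.
  by rewrite (gt_eqF a0) implybT.
by field; rewrite gt_eqF.
Qed.

(** With [b = x - y2] and [t = (z - x) / b], the bracket is [z - y2] times the
    tangent gap of the power between [b] and [x - y1], minus
    [(y2 - y1) * b `^ p * hfun p t].  Both contributions have the sign of [p - 1],
    and the last hypothesis says [t <= ts]. *)
Lemma bracket_gt0 p ts y1 y2 x z : 0 < p -> p != 1 ->
  (forall t, 0 <= t <= ts -> Num.sg (p - 1) * hfun p t <= 0) ->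
  y1 < y2 -> y2 < x -> x < z -> z - x <= ts * (x - y2) ->
  0 < Num.sg (p - 1) * ((z - y2) * (x - y1) `^ p - (y2 - y1) * (z - x) `^ p
                        - (z - y1) * (x - y2) `^ p).
Proof.
move=> p0 p1 hts y12 y2x xz zts.
have b0 : 0 < x - y2 by lra.
have ba : x - y2 < x - y1 by lra.
have := powR_tangent _ _ _ p0 p1 b0 ba.
have /hts : 0 <= (z - x) / (x - y2) <= ts.
  by rewrite divr_ge0 ?ler_pdivrMr//; lra.
rewrite /hfun powRM ?invr_ge0; [|lra|lra].
rewrite -(@mulr_powRB1 _ (x - y2) p)//; last by lra.
have -> : ((x - y2)^-1) `^ p = (x - y2)^-1 * ((x - y2) `^ (p - 1))^-1.
  rewrite -powR_inv1 ?ltW// -powRrM -powRN -powRD; last by rewrite (gt_eqF b0) implybT.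
  by congr (_ `^ _); ring.
have : 0 < (x - y2) `^ (p - 1) by rewrite powR_gt0.
set e := Num.sg _; set b := (x - y2) `^ _; set c := (z - x) `^ p; set d := (x - y1) `^ p.
move=> b'0 h1 h2.
set B := x - y2 in b0 ba h1 h2 *.
have h3 : 0 < (z - y2) * (e * (d - B * b - p * b * (x - y1 - B))).
  by rewrite mulr_gt0//; rewrite /B in b0 *; lra.
have h4 : 0 <= - ((y2 - y1) * (b * B) *
    (e * (c * (B^-1 * b^-1) - p * ((z - x) / B) + 1 - p))).
  rewrite oppr_ge0 mulr_ge0_le0// !mulr_ge0 ?ltW//; lra.
apply: lt_le_trans (ltr_wpDr h4 h3) _.
rewrite le_eqVlt; apply/orP; left; apply/eqP.
have -> : c * (B^-1 * b^-1) - p * ((z - x) / B) + 1 - p =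
  (c - p * (z - x) * b + (1 - p) * (b * B)) / (b * B).
  by field; rewrite !gt_eqF.
have -> : (y2 - y1) * (b * B) * (e * ((c - p * (z - x) * b + (1 - p) * (b * B)) / (b * B))) =
   (y2 - y1) * (e * (c - p * (z - x) * b + (1 - p) * (b * B))).
  by field; rewrite !gt_eqF.
rewrite /B; ring.
Qed.

End PowerInequalities.

(** * Measures determined by few sets *)

Section MeasurableComparisons.
Context d (T : measurableType d) {R : realType}.
Implicit Types f g : T -> R.

Lemma measurable_set_lt f g : measurable_fun setT f -> measurable_fun setT g ->
  measurable [set x | f x < g x].
Proof.
move=> mf mg; rewrite -[X in measurable X]setTI.
exact: (measurable_fun_ltr mf mg measurableT (Y := [set true])).
Qed.

Lemma measurable_set_le f g : measurable_fun setT f -> measurable_fun setT g ->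
  measurable [set x | f x <= g x].
Proof.
move=> mf mg; rewrite -[X in measurable X]setTI.
exact: (measurable_fun_ler mf mg measurableT (Y := [set true])).
Qed.

End MeasurableComparisons.

Section MeasureUniqueness.
Context {R : realType}.

Lemma setI_rays_open : setI_closed [set A : set R | exists x, A = `]-oo, x[%classic].
Proof.
move=> _ _ [x ->] [y ->]; exists (Num.min x y).
apply/seteqP; split => z/=; rewrite !in_itv/= lt_min; first by move=> [-> ->].
by move=> /andP[-> ->].
Qed.

Lemma measure_eq_open_rays (m1 m2 : {measure set R -> \bar R}) :
  (m1 setT < +oo)%E -> (forall t, m1 `]-oo, t[%classic = m2 `]-oo, t[%classic) ->
  forall B, measurable B -> m1 B = m2 B.
Proof.
move=> fin m12.
apply: (measure_unique (@RGenInftyO.G R) (fun n => `]-oo, n%:R[%classic)).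
- exact: RGenInftyO.measurableE.
- exact: setI_rays_open.
- by move=> i; exists i%:R.
- apply/seteqP; split => // x _; exists (Num.truncn `|x|).+1 => //=.
  by rewrite in_itv/= (le_lt_trans (ler_norm x))// truncnS_gt.
- by move=> _ [t ->].
- by move=> k; apply: le_lt_trans fin; apply: le_measure; rewrite ?inE.
Qed.

Lemma measure_eq_closed_rays (m1 m2 : {measure set R -> \bar R}) :
  (m1 setT < +oo)%E -> (forall t, m1 `]-oo, t]%classic = m2 `]-oo, t]%classic) ->
  forall B, measurable B -> m1 B = m2 B.
Proof.
move=> fin m12; apply: measure_eq_open_rays => // t.
have E : `]-oo, t[%classic = \bigcup_n `]-oo, t - n.+1%:R^-1]%classic :> set R.
  apply/seteqP; split => x/=.
    rewrite in_itv/= => /ltr_add_invr[n xn]; exists n => //=.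
    by rewrite in_itv/= lerBrDr ltW.
  by move=> [n _] /=; rewrite !in_itv/= => /le_lt_trans; apply; rewrite ltrBlDr ltrDl.
have nd : nondecreasing_seq (fun n => `]-oo, t - n.+1%:R^-1]%classic : set R).
  move=> m n mn; apply/subsetPset => x/=; rewrite !in_itv/= => /le_trans; apply.
  by rewrite lerD2l lerN2 lef_pV2 ?posrE// ler_nat.
have c1 := @nondecreasing_cvg_mu _ _ _ m1 _ (fun i => measurable_itv _) (bigcup_measurable (fun i _ => measurable_itv _)) nd.
have c2 := @nondecreasing_cvg_mu _ _ _ m2 _ (fun i => measurable_itv _) (bigcup_measurable (fun i _ => measurable_itv _)) nd.
rewrite E -(cvg_lim _ c1)// -(cvg_lim _ c2)//.
by congr (limn _); apply/funext => n /=; rewrite m12.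
Qed.

End MeasureUniqueness.

(** * Integration against a disintegration *)

Section PairKernel.
Context {R : realType}.
Variable (k : R.-pker R ~> R).

Lemma measurable_pair_of (x : R) : measurable_fun [set: R] (fun y : R => (x, y)).
Proof. exact: measurable_pair1. Qed.

Definition pair_of (x : R) : {mfun R >-> (R * R)%type} :=
  mfun_Sub (mem_set (measurable_pair_of x)).

(** The measure [k x] under a name to which a probability structure can be
    attached. *)
Definition kernel_law (x : R) : set R -> \bar R := k x.

HB.instance Definition _ x := Measure.on (kernel_law x).
HB.instance Definition _ x :=
  Measure_isProbability.Build _ _ _ (kernel_law x) (prob_kernel x).

(** The Dirac mass at [x] times [k x].  The unit component is the dummy parameter
    that composition of kernels expects. *)
Definition kpair (ux : unit * R) : {measure set (R * R) -> \bar R} :=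
  distribution (kernel_law ux.2) (pair_of ux.2).

Lemma kpairE ux (C : set (R * R)) : kpair ux C = k ux.2 (xsection C ux.2).
Proof. by rewrite /kpair /= /distribution /pushforward; congr (k _ _); rewrite xsectionE. Qed.

Lemma measurable_kpair U : measurable U -> measurable_fun [set: unit * R] (kpair ^~ U).
Proof.
move=> mU; rewrite (_ : kpair ^~ U = (fun x => k x (xsection U x)) \o snd).
  apply: measurableT_comp => //.
  by apply: measurable_fun_xsection_finite_kernel; rewrite inE.
by apply/funext => ux; rewrite kpairE.
Qed.

HB.instance Definition _ := isKernel.Build _ _ _ _ _ kpair measurable_kpair.

Lemma kpair_setT ux : kpair ux setT = 1%E.
Proof. exact: probability_setT. Qed.

HB.instance Definition _ := Kernel_isProbability.Build _ _ _ _ _ kpair kpair_setT.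

End PairKernel.

Section Mixture.
Context {R : realType}.
Implicit Types (mu : probability R R) (pi : probability (R * R)%type R) (k : R.-pker R ~> R).

(** The measure [mu(dx) k_x(dy)]. *)
Definition mixture mu k : {measure set (R * R) -> \bar R} :=
  mkcomp (kprobability (@measurable_cst _ _ unit (pprobability R R) setT (mu : pprobability R R))) (kpair k) tt.

Lemma mixtureE mu k C : mixture mu k C = (\int[mu]_x k x (xsection C x))%E.
Proof. by apply: eq_integral => x _; rewrite kpairE. Qed.

Lemma integral_mixture mu k (f : R * R -> \bar R) :
  (forall p, 0 <= f p)%E -> measurable_fun setT f ->
  (\int[mixture mu k]_p f p = \int[mu]_x \int[k x]_y f (x, y))%E.
Proof.
move=> f0 mf; rewrite [LHS]integral_kcomp//; apply: eq_integral => x _.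
by rewrite ge0_integral_pushforward//.
Qed.

Lemma disintegration_integral mu pi k (f : R * R -> \bar R) :
  disintegration mu pi k ->
  (forall p, 0 <= f p)%E -> measurable_fun setT f ->
  (\int[pi]_p f p = \int[mu]_x \int[k x]_y f (x, y))%E.
Proof.
move=> dis f0 mf; rewrite -integral_mixture//; apply: eq_measure_integral => C mC _.
by rewrite mixtureE; exact: dis.
Qed.

Lemma product_measure_eq (m1 m2 : {measure set (R * R) -> \bar R}) :
  (m1 setT < +oo)%E ->
  (forall A B, measurable A -> measurable B -> m1 (A `*` B) = m2 (A `*` B)) ->
  forall C, measurable C -> m1 C = m2 C.
Proof.
move=> fin m12.
apply: (measure_unique [set A `*` B | A in measurable & B in measurable] (fun=> setT)) => //.
- exact: measurable_prod_measurableType.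
- move=> _ _ [A1 mA1 [B1 mB1 <-]] [A2 mA2 [B2 mB2 <-]]; rewrite -setXI.
  by exists (A1 `&` A2); [exact: measurableI|exists (B1 `&` B2) => //; exact: measurableI].
- by move=> _; exists setT => //; exists setT => //; rewrite setXTT.
- by rewrite bigcup_const//; exists 0%N.
- by move=> _ [A mA [B mB <-]]; exact: m12.
Qed.

End Mixture.

(** * Existence of disintegrations *)

Section AlmostEverywhere.
Context d (T : measurableType d) {R : realType} (mu : {measure set T -> \bar R}).

Lemma ae_forall_countable (I : countType) (P : I -> T -> Prop) :
  (forall i, {ae mu, forall x, P i x}) -> {ae mu, forall x, forall i, P i x}.
Proof.
move=> h; pose Q n x := if unpickle n is Some i then P i x else True.
have : {ae mu, forall x, forall n, Q n x}.
  apply/ae_foralln => n; rewrite /Q; case: (unpickle n) => [i|]; first exact: h.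
  exact: aeW.
by apply: filterS => x Qx i; have := Qx (pickle i); rewrite /Q pickleK.
Qed.

Lemma ae_exists_null_set (P : T -> Prop) : {ae mu, forall x, P x} ->
  exists N, [/\ measurable N, mu N = 0%E & forall x, ~ N x -> P x].
Proof.
move=> [N [mN N0 PN]]; exists N; split => // x Nx.
by apply: contrapT => Px; apply: Nx; exact: PN.
Qed.

Lemma ae_le_of_integral_le (f g : T -> R) :
  measurable_fun setT f -> mu.-integrable setT (EFin \o g) ->
  (forall x, 0 <= f x) -> (forall x, 0 <= g x) ->
  (forall S, measurable S ->
     (\int[mu]_(x in S) (f x)%:E <= \int[mu]_(x in S) (g x)%:E)%E) ->
  {ae mu, forall x, f x <= g x}.
Proof.
move=> mf ig f0 g0 fg.
have mg : measurable_fun setT g by have /measurable_int/measurable_EFinP := ig.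
pose D := [set x | g x < f x].
have mD : measurable D.
  by apply: measurable_set_lt.
have : ae_eq mu D (EFin \o g) (EFin \o f).
  apply: integral_ae_eq => //.
  - exact: integrableS ig.
  - by apply/measurable_funTS/measurable_EFinP.
  - move=> E ED mE; apply/eqP; rewrite eq_le fg// andbT.
    apply: ge0_le_integral => //.
    + by move=> x _; rewrite lee_fin.
    + by apply/measurable_funTS/measurable_EFinP.
    + by apply/measurable_funTS/measurable_EFinP.
    + by move=> x /ED /=; rewrite lee_fin => /ltW.
apply: filterS => x h; rewrite leNgt; apply/negP => gf.
by have := h gf => /= -[e]; rewrite /D/= e ltxx in gf.
Qed.

End AlmostEverywhere.

Section ConditionalCdf.
Context {R : realType}.
Variables (mu : probability R R) (pi : probability (R * R)%type R).
Hypothesis marginal : forall S, measurable S -> pi (S `*` setT) = mu S.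

Section Slice.
Variables (B : set R) (mB : measurable B).

(** The measurability proof is an argument so that the measure structure can be
    inferred from the term. *)
Definition slice & measurable B := fun S : set R => pi (S `*` B).
Local Notation sl := (slice mB).

Let slice0 : sl set0 = 0%E. Proof. by rewrite /slice set0X measure0. Qed.

Let slice_ge0 S : (0 <= sl S)%E. Proof. exact: measure_ge0. Qed.

Let slice_sigma_additive : semi_sigma_additive sl.
Proof.
move=> F mF tF mUF; rewrite /slice setX_bigcupl; apply: measure_semi_sigma_additive.
- by move=> i; exact: measurableX.
- move=> i j _ _ [[x y] [[/= Fi _] [Fj _]]]; apply: tF => //.
  by exists x.
- by rewrite -setX_bigcupl; exact: measurableX.
Qed.

HB.instance Definition _ := isMeasure.Build _ _ _ sl slice0 slice_ge0 slice_sigma_additive.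

Let slice_fin : fin_num_fun sl.
Proof. by move=> S mS; apply: fin_num_measure; exact: measurableX. Qed.

HB.instance Definition _ := Measure_isFinite.Build _ _ _ sl slice_fin.

Lemma slice_le S : measurable S -> (sl S <= mu S)%E.
Proof.
move=> mS; rewrite -marginal//; apply: le_measure; rewrite ?inE; try exact: measurableX.
by move=> [x y] [].
Qed.

(** Radon-Nikodym: [pi (S `*` B)] is at most [mu S]. *)
Lemma slice_density : exists f : R -> R, [/\ measurable_fun setT f,
  forall x, 0 <= f x, mu.-integrable setT (EFin \o f) &
  forall S, measurable S -> pi (S `*` B) = (\int[mu]_(x in S) (f x)%:E)%E].
Proof.
have [|f [f0 ffin fi fS]] := @radon_nikodym_sigma_finite _ _ _ mu sl.
  apply/null_content_dominatesP => S mS /= muS.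
  by apply/eqP; rewrite -measure_le0 -muS; exact: slice_le.
have fE : EFin \o (fine \o f) = f by apply/funext => x /=; rewrite fineK.
exists (fine \o f); split.
- by apply/measurable_EFinP; rewrite fE; exact: measurable_int fi.
- by move=> x; rewrite /= fine_ge0.
- by rewrite fE.
- move=> S mS; rewrite -[LHS]/(sl S) fS//.
  by apply: eq_integral => x _ /=; rewrite fineK.
Qed.

End Slice.

(** Countably many levels make it possible to discard one null set outside which
    the densities form a distribution function. *)
Lemma conditional_cdf : exists F : rat -> R -> R,
  [/\ forall r, measurable_fun setT (F r), forall r x, 0 <= F r x <= 1,
      forall r r' x, r <= r' -> F r x <= F r' x &
      forall r S, measurable S ->
        pi (S `*` `]-oo, ratr r]%classic) = (\int[mu]_(x in S) (F r x)%:E)%E].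
Proof.
have mray (r : rat) : measurable (`]-oo, ratr r]%classic : set R) by [].
pose f r := sval (cid (slice_density _ (mray r))).
have mf r : measurable_fun setT (f r) by rewrite /f; case: cid => g /= [].
have f0 r x : 0 <= f r x by rewrite /f; case: cid => g /= [].
have fi r : mu.-integrable setT (EFin \o f r) by rewrite /f; case: cid => g /= [].
have fE r S : measurable S ->
    pi (S `*` `]-oo, ratr r]%classic) = (\int[mu]_(x in S) (f r x)%:E)%E.
  by rewrite /f; case: cid => g /= [_ _ _]; exact.
have le1 : {ae mu, forall x, forall r, f r x <= 1}.
  apply: ae_forall_countable => r; apply: (ae_le_of_integral_le _ _ mu (f r) (cst 1)) => //.
    exact: finite_measure_integrable_cst.
  move=> S mS; suff : (pi (S `*` `]-oo, ratr r]%classic) <= mu S)%E by rewrite -fE// (integral_cst _ mS 1%:E) mul1e.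
  by rewrite -marginal//; apply: le_measure; rewrite ?inE; [exact: measurableX..|move=> [x y] []].
have mon : {ae mu, forall x, forall rr : rat * rat, rr.1 <= rr.2 -> f rr.1 x <= f rr.2 x}.
  apply: ae_forall_countable => -[r r'] /=.
  have [rr'|rr'] := boolP (r <= r'); last by exact: aeW.
  apply: filterS (ae_le_of_integral_le _ _ mu (f r) (f r') _ _ _ _ _) => //.
  move=> S mS; rewrite -!fE//.
  apply: le_measure; rewrite ?inE; [exact: measurableX..|move=> [x y] /= [Sx]].
  rewrite /= in_itv/= => yr; split => //=.
  by rewrite /= in_itv/= (le_trans yr)// ler_rat.
have [N [mN N0 NP]] := ae_exists_null_set _ _ _ _ (filterI le1 mon).
(* Zero on the exceptional set, so that bounds and monotonicity hold everywhere. *)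
pose F r x := if x \in N then 0 else f r x.
exists F; split.
- move=> r; apply: measurable_fun_ifT => //.
  by apply: (measurable_fun_bool true); rewrite setTI preimage_mem_true.
- move=> r x; rewrite /F; case: ifPn => [_|/negP]; first by rewrite lexx ler01.
  by rewrite inE => /NP [+ _] => ->; rewrite f0.
- move=> r r' x rr'; rewrite /F; case: ifPn => // /negP.
  by rewrite inE => /NP [_ /(_ (r, r') rr')].
- move=> r S mS; rewrite fE//.
  apply: ae_eq_integral => //.
  + by apply/measurable_funTS/measurable_EFinP.
  + apply/measurable_funTS/measurable_EFinP; apply: measurable_fun_ifT => //.
    by apply: (measurable_fun_bool true); rewrite setTI preimage_mem_true.
  + exists N; split => // x /= h; apply: contrapT => Nx; apply: h => _.
    by rewrite /F memNset.
Qed.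

End ConditionalCdf.

Section Unif.
Context {R : realType}.

(** The uniform law, on the same measurable structure of [R] as [mu] and [nu]. *)
Definition unif01 : set R -> \bar R := fun A => lebesgue_measure (A `&` `]0, 1]).

Let unif01_0 : unif01 set0 = 0%E. Proof. by rewrite /unif01 set0I measure0. Qed.

Let unif01_ge0 A : (0 <= unif01 A)%E. Proof. exact: measure_ge0. Qed.

Let unif01_sigma_additive : semi_sigma_additive unif01.
Proof.
exact: (@measure_semi_sigma_additive _ _ _
  (mrestr lebesgue_measure (measurable_itv `]0:R, 1]))).
Qed.

HB.instance Definition _ :=
  isMeasure.Build _ _ _ unif01 unif01_0 unif01_ge0 unif01_sigma_additive.

Let unif01_setT : unif01 setT = 1%E.
Proof. by rewrite /unif01 setTI /= lebesgue_measure_itv/= lte01 sube0. Qed.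

HB.instance Definition _ := Measure_isProbability.Build _ _ _ unif01 unif01_setT.

Lemma unif01_le t : 0 <= t <= 1 -> unif01 [set s | s <= t] = t%:E.
Proof.
move=> /andP[t0 t1]; rewrite /unif01.
rewrite (_ : _ `&` _ = `]0, t]%classic); last first.
  apply/seteqP; split => s /=; rewrite !in_itv/=; first by move=> [-> /andP[->]].
  by move=> /andP[-> st]; rewrite st (le_trans st t1).
rewrite lebesgue_measure_itv/= lte_fin.
by case: ltgtP t0 => // [_ _|<- _]; rewrite ?sube0.
Qed.

End Unif.

Section Probability1.
Context d (T : measurableType d) {R : realType} (P : probability T R).

Lemma prob1_setI (D : set T) : measurable D -> P D = 1%E ->
  forall A, measurable A -> P (A `&` D) = P A.
Proof.
move=> mD PD A mA.
have PDC : P (~` D) = 0%E by rewrite probability_setC// PD subee.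
rewrite [RHS](measureDI P mA mD) addeC.
rewrite [X in (_ + X)%E](_ : _ = 0%E) ?adde0//.
apply/eqP; rewrite -measure_le0 -PDC; apply: le_measure; rewrite ?inE.
- exact: measurableD.
- exact: measurableC.
- by move=> x [].
Qed.

End Probability1.

Section RationalApproximation.
Context {R : realType}.

(** Turns the union over rationals that defines the conditional quantile into a
    monotone limit. *)
Lemma increasing_rational_seq (c t : R) : c < t -> exists u : nat -> rat,
  [/\ nondecreasing_seq u, forall n, c < ratr (u n) < t &
      forall y, y < t -> exists n, y < ratr (u n)].
Proof.
move=> ct.
have ex n : exists q : rat, Num.max c (t - n.+1%:R^-1) < ratr q < t.
  have : Num.max c (t - n.+1%:R^-1) < t by rewrite gt_max ct/= ltrBlDr ltrDl.
  by move=> /rat_in_itvoo[q]; rewrite in_itv/=; exists q.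
pose v n := sval (cid (ex n)).
have vP n : Num.max c (t - n.+1%:R^-1) < ratr (v n) < t by rewrite /v; case: cid.
pose u := fix u n := if n is m.+1 then Num.max (u m) (v n) else v 0%N.
have uv n : v n <= u n by case: n => //= n; rewrite le_max lexx orbT.
exists u; split.
- by apply/nondecreasing_seqP => n /=; rewrite le_max lexx.
- elim => [|n /andP[h1 h2]] /=.
    by have /andP[+ ->] := vP 0%N; rewrite gt_max => /andP[-> _].
  have /andP[+ h3] := vP n.+1; rewrite gt_max => /andP[h4 _].
  by rewrite /Num.max; case: ifP => _; rewrite ?h1 ?h4.
- move=> y /ltr_add_invr[n yn]; exists n.
  have /andP[+ _] := vP n; rewrite gt_max => /andP[_ h].
  apply: (@lt_le_trans _ _ (ratr (v n))); last by rewrite ler_rat.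
  by apply: lt_trans h; rewrite ltrBrDr.
Qed.

End RationalApproximation.

Section KernelOfMap.
Context {R : realType}.
Variables (Q : R * R -> R) (mQ : measurable_fun setT Q).

Lemma measurable_partial x : measurable_fun setT (fun s => Q (x, s)).
Proof. exact: measurableT_comp. Qed.

Definition partial_map x : {mfun R >-> R} := mfun_Sub (mem_set (measurable_partial x)).

Definition map_kernel & measurable_fun setT Q := fun x : R =>
  distribution (@unif01 R) (partial_map x) : {measure set R -> \bar R}.

Local Notation k := (map_kernel mQ).

Lemma map_kernelE x B : k x B = unif01 [set s | B (Q (x, s))].
Proof. by []. Qed.

Lemma measurable_map_kernel U : measurable U -> measurable_fun [set: R] (k ^~ U).
Proof.
move=> mU.
have -> : k ^~ U = (fun x => unif01 (xsection (Q @^-1` U) x)).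
  by apply/funext => x; rewrite map_kernelE xsectionE.
apply: measurable_fun_xsection.
by rewrite -[X in measurable X]setTI; exact: mQ.
Qed.

HB.instance Definition _ := isKernel.Build _ _ _ _ _ k measurable_map_kernel.

Let map_kernel_setT x : k x setT = 1%E.
Proof. exact: probability_setT. Qed.

HB.instance Definition _ := Kernel_isProbability.Build _ _ _ _ _ k map_kernel_setT.

Definition map_pkernel : R.-pker R ~> R := k.

Lemma map_pkernelE x B : map_pkernel x B = unif01 [set s | B (Q (x, s))].
Proof. by []. Qed.

End KernelOfMap.

Section ConditionalQuantile.
Context {R : realType}.
Variables (c d : R) (F : rat -> R -> R).
Hypothesis cd : c <= d.
Hypothesis mF : forall r, measurable_fun setT (F r).

(** The point [d] keeps the set nonempty, and the bound [c] keeps it bounded below,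
    so that its infimum is meaningful for every source, not only almost surely. *)
Definition quantile_set (p : R * R) : set R :=
  [set t | t = d \/ exists r : rat, [/\ t = ratr r, c <= t & p.2 <= F r p.1]].

Definition cond_quantile (p : R * R) := inf (quantile_set p).

Lemma cond_quantile_lt p t : cond_quantile p < t <->
  (d < t \/ exists r : rat, [/\ c <= ratr r, ratr r < t & p.2 <= F r p.1]).
Proof.
have lb : has_lbound (quantile_set p).
  by exists c => y [->//|[r [-> ? _]]].
split.
- move=> /inf_lt [|y [->|[r [-> cr pF]]] yt]; first by exists d; left.
    by left.
  by right; exists r.
- case => [dt|[r [cr rt pF]]].
    by apply: le_lt_trans dt; apply: ge_inf => //; left.
  by apply: le_lt_trans rt; apply: ge_inf => //; right; exists r.
Qed.

Lemma measurable_cond_quantile : measurable_fun setT cond_quantile.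
Proof.
apply: (measurability _ (RGenInftyO.measurableE R)) => _ [_ [t ->] <-].
rewrite setTI.
have -> : cond_quantile @^-1` `]-oo, t[%classic =
   [set _ | d < t] `|` \bigcup_r ([set _ | c <= ratr r < t] `&` [set p | p.2 <= F r p.1]).
  apply/seteqP; split => p /=; rewrite in_itv/=.
    move=> /cond_quantile_lt [|[r [h1 h2 h3]]]; first by left.
    by right; exists r => //; split => //=; rewrite h1.
  move=> [h|[r _ /= [/andP[h1 h2] h3]]]; apply/cond_quantile_lt; first by left.
  by right; exists r.
have mcst (b : bool) : measurable [set _ : R * R | b].
  by case: b; [rewrite (_ : mkset _ = setT)|rewrite (_ : mkset _ = set0)] => //; apply/seteqP; split.
apply: measurableU; first exact: mcst.
apply: bigcupT_measurable_rat => r; apply: measurableI; first exact: mcst.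
apply: measurable_set_le; first exact: measurable_snd.
by apply: measurableT_comp => //; exact: measurable_fst.
Qed.

End ConditionalQuantile.

Section SecondSlice.
Context {R : realType} (m : {measure set (R * R) -> \bar R}).
Variables (A : set R) (mA : measurable A).

Definition second_slice & measurable A := fun B : set R => m (A `*` B).
Local Notation sl := (second_slice mA).

Let slice0 : sl set0 = 0%E. Proof. by rewrite /second_slice setX0 measure0. Qed.

Let slice_ge0 B : (0 <= sl B)%E. Proof. exact: measure_ge0. Qed.

Let slice_sigma_additive : semi_sigma_additive sl.
Proof.
move=> G mG tG mUG; rewrite /second_slice setX_bigcupr; apply: measure_semi_sigma_additive.
- by move=> i; exact: measurableX.
- move=> i j _ _ [[x y] [[/= _ Gi] [_ Gj]]]; apply: tG => //.
  by exists y.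
- by rewrite -setX_bigcupr; exact: measurableX.
Qed.

HB.instance Definition _ := isMeasure.Build _ _ _ sl slice0 slice_ge0 slice_sigma_additive.

End SecondSlice.

Section DisintegrationExists.
Context {R : realType}.

(** The kernel is the law of the conditional quantile at a uniform variable; it is
    compared with [pi] on products of a measurable set and an open ray. *)
Lemma exists_disintegration (mu : probability R R) (pi : probability (R * R)%type R) (c d : R) :
  c <= d ->
  (forall S, measurable S -> pi (S `*` setT) = mu S) ->
  pi (setT `*` `[c, d]%classic) = 1%E ->
  exists k : R.-pker R ~> R, disintegration mu pi k.
Proof.
move=> cd marginal strip.
have [F [mF F01 Fmon FE]] := conditional_cdf _ _ marginal.
have mQ := measurable_cond_quantile c d F cd mF.
exists (map_pkernel _ mQ) => C mC.
rewrite -mixtureE.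
apply: product_measure_eq => //.
  by rewrite (_ : _ setT = 1%E) ?ltry//; exact: probability_setT.
move=> A B mA mB.
have mstrip : measurable (setT `*` `[c, d] : set (R * R)) by exact: measurableX.
have piI D : measurable D -> pi D = pi (D `&` (setT `*` `[c, d])).
  by move=> mD; rewrite (prob1_setI _ _ pi _ mstrip strip).
have rays t : pi (A `*` `]-oo, t[%classic) =
    (\int[mu]_(x in A) map_pkernel _ mQ x `]-oo, t[%classic)%E.
  (* Rays outside ]c,d] are handled by the support of [pi]. *)
  have [dt|td] := ltP d t.
    transitivity (pi (A `*` setT)).
      rewrite piI; last exact: measurableX.
      rewrite [RHS]piI; last exact: measurableX.
      congr (pi _); apply/seteqP; split => -[x y] /= [[Ax yt] [_ ycd]]; split => //.
      split => //; move: ycd; rewrite /= !in_itv/= => /andP[_ /le_lt_trans]; exact.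
    rewrite marginal// -[LHS]mul1e -integral_cst//; apply: eq_integral => x _.
    rewrite map_pkernelE (_ : [set s | _] = setT) ?probability_setT//.
    by apply/seteqP; split => // s _ /=; rewrite in_itv/=; apply/(cond_quantile_lt _ _ _ cd); left.
  have [tc|ct] := leP t c.
    transitivity (0 : \bar R)%E.
      rewrite piI; last exact: measurableX.
      rewrite (_ : _ `&` _ = set0) ?measure0//; apply/seteqP; split => // -[x y] /= [[Ax yt] [_ ycd]].
      by move: yt ycd; rewrite /= !in_itv/= => yt /andP[cy _]; lra.
    rewrite integral0_eq// => x _; rewrite map_pkernelE (_ : [set s | _] = set0) ?measure0//.
    apply/seteqP; split => // s /=; rewrite in_itv/= => /(cond_quantile_lt _ _ _ cd)[dt|[r [cr rt _]]]; lra.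
  have [u [und ubd ucof]] := increasing_rational_seq _ _ ct.
  have kE x : map_pkernel _ mQ x `]-oo, t[%classic = limn (fun n => (F (u n) x)%:E).
    rewrite map_pkernelE.
    have -> : [set s | `]-oo, t[%classic (cond_quantile c d F (x, s))] =
        \bigcup_n [set s | s <= F (u n) x].
      apply/seteqP; split => s /=; rewrite in_itv/=.
        move=> /(cond_quantile_lt _ _ _ cd)[|[r [cr rt sF]]]; first by move=> ?; lra.
        have [n rn] := ucof _ rt; exists n => //=; apply: le_trans sF _.
        by apply: Fmon; apply/ltW; rewrite -(@ltr_rat R).
      move=> [n _ /= sF]; apply/(cond_quantile_lt _ _ _ cd); right.
      by exists (u n); have /andP[h1 ->] := ubd n; rewrite (ltW h1).
    have mm n : measurable [set s | s <= F (u n) x].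
      by apply: measurable_set_le.
    have nd : nondecreasing_seq (fun n => [set s | s <= F (u n) x]).
      by move=> m n mn; apply/subsetPset => s /= /le_trans; apply; apply: Fmon; exact: und.
    have /cvg_lim <- // := @nondecreasing_cvg_mu _ _ _ unif01 _ mm (bigcupT_measurable _ mm) nd.
    by congr (limn _); apply/funext => n /=; rewrite unif01_le.
  under eq_integral do rewrite kE.
  rewrite monotone_convergence//.
  - have -> : A `*` `]-oo, t[%classic = \bigcup_n (A `*` `]-oo, ratr (u n)]%classic).
      rewrite -setX_bigcupr; congr (_ `*` _); apply/seteqP; split => y /=; rewrite in_itv/=.
        by move=> /ucof[n yn]; exists n => //=; rewrite in_itv/= ltW.
      by move=> [n _] /=; rewrite in_itv/= => /le_lt_trans; apply; have /andP[] := ubd n.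
    have mm n : measurable (A `*` `]-oo, ratr (u n)]%classic : set (R * R)) by exact: measurableX.
    have nd : nondecreasing_seq (fun n => A `*` `]-oo, ratr (u n)]%classic : set (R * R)).
      move=> m n mn; apply/subsetPset => -[x y] [Ax yr]; split => //; move: yr.
      by rewrite /= !in_itv/= => /le_trans; apply; rewrite ler_rat; exact: und.
    have /cvg_lim <- // := @nondecreasing_cvg_mu _ _ _ pi _ mm (bigcupT_measurable _ mm) nd.
    by congr (limn _); apply/funext => n /=; rewrite FE.
  - by move=> n; apply/measurable_funTS/measurable_EFinP.
  - by move=> n x _; rewrite lee_fin; have /andP[] := F01 (u n) x.
  - by move=> x _ m n mn; rewrite lee_fin; apply: Fmon; exact: und.
have mixX B' : measurable B' -> mixture mu (map_pkernel _ mQ) (A `*` B') =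
    (\int[mu]_(x in A) map_pkernel _ mQ x B')%E.
  move=> mB'; rewrite mixtureE [RHS]integral_mkcond; apply: eq_integral => x _.
  rewrite patchE; case: ifPn => xA; first by rewrite in_xsectionX.
  by rewrite notin_xsectionX// measure0.
apply: (measure_eq_open_rays (second_slice pi A mA)
  (second_slice (mixture mu (map_pkernel _ mQ)) A mA)) => //.
- apply: le_lt_trans (_ : _ <= 1)%E (ltry _).
  by apply: probability_le1; exact: measurableX.
- by move=> t; apply: etrans (rays t) _; rewrite -mixX.
Qed.

End DisintegrationExists.

(** * Expectations of bounded measurable functions *)

Section BoundedMeasurable.
Context d (T : measurableType d) {R : realType}.
Implicit Types f g : T -> R.

Definition bmeas f := measurable_fun setT f /\ exists M, forall x, `|f x| <= M.

Lemma bmeas_cst r : bmeas (cst r).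
Proof. by split => //; exists `|r|. Qed.

Lemma bmeasD f g : bmeas f -> bmeas g -> bmeas (fun x => f x + g x).
Proof.
move=> [mf [M fM]] [mg [N gN]]; split; first exact: measurable_funD.
by exists (M + N) => x; rewrite (le_trans (ler_normD _ _))// lerD.
Qed.

Lemma bmeasN f : bmeas f -> bmeas (fun x => - f x).
Proof.
move=> [mf [M fM]]; split; first exact: measurableT_comp.
by exists M => x; rewrite normrN.
Qed.

Lemma bmeasB f g : bmeas f -> bmeas g -> bmeas (fun x => f x - g x).
Proof. by move=> hf hg; apply: bmeasD => //; exact: bmeasN. Qed.

Lemma bmeasM f g : bmeas f -> bmeas g -> bmeas (fun x => f x * g x).
Proof.
move=> [mf [M fM]] [mg [N gN]]; split; first exact: measurable_funM.
by exists (M * N) => x; rewrite normrM ler_pM.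
Qed.

Lemma bmeas_indic A : measurable A -> bmeas (\1_A : T -> R).
Proof.
move=> mA; split; first exact: measurable_indic.
exists 1 => x; rewrite indicE; case: (_ \in _); rewrite ?normr1// normr0; exact: ler01.
Qed.

Lemma bmeas_bounded (f : T -> R) c e : measurable_fun setT f ->
  (forall x, c <= f x <= e) -> bmeas f.
Proof.
move=> mf h; split => //; exists (Num.max `|c| `|e|) => x.
have /andP[h1 h2] := h x; rewrite ler_norml; apply/andP; split.
  by rewrite (le_trans _ h1)// lerNl le_max -[X in _ <= X]normrN ler_norm.
by rewrite (le_trans h2)// le_max (ler_norm e) orbT.
Qed.

End BoundedMeasurable.

Lemma bmeas_comp d d' (T : measurableType d) (U : measurableType d') {R : realType}
  (f : U -> R) (g : T -> U) : bmeas _ _ f -> measurable_fun setT g ->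
  bmeas _ _ (fun x => f (g x)).
Proof.
move=> [mf [M fM]] mg; split; first exact: measurableT_comp mf mg.
by exists M => x.
Qed.

Section Expectation.
Context d (T : measurableType d) {R : realType} (m : {finite_measure set T -> \bar R}).
Implicit Types f g : T -> R.

Lemma bmeas_integrable f : bmeas _ _ f -> m.-integrable setT (EFin \o f).
Proof.
move=> [mf [M fM]]; apply: measurable_bounded_integrable => //.
  by rewrite ltey_eq fin_num_measure.
by exists M; split => [|x Mx y _ /=]; [exact: num_real|rewrite (le_trans (fM y))// ltW].
Qed.

Lemma bmeas_EFin f : bmeas _ _ f -> (\int[m]_x (f x)%:E)%E = (\int[m]_x f x)%:E.
Proof. by move=> hf; rewrite /Rintegral fineK//; apply: integrable_fin_num => //; exact: bmeas_integrable. Qed.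

Lemma bRintD f g : bmeas _ _ f -> bmeas _ _ g ->
  \int[m]_x (f x + g x) = \int[m]_x f x + \int[m]_x g x.
Proof. by move=> hf hg; rewrite RintegralD//; exact: bmeas_integrable. Qed.

Lemma bRintB f g : bmeas _ _ f -> bmeas _ _ g ->
  \int[m]_x (f x - g x) = \int[m]_x f x - \int[m]_x g x.
Proof. by move=> hf hg; rewrite RintegralB//; exact: bmeas_integrable. Qed.

Lemma bRintZ r f : bmeas _ _ f -> \int[m]_x (r * f x) = r * \int[m]_x f x.
Proof. by move=> hf; rewrite RintegralZl//; exact: bmeas_integrable. Qed.

Lemma bRint_ae f g : bmeas _ _ f -> bmeas _ _ g -> {ae m, forall x, f x = g x} ->
  \int[m]_x f x = \int[m]_x g x.
Proof.
move=> hf hg fg; rewrite /Rintegral; congr fine; apply: ae_eq_integral => //.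
- by apply/measurable_EFinP; case: hf.
- by apply/measurable_EFinP; case: hg.
- by apply: filterS fg => x /= ->.
Qed.

Lemma bRint_le f g : bmeas _ _ f -> bmeas _ _ g -> (forall x, f x <= g x) ->
  \int[m]_x f x <= \int[m]_x g x.
Proof. by move=> hf hg fg; apply: le_Rintegral => //; exact: bmeas_integrable. Qed.

Lemma bRint_eq0 f : bmeas _ _ f -> (forall x, 0 <= f x) -> \int[m]_x f x = 0 ->
  {ae m, forall x, f x = 0}.
Proof.
move=> hf f0 If; have /ae_eq_integral_abs : (\int[m]_x `|(f x)%:E| = 0)%E.
  under eq_integral do rewrite gee0_abs ?lee_fin//.
  by rewrite bmeas_EFin// If.
move=> /(_ measurableT) h; have {h}: ae_eq m setT (EFin \o f) (cst 0%E).
  by apply: h => //; apply/measurable_EFinP; case: hf.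
by apply: filterS => x /(_ I) /= [].
Qed.

Lemma bRint_indic f A : bmeas _ _ f -> measurable A ->
  \int[m]_x (\1_A x * f x) = \int[m]_(x in A) f x.
Proof.
move=> hf mA; rewrite [RHS]Rintegral_mkcond; apply: eq_Rintegral => x _.
by rewrite patchE indicE; case: ifPn => _; rewrite ?mul1r ?mul0r.
Qed.

(** Reduces moments of signed functions to moments of nonnegative ones, for which
    disintegration applies. *)
Lemma bRint_shift f g M c : bmeas _ _ f -> bmeas _ _ g ->
  \int[m]_x ((f x + M) * (g x - c)) =
  \int[m]_x (f x * g x) - c * \int[m]_x f x + \int[m]_x (M * (g x - c)).
Proof.
move=> hf hg.
have hgc : bmeas _ T (fun x => g x - c) by apply: bmeasB => //; exact: bmeas_cst.
have hM : bmeas _ T (fun x => M * (g x - c)) by apply: bmeasM => //; exact: bmeas_cst.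
have hcf : bmeas _ T (fun x => c * f x) by apply: bmeasM => //; exact: bmeas_cst.
have hfg : bmeas _ T (fun x => f x * g x) by exact: bmeasM.
rewrite -(bRintZ c f)// -(bRintB (fun x => f x * g x))//.
rewrite -(bRintD (fun x => f x * g x - c * f x))//; last exact: bmeasB.
by apply: eq_Rintegral => x _; ring.
Qed.

End Expectation.

Lemma bRint_push d d' (T : measurableType d) (U : measurableType d') {R : realType}
  (m : {finite_measure set T -> \bar R}) (m' : {finite_measure set U -> \bar R})
  (g : T -> U) (f : U -> R) : measurable_fun setT g -> bmeas _ _ f ->
  (forall B, measurable B -> m' B = m (g @^-1` B)) ->
  \int[m']_y f y = \int[m]_x f (g x).
Proof.
move=> mg hf mm'; rewrite /Rintegral; congr fine.
have := @integral_pushforward _ _ _ _ _ _ mg m setT (EFin \o f).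
rewrite preimage_setT => <- //.
- by apply: eq_measure_integral => B mB _; exact: mm'.
- by apply/measurable_EFinP; case: hf.
- by apply: bmeas_integrable; apply: bmeas_comp.
Qed.

Section Clamp.
Context {R : realType} (c e : R).
Hypothesis ce : c <= e.

(** Replacing the identity by [clamp] makes first moments integrals of a bounded
    function; on measures carried by [[c, e]] the two agree almost surely. *)
Definition clamp (y : R) := Num.max c (Num.min y e).

Lemma clamp_itv y : c <= clamp y <= e.
Proof. by rewrite /clamp le_max lexx/= ge_max ce ge_min lexx orbT. Qed.

Lemma clamp_id y : c <= y <= e -> clamp y = y.
Proof. by move=> /andP[cy ye]; rewrite /clamp (min_idPl ye) (max_idPr cy). Qed.

Lemma clamp_nd : {homo clamp : x y / x <= y}.
Proof.
by move=> x y xy; rewrite /clamp ge_max !le_max lexx/= le_min !ge_min lexx xy !orbT.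
Qed.

Lemma measurable_clamp : measurable_fun setT clamp.
Proof. by apply: measurable_maxr => //; exact: measurable_minr. Qed.

Lemma bmeas_clamp : bmeas _ _ clamp.
Proof. apply: bmeas_bounded; [exact: measurable_clamp|exact: clamp_itv]. Qed.

End Clamp.

(** * Martingale couplings through moments *)

Section Prob1Ae.
Context d (T : measurableType d) {R : realType} (P : probability T R).

Lemma prob1_ae (D : set T) : measurable D -> P D = 1%E -> {ae P, forall x, D x}.
Proof.
move=> mD PD; exists (~` D); split => //; first exact: measurableC.
by rewrite probability_setC// PD subee.
Qed.

Lemma prob1_of_setC (D : set T) : measurable D -> P (~` D) = 0%E -> P D = 1%E.
Proof.
move=> mD; rewrite probability_setC//.
have : P D \is a fin_num by exact: fin_num_measure.
by case: (P D) => // r _ [h]; congr (_%:E); lra.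
Qed.

Lemma ae_prob1 (D : set T) : measurable D -> {ae P, forall x, D x} -> P D = 1%E.
Proof.
move=> mD [N [mN N0 DN]]; apply: prob1_of_setC => //.
by apply/eqP; rewrite -measure_le0 -N0; apply: le_measure; rewrite ?inE//; exact: measurableC.
Qed.

End Prob1Ae.

Lemma superset_prob1 {R : realType} (P : probability R R) A c e : measurable A -> P A = 1%E ->
  A `<=` `[c, e]%classic -> P `[c, e]%classic = 1%E.
Proof.
move=> mA PA sub; apply/eqP; rewrite eq_le probability_le1//= -PA.
by apply: le_measure; rewrite ?inE//; exact: measurable_itv.
Qed.

Lemma coupling_prod_support {R : realType} (mu nu : probability R R)
    (pi : probability (R * R)%type R) (A B : set R) : coupling mu nu pi ->
  measurable A -> measurable B -> mu A = 1%E -> nu B = 1%E -> pi (A `*` B) = 1%E.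
Proof.
move=> [c1 c2] mA mB A1 B1.
have -> : A `*` B = (setT `*` B) `&` (A `*` setT).
  by apply/seteqP; split => -[u v] /= [h1 h2]; split => //; [case: h2|case: h1].
rewrite (prob1_setI _ _ pi); [|exact: measurableX| |exact: measurableX].
  by rewrite -B1; exact: c2.
by rewrite -A1; exact: c1.
Qed.

Section MartingaleMoments.
Context {R : realType}.
Variables (c e : R) (ce : c <= e).
Local Notation cl := (clamp c e).
Local Notation mcl := (measurable_clamp c e).
Variables (mu nu : probability R R) (pi : probability (R * R)%type R).
Hypothesis mu1 : mu `[c, e]%classic = 1%E.
Hypothesis nu1 : nu `[c, e]%classic = 1%E.

Lemma coupling_strip : coupling mu nu pi -> pi (setT `*` `[c, e]%classic) = 1%E.
Proof. by move=> [_ ->]. Qed.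

Lemma coupling_fst (f : R -> R) : coupling mu nu pi -> bmeas _ _ f ->
  \int[pi]_p f p.1 = \int[mu]_x f x.
Proof.
move=> [h _] hf; rewrite (bRint_push _ _ _ _ pi mu fst)//.
move=> B mB; apply: etrans (esym (h B mB)) _; congr (pi _); apply/seteqP; split => -[x y] //=.
by case.
Qed.

Lemma coupling_snd (f : R -> R) : coupling mu nu pi -> bmeas _ _ f ->
  \int[pi]_p f p.2 = \int[nu]_y f y.
Proof.
move=> [_ h] hf; rewrite (bRint_push _ _ _ _ pi nu snd)//.
move=> B mB; apply: etrans (esym (h B mB)) _; congr (pi _); apply/seteqP; split => -[x y] //=.
by case.
Qed.

Lemma bmeas_fst (f : R -> R) : bmeas _ _ f -> bmeas _ (R * R)%type (fun p => f p.1).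
Proof. by move=> hf; apply: bmeas_comp hf _; exact: measurable_fst. Qed.

Lemma bmeas_snd (f : R -> R) : bmeas _ _ f -> bmeas _ (R * R)%type (fun p => f p.2).
Proof. by move=> hf; apply: bmeas_comp hf _; exact: measurable_snd. Qed.

Section Kernel.
Variable k : R.-pker R ~> R.
Hypothesis cpl : coupling mu nu pi.
Hypothesis dis : disintegration mu pi k.

(** Since [nu] does not charge the complement of [[c, e]], neither does almost
    every [k x]. *)
Lemma kernel_strip : {ae mu, forall x, k x `[c, e]%classic = 1%E}.
Proof.
have mC : measurable (~` `[c, e]%classic : set R) by exact: measurableC.
have mf : measurable_fun setT (fun x => k x (~` `[c, e]%classic)) by exact: measurable_kernel.
have : (\int[mu]_x `|k x (~` `[c, e]%classic)| = 0)%E.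
  under eq_integral do rewrite gee0_abs//.
  have := dis (setT `*` ~` `[c, e]%classic) (measurableX measurableT mC).
  under [X in _ = X -> _]eq_integral do rewrite in_xsectionX ?inE//.
  by move=> <-; apply: etrans (cpl.2 _ mC) _; rewrite probability_setC// nu1 subee.
move=> /(ae_eq_integral_abs _ measurableT mf); apply: filterS => x /(_ I) /= k0.
by apply: (prob1_of_setC _ _ (kernel_law k x)).
Qed.

Lemma integral_kernel_clamp x (r : R) :
  (\int[k x]_y (r * (cl y - c))%:E = (r * (\int[kernel_law k x]_y cl y - c))%:E)%E.
Proof.
have h1 : bmeas _ R cl by exact: bmeas_clamp.
have h2 : bmeas _ R (fun y => cl y - c) by apply: bmeasB => //; exact: bmeas_cst.
have h3 : bmeas _ R (fun y => r * (cl y - c)) by apply: bmeasM => //; exact: bmeas_cst.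
apply: etrans (bmeas_EFin _ _ (kernel_law k x) _ h3) _.
rewrite bRintZ// bRintB//; last exact: bmeas_cst.
by rewrite Rintegral_cst// [X in fine X](_ : _ = 1%E) ?mulr1//; exact: probability_setT.
Qed.

Lemma ae_kernel_clamp x : k x `[c, e]%classic = 1%E ->
  {ae k x, forall y, cl y = y}.
Proof.
move=> kx1; have := @prob1_ae _ _ _ (kernel_law k x) `[c, e]%classic (measurable_itv _) kx1.
by apply: filterS => y /=; rewrite in_itv/= => ?; rewrite clamp_id.
Qed.

Lemma integral_kernel_id x : k x `[c, e]%classic = 1%E ->
  (\int[k x]_y y%:E = (\int[kernel_law k x]_y cl y)%:E)%E.
Proof.
move=> kx1; rewrite -bmeas_EFin; last exact: bmeas_clamp.
apply: (@ae_eq_integral _ _ _ (k x)) => //.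
- by apply/measurable_EFinP; exact: mcl.
- by apply: filterS (ae_kernel_clamp x kx1) => y /= ->.
Qed.

Lemma integrable_kernel_id x : k x `[c, e]%classic = 1%E ->
  (k x).-integrable setT (EFin : R -> \bar R).
Proof.
move=> kx1; have h : (k x).-integrable setT (EFin \o cl).
  by apply: (bmeas_integrable _ _ (kernel_law k x)); exact: bmeas_clamp.
move/integrableP : h => [_ h]; apply/integrableP; split => //.
apply: le_lt_trans h; rewrite le_eqVlt; apply/orP; left; apply/eqP.
apply: ge0_ae_eq_integral => //; do ?[exact: measurableT_comp].
- by do 2 apply: measurableT_comp => //; exact: mcl.
- by apply: filterS (ae_kernel_clamp x kx1) => y /= ->.
Qed.

Lemma kernel_moment (H : R -> R) : bmeas _ _ H -> (forall x, 0 <= H x) ->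
  \int[pi]_p (H p.1 * (cl p.2 - c)) =
  \int[mu]_x (H x * (\int[kernel_law k x]_y cl y - c)).
Proof.
move=> hH H0; have hB : bmeas _ (R * R)%type (fun p => H p.1 * (cl p.2 - c)).
  apply: bmeasM; first exact: bmeas_fst.
  by apply: bmeasB; [apply: bmeas_snd; exact: bmeas_clamp|exact: bmeas_cst].
rewrite /Rintegral; congr fine.
have mB : measurable_fun setT (EFin \o (fun p : R * R => H p.1 * (cl p.2 - c))).
  by apply/measurable_EFinP; case: hB.
have B0 (p : R * R) : (0 <= (H p.1 * (cl p.2 - c))%:E)%E.
  by rewrite lee_fin mulr_ge0// subr_ge0; have /andP[] := clamp_itv _ _ ce p.2.
rewrite (disintegration_integral _ _ _ _ dis B0 mB) /=.
by apply: eq_integral => x _; exact: integral_kernel_clamp.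
Qed.

Let mean x : R := \int[kernel_law k x]_y cl y.

Lemma bmeas_kernel_mean : bmeas _ R mean.
Proof.
have mm : measurable_fun setT (fun x => mean x - c).
  apply/measurable_EFinP.
  have -> : EFin \o (fun x => mean x - c) = fun x => (\int[k x]_y (1 * (cl y - c))%:E)%E.
    by apply/funext => x; rewrite integral_kernel_clamp mul1r.
  apply: (measurable_fun_integral_finite_kernel (fun p : R * R => (1 * (cl p.2 - c))%:E)) => //.
    by move=> p; rewrite lee_fin mul1r subr_ge0; have /andP[] := clamp_itv _ _ ce p.2.
  apply/measurable_EFinP; apply: measurable_funM => //; apply: measurable_funB => //.
  by apply: measurableT_comp => //; exact: mcl.
have cstE r x : \int[kernel_law k x]_y r = r :> R.
  by rewrite Rintegral_cst// [X in fine X](_ : _ = 1%E) ?mulr1//; exact: probability_setT.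
apply: (bmeas_bounded _ _ _ c e).
  have -> : mean = fun x => (mean x - c) + c by apply/funext => x; rewrite subrK.
  exact: measurable_funD.
move=> x; rewrite -{1}(cstE c x) -(cstE e x); apply/andP; split.
  apply: bRint_le; [exact: bmeas_cst|exact: bmeas_clamp|].
  by move=> y; have /andP[] := clamp_itv _ _ ce y.
apply: bRint_le; [exact: bmeas_clamp|exact: bmeas_cst|].
by move=> y; have /andP[] := clamp_itv _ _ ce y.
Qed.

(** Shift [H] by a bound and [cl] by [c] to reach the nonnegative case. *)
Lemma kernel_mean_moment (H : R -> R) : bmeas _ _ H ->
  \int[pi]_p (H p.1 * cl p.2) = \int[mu]_x (H x * mean x).
Proof.
move=> hH; have [_ [M HM]] := hH.
have M0 : 0 <= M by exact: le_trans (HM 0).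
have hc : bmeas _ R cl by exact: bmeas_clamp.
have hm := bmeas_kernel_mean.
have hM : bmeas _ R (cst M) by exact: bmeas_cst.
have hcc : bmeas _ R (cst c) by exact: bmeas_cst.
have h1 := kernel_moment (fun x => H x + M) (bmeasD _ _ _ _ hH hM).
have {h1} : \int[pi]_p ((H p.1 + M) * (cl p.2 - c)) =
    \int[mu]_x ((H x + M) * (mean x - c)).
  by apply: h1 => x; have := HM x; rewrite ler_norml => /andP[]; lra.
have := kernel_moment (cst M) hM (fun=> M0).
have -> : \int[pi]_p (cst M p.1 * (cl p.2 - c)) = \int[pi]_p (M * (cl p.2 - c)) by [].
have -> : \int[mu]_x (cst M x * (mean x - c)) = \int[mu]_x (M * (mean x - c)) by [].
have bf : bmeas _ (R * R)%type (fun p => H p.1) by exact: bmeas_fst.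
have bs : bmeas _ (R * R)%type (fun p => cl p.2) by exact: bmeas_snd.
rewrite (bRint_shift _ _ _ (fun p => H p.1) (fun p => cl p.2))//.
rewrite (bRint_shift _ _ _ H mean)// (coupling_fst _ cpl hH).
by set u := \int[pi]_p (M * _); set v := \int[mu]_x (M * _) => ->; lra.
Qed.

End Kernel.

Lemma martingale_moment (H : R -> R) : martingale_coupling mu nu pi -> bmeas _ _ H ->
  \int[pi]_p (H p.1 * cl p.2) = \int[mu]_x (H x * cl x).
Proof.
move=> [cpl [k dis mart]] hH; rewrite (kernel_mean_moment _ cpl dis)//.
apply: bRint_ae.
- by apply: bmeasM => //; exact: bmeas_kernel_mean.
- by apply: bmeasM => //; exact: bmeas_clamp.
- apply: filterS3 mart (kernel_strip _ cpl dis) (prob1_ae _ _ mu _ (measurable_itv _) mu1) => x.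
  move=> [_ mx] kx1 /=; rewrite in_itv/= => xce.
  by move: mx; rewrite integral_kernel_id// => -[->]; rewrite clamp_id.
Qed.

(** The conditional mean and the identity have the same integral over every
    measurable set, hence agree almost everywhere. *)
Lemma martingale_of_moment : coupling mu nu pi ->
  (forall S, measurable S -> \int[pi]_p (\1_S p.1 * cl p.2) = \int[mu]_x (\1_S x * cl x)) ->
  martingale_coupling mu nu pi.
Proof.
move=> cpl mom; split => //.
have [k dis] := exists_disintegration mu pi c e ce cpl.1 (coupling_strip cpl).
exists k => //.
have hm := bmeas_kernel_mean k; have hc : bmeas _ R cl by exact: bmeas_clamp.
have : ae_eq mu setT (EFin \o (fun x => \int[kernel_law k x]_y cl y)) (EFin \o cl).
  apply: integral_ae_eq => //.
  - exact: bmeas_integrable.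
  - by apply/measurable_EFinP; exact: mcl.
  - move=> S _ mS.
    have E f : bmeas _ R f -> (\int[mu]_(x in S) (EFin \o f) x = (\int[mu]_x (\1_S x * f x))%:E)%E.
      move=> hf; rewrite bRint_indic// /Rintegral fineK//.
      by apply: integrable_fin_num => //; apply: integrableS (bmeas_integrable _ _ mu _ hf).
    rewrite !E//; congr (_%:E); rewrite -mom// (kernel_mean_moment _ cpl dis)//.
    exact: bmeas_indic.
move=> mE; apply: filterS3 mE (kernel_strip _ cpl dis) (prob1_ae _ _ mu _ (measurable_itv _) mu1) => x.
move=> /(_ I) [mx] kx1 /=; rewrite in_itv/= => xce.
split; first exact: integrable_kernel_id.
by rewrite integral_kernel_id// mx clamp_id.
Qed.

End MartingaleMoments.

(** * Quantile functions *)

Section GeneralizedInverse.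
Context {R : realType} (c d : R) (F : R -> R).
Hypothesis cd : c <= d.
Hypothesis F_nd : {homo F : x y / x <= y}.
Hypothesis F_rc : forall s t, (forall t', t < t' -> s <= F t') -> s <= F t.

(** Truncating the level at [F d] keeps the set nonempty, so that the inverse is
    monotone and takes its values in [[c, d]] for all levels. *)
Definition ginv (s : R) := inf [set t | c <= t <= d /\ Num.min s (F d) <= F t].

Let ginv_set_d s : c <= d <= d /\ Num.min s (F d) <= F d.
Proof. by rewrite cd lexx ge_min lexx orbT. Qed.

Let ginv_lb s : has_lbound [set t | c <= t <= d /\ Num.min s (F d) <= F t].
Proof. by exists c => t [/andP[]]. Qed.

Lemma ginv_itv s : c <= ginv s <= d.
Proof.
apply/andP; split; last by apply: ge_inf (ginv_lb s) _ (ginv_set_d s).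
by apply: lb_le_inf => [|t [/andP[]]//]; exists d; exact: ginv_set_d.
Qed.

Lemma ginv_nd : {homo ginv : s t / s <= t}.
Proof.
move=> s t st; apply: lb_le_inf => [|u [ucd uF]]; first by exists d; exact: ginv_set_d.
apply: ge_inf (ginv_lb s) _ _; split => //; apply: le_trans uF.
by rewrite le_min ge_min st/= ge_min lexx orbT.
Qed.

Lemma measurable_ginv : measurable_fun setT ginv.
Proof. by apply: nondecreasing_measurable => // s t; exact: ginv_nd. Qed.

(** The Galois connection from which all laws below are computed. *)
Lemma ginv_le s t : s <= F d -> c <= t -> (ginv s <= t) = (s <= F t).
Proof.
move=> sFd ct; apply/idP/idP => [h|sFt].
  apply: F_rc => t' tt'.
  have : ginv s < t' by exact: le_lt_trans tt'.
  move=> /inf_lt[|u [ucd]]; first by exists d; exact: ginv_set_d.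
  by rewrite (min_idPl sFd) => su ut'; apply: le_trans su (F_nd _ _ (ltW ut')).
have [td|dt] := leP t d.
  by apply: ge_inf (ginv_lb s) _ _; split; [rewrite ct td|rewrite (min_idPl sFd)].
by have /andP[_ /le_trans] := ginv_itv s; apply; exact: ltW.
Qed.

End GeneralizedInverse.

Section DistributionFunction.
Context {R : realType} (nu : probability R R).

Definition dfun (t : R) : R := fine (nu `]-oo, t]%classic).

Lemma dfunE t : nu `]-oo, t]%classic = (dfun t)%:E.
Proof. by rewrite /dfun fineK// fin_num_measure. Qed.

Lemma dfun_nd : {homo dfun : x y / x <= y}.
Proof.
move=> x y xy; rewrite -lee_fin -!dfunE; apply: le_measure; rewrite ?inE//.
by move=> z/=; rewrite !in_itv/= => /le_trans; exact.
Qed.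

Lemma dfun_itv x y : x <= y -> fine (nu `]x, y]%classic) = dfun y - dfun x.
Proof.
move=> xy; have : nu `]-oo, y]%classic = (nu `]-oo, x]%classic + nu `]x, y]%classic)%E.
  rewrite -measureU//; last first.
    by apply/seteqP; split => // t [] /=; rewrite !in_itv/= => tx /andP[xt _]; lra.
  by rewrite -itv_bndbnd_setU// bnd_simp.
have : nu `]x, y]%classic \is a fin_num by exact: fin_num_measure.
by rewrite !dfunE; case: (nu `]x, y]%classic) => //= r _ [->]; ring.
Qed.

Lemma dfun01 t : 0 <= dfun t <= 1.
Proof. by rewrite -!lee_fin -dfunE measure_ge0 probability_le1. Qed.

Lemma dfun_rc s t : (forall t', t < t' -> s <= dfun t') -> s <= dfun t.
Proof.
move=> h; rewrite -lee_fin -dfunE.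
have E : `]-oo, t]%classic = \bigcap_n `]-oo, t + n.+1%:R^-1]%classic :> set R.
  apply/seteqP; split => x /=; rewrite in_itv/=.
    by move=> xt n _ /=; rewrite in_itv/= (le_trans xt)// lerDl.
  move=> hx; rewrite leNgt; apply/negP => /ltr_add_invr[n tx].
  by have := hx n I; rewrite /= in_itv/= leNgt tx.
have mm n : measurable (`]-oo, t + n.+1%:R^-1]%classic : set R) by [].
have ni : nonincreasing_seq (fun n => `]-oo, t + n.+1%:R^-1]%classic : set R).
  move=> m n mn; apply/subsetPset => x/=; rewrite !in_itv/= => /le_trans; apply.
  by rewrite lerD2l lef_pV2 ?posrE// ler_nat.
have fin0 : (nu (`]-oo, (t + 0%N.+1%:R^-1)%R]%classic) < +oo)%E.
  by rewrite ltey_eq fin_num_measure.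
have cv := nonincreasing_cvg_mu fin0 mm (bigcap_measurable (ex_intro _ 0%N I) (fun i _ => mm i)) ni.
rewrite E -(cvg_lim _ cv)//; apply: lime_ge.
  by apply/cvg_ex; eexists; exact: cv.
by apply: nearW => n /=; rewrite dfunE lee_fin; apply: h; rewrite ltrDl.
Qed.

End DistributionFunction.

Section Quantile.
Context {R : realType} (nu : probability R R) (c d : R).
Hypothesis cd : c <= d.
Hypothesis nu1 : nu `[c, d]%classic = 1%E.
Local Notation N := (dfun nu).

Definition quantile := ginv c d N.

Lemma dfun_max : N d = 1.
Proof.
apply/eqP; rewrite eq_le; have /andP[_ ->] := dfun01 nu d; rewrite /=.
rewrite -lee_fin -dfunE -nu1; apply: le_measure; rewrite ?inE//.
by move=> x /=; rewrite !in_itv/= => /andP[].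
Qed.

Lemma dfun_min t : t < c -> N t = 0.
Proof.
move=> tc; apply/eqP; rewrite -eqe -dfunE; apply/eqP.
rewrite -(prob1_setI _ _ nu _ (measurable_itv _) nu1)//.
rewrite (_ : _ `&` _ = set0) ?measure0//; apply/seteqP; split => // x [] /=.
by rewrite !in_itv/= => xt /andP[cx _]; lra.
Qed.

Lemma quantile_le s t : 0 < s <= 1 -> (quantile s <= t) = (s <= N t).
Proof.
move=> /andP[s0 s1]; have [ct|tc] := leP c t.
  by apply: ginv_le; rewrite ?dfun_max//; [exact: dfun_nd|exact: dfun_rc].
rewrite (dfun_min _ tc) [RHS]leNgt s0/=; apply/negbTE; rewrite -ltNge.
by apply: lt_le_trans tc _; have /andP[] := ginv_itv c d N cd s.
Qed.

Lemma unif01_ae_itv : {ae @unif01 R, forall s, 0 < s <= 1}.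
Proof.
have E : unif01 (`]0, 1]%classic : set R) = 1%E.
  by rewrite /unif01 setIid lebesgue_measure_itv/= lte01 sube0.
have := @prob1_ae _ _ _ (@unif01 R) `]0, 1]%classic (measurable_itv _) E.
by apply: filterS => s; rewrite /= in_itv.
Qed.

Lemma unif01_eq (A B : set R) : (forall s, 0 < s <= 1 -> A s <-> B s) -> unif01 A = unif01 B.
Proof.
move=> AB; rewrite /unif01; congr (lebesgue_measure _); apply/seteqP; split => s [] /= h;
  by rewrite !in_itv/= => s01; split => //; apply/AB.
Qed.

Lemma quantile_law (B : set R) : measurable B -> unif01 [set s | B (quantile s)] = nu B.
Proof.
have mq : measurable_fun setT quantile by apply: measurable_ginv.
pose qm : {mfun R >-> R} := mfun_Sub (mem_set mq).
apply: (measure_eq_closed_rays (distribution (@unif01 R) qm) nu).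
  by rewrite (_ : _ setT = 1%E) ?ltry//; exact: probability_setT.
move=> t; apply: etrans (esym (dfunE nu t)); rewrite -unif01_le ?dfun01//.
apply: unif01_eq => s s01 /=.
by rewrite in_itv/= quantile_le.
Qed.

End Quantile.

(** * Splitting the mass of the sources between the two sides *)

(** [W] is a primitive of a function with values in [[yl, yu]] below [a] and in
    [[zl, zu]] above. *)
Section Splitting.
Context {R : realType} (yl yu xl xu zl zu a K : R) (W : R -> R).
Hypotheses (yx : yu < xl) (xlu : xl <= xu) (xz : xu < zl) (a01 : 0 <= a <= 1).
Hypothesis Wlip : forall s t, s <= t -> `|W t - W s| <= K * (t - s).
Hypothesis Wlow : forall s t, 0 <= s -> s <= t -> t <= a ->
  yl * (t - s) <= W t - W s <= yu * (t - s).
Hypothesis Wup : forall s t, a <= s -> s <= t -> t <= 1 ->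
  zl * (t - s) <= W t - W s <= zu * (t - s).
Hypothesis W0 : W 0 = 0.

Lemma lipschitz_cvg : continuous W.
Proof.
have K0 : 0 <= K.
  have := Wlip 0 1 ler01; rewrite subr0 mulr1; exact: le_trans.
move=> s; apply/cvgrPdist_le => e e0; near=> t.
have : `|s - t| <= e / (K + 1).
  by near: t; apply: cvgr_dist_le; [exact: cvg_id|rewrite divr_gt0//; lra].
rewrite ler_pdivlMr; last lra.
move=> h; apply: le_trans h; have [st|/ltW ts] := leP s t.
  rewrite distrC (le_trans (Wlip _ _ st))// distrC ger0_norm ?subr_ge0//.
  by rewrite mulrC ler_wpM2l ?subr_ge0//; lra.
rewrite (le_trans (Wlip _ _ ts))// ger0_norm ?subr_ge0//.
by rewrite mulrC ler_wpM2l ?subr_ge0//; lra.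
Unshelve. all: by end_near. Qed.

(** Intermediate values.  When as much mass as possible goes low, either all of it
    does or the remaining target is entirely high; in both cases the first moment is
    at most [A].  Sending as little as possible low is symmetric. *)
Lemma splitting_exists (M A : R) : 0 <= M <= 1 ->
  xl * M <= A -> A <= xu * M ->
  xl * (1 - M) <= W 1 - A <= xu * (1 - M) ->
  exists q, [/\ 0 <= q <= a, 0 <= M - q <= 1 - a & W q + (W (a + (M - q)) - W a) = A].
Proof.
move: yx xlu xz => yx' xlu' xz' /andP[M0 M1] A1 A2 /andP[A3 A4]; case/andP: a01 => a0 a1.
pose f q := W q + (W (a + (M - q)) - W a).
pose lo := Num.max 0 (M - (1 - a)); pose hi := Num.min a M.
have lohi : lo <= hi.
  by rewrite /lo /hi ge_max !le_min; apply/andP; split; apply/andP; split; lra.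
have fhi : f hi <= A.
  rewrite /f /hi; have [aM|Ma] := leP a M.
    have /andP[h1 h2] : zl * (1 - M) <= W 1 - W M <= zu * (1 - M) by apply: Wup.
    have -> : a + (M - a) = M by ring.
    have : 0 <= (zl - xu) * (1 - M) by apply: (@mulr_ge0 R); lra.
    lra.
  have /andP[h1 h2] : yl * (M - 0) <= W M - W 0 <= yu * (M - 0) by apply: Wlow => //; lra.
  have -> : a + (M - M) = a by ring.
  have : 0 <= (xl - yu) * M by apply: (@mulr_ge0 R); lra.
  rewrite W0 in h1 h2; lra.
have flo : A <= f lo.
  rewrite /f /lo; have [h|h] := leP 0 (M - (1 - a)).
    have /andP[h1 h2] : yl * (a - (M - (1 - a))) <= W a - W (M - (1 - a)) <= yu * (a - (M - (1 - a))).
      by apply: Wlow => //; lra.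
    have -> : a + (M - (M - (1 - a))) = 1 by ring.
    have : 0 <= (xl - yu) * (1 - M) by apply: (@mulr_ge0 R); lra.
    have e : a - (M - (1 - a)) = 1 - M by ring.
    rewrite e in h1 h2; lra.
  have /andP[h1 h2] : zl * (a + M - a) <= W (a + M) - W a <= zu * (a + M - a).
    by apply: Wup; lra.
  have : 0 <= (zl - xu) * M by apply: (@mulr_ge0 R); lra.
  have e : a + M - a = M by ring.
  rewrite W0 subr0; rewrite e in h1 h2; lra.
have fcont : {within `[lo, hi], continuous f}.
  apply: continuous_subspaceT => q; apply: cvgD; first exact: lipschitz_cvg.
  apply: cvgB; last exact: cvg_cst.
  apply: (@continuous_comp _ _ _ (fun q => a + (M - q)) W); last exact: lipschitz_cvg.
  by apply: cvgD; [exact: cvg_cst|apply: cvgB; [exact: cvg_cst|exact: cvg_id]].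
have [|q] := @IVT _ f lo hi A lohi fcont.
  by rewrite ge_min fhi orbT le_max flo.
rewrite in_itv/= /lo /hi ge_max le_min => /andP[/andP[q0 qM] /andP[qa qM']] fq.
by exists q; split => //; apply/andP; split; lra.
Qed.

(** If [q] decreased, the moment would grow by [zl * (M' - M)] plus a positive
    multiple of the decrease, at least, hence by more than [xu * (M' - M)];
    symmetrically, if [M - q] decreased it would grow by less than
    [xl * (M' - M)]. *)
Lemma splitting_mono (M A q M' A' q' : R) :
  0 <= q <= a -> 0 <= M - q <= 1 - a -> W q + (W (a + (M - q)) - W a) = A ->
  0 <= q' <= a -> 0 <= M' - q' <= 1 - a -> W q' + (W (a + (M' - q')) - W a) = A' ->
  M <= M' -> xl * (M' - M) <= A' - A <= xu * (M' - M) ->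
  q <= q' /\ M - q <= M' - q'.
Proof.
move: yx xlu xz => yx' xlu' xz' /andP[q0 qa] /andP[r0 ra] e /andP[q0' qa'] /andP[r0' ra'] e' MM /andP[h1 h2].
split; rewrite leNgt; apply/negP => lt.
- have /andP[w1 w2] : yl * (q - q') <= W q - W q' <= yu * (q - q') by apply: Wlow => //; lra.
  have /andP[w3 w4] : zl * ((a + (M' - q')) - (a + (M - q))) <= W (a + (M' - q')) - W (a + (M - q)) <= zu * ((a + (M' - q')) - (a + (M - q))).
    by apply: Wup; lra.
  have e1 : (a + (M' - q')) - (a + (M - q)) = (M' - M) + (q - q') by ring.
  rewrite e1 in w3.
  have g1 : 0 < (zl - yu) * (q - q') by apply: (@mulr_gt0 R); lra.
  have g2 : 0 <= (zl - xu) * (M' - M) by apply: (@mulr_ge0 R); lra.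
  have e2 : zl * (M' - M + (q - q')) = zl * (M' - M) + zl * (q - q') by ring.
  lra.
- have /andP[w1 w2] : yl * (q' - q) <= W q' - W q <= yu * (q' - q) by apply: Wlow => //; lra.
  have /andP[w3 w4] : zl * ((a + (M - q)) - (a + (M' - q'))) <= W (a + (M - q)) - W (a + (M' - q')) <= zu * ((a + (M - q)) - (a + (M' - q'))).
    by apply: Wup; lra.
  have e1 : q' - q = (M' - M) + ((M - q) - (M' - q')) by ring.
  have e2 : (a + (M - q)) - (a + (M' - q')) = (M - q) - (M' - q') by ring.
  rewrite e1 in w2; rewrite e2 in w3.
  set D := (M - q) - (M' - q') in w2 w3.
  have D0 : 0 < D by rewrite /D; lra.
  have g1 : 0 < (zl - yu) * D by apply: (@mulr_gt0 R); lra.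
  have g2 : 0 <= (xl - yu) * (M' - M) by apply: (@mulr_ge0 R); lra.
  have e3 : yu * (M' - M + D) = yu * (M' - M) + yu * D by ring.
  lra.
Qed.

End Splitting.

(** * Parametrizing the target by its mass *)

Section MonotoneParametrization.
Context {R : realType}.
Implicit Types tau : R.

(** For [tau = -1], reflect each of the two intervals in its centre: the order is
    reversed inside each side, and the sides are not exchanged. *)
Lemma exists_reordering (yl yu zl zu tau : R) : yl <= yu -> yu < zl -> zl <= zu ->
  tau = 1 \/ tau = -1 -> exists theta : R -> R,
  [/\ measurable_fun setT theta,
      forall y, yl <= y <= yu -> yl <= theta y <= yu /\ theta (theta y) = y,
      forall y, zl <= y <= zu -> zl <= theta y <= zu /\ theta (theta y) = y,
      forall y y', yl <= y -> y <= y' -> y' <= yu -> tau * theta y <= tau * theta y' &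
      forall y y', zl <= y -> y <= y' -> y' <= zu -> tau * theta y <= tau * theta y'].
Proof.
move=> yy yz zz [->|->].
  by exists id; split => // y y' *; rewrite !mul1r.
exists (fun y => if y <= yu then yl + yu - y else zl + zu - y); split.
- apply: measurable_fun_ifT.
  + exact: measurable_fun_ler.
  + exact: measurable_funB.
  + exact: measurable_funB.
- move=> y /andP[y1 y2]; rewrite y2.
  have -> : yl + yu - y <= yu by lra.
  by split; [apply/andP; split|]; lra.
- move=> y /andP[y1 y2].
  have -> : (y <= yu) = false by apply/negbTE; rewrite -ltNge; lra.
  have -> : (zl + zu - y <= yu) = false by apply/negbTE; rewrite -ltNge; lra.
  by split; [apply/andP; split|]; lra.
- move=> y y' h1 h2 h3; rewrite h3 (le_trans h2 h3); lra.
- move=> y y' h1 h2 h3.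
  have -> : (y <= yu) = false by apply/negbTE; rewrite -ltNge; lra.
  have -> : (y' <= yu) = false by apply/negbTE; rewrite -ltNge; lra.
  lra.
Qed.

(** Take the quantile function of the image of [nu] under the reordering, and apply
    the reordering (an involution) to it.  Clamping makes the two branches total
    functions with values in the right interval. *)
Lemma exists_monotone_param (nu : probability R R) (yl yu zl zu tau : R) :
  yl <= yu -> yu < zl -> zl <= zu -> tau = 1 \/ tau = -1 ->
  nu (`[yl, yu]%classic `|` `[zl, zu]%classic) = 1%E ->
  exists (a : R) (yq zq : R -> R),
  [/\ nu `[yl, yu]%classic = a%:E,
      measurable_fun setT yq /\ measurable_fun setT zq,
      forall s, yl <= yq s <= yu /\ zl <= zq s <= zu,
      (forall s t, s <= t -> tau * yq s <= tau * yq t) /\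
      (forall s t, s <= t -> tau * zq s <= tau * zq t) &
      forall B, measurable B ->
        unif01 [set s | B (if s <= a then yq s else zq (s - a))] = nu B].
Proof.
move=> yy yz zz tau1 nuLU.
have [th [mth thL thU monL monU]] := exists_reordering _ _ _ _ _ yy yz zz tau1.
pose thm : {mfun R >-> R} := mfun_Sub (mem_set mth).
pose nu' : probability R R := distribution nu thm.
set LU := (_ `|` _) in nuLU.
have mLU : measurable LU by apply: measurableU.
have nuLUI := prob1_setI _ _ nu _ mLU nuLU.
have mpre B : measurable B -> measurable (th @^-1` B).
  by move=> mB; rewrite -[X in measurable X]setTI; exact: (mth measurableT).
have nu'E B : measurable B -> nu' B = nu (th @^-1` B `&` LU).
  by move=> mB; rewrite nuLUI//; exact: mpre.
have thLU y : LU y -> LU (th y).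
  by move=> [] /=; rewrite !in_itv/= => h; [left|right]; rewrite /= in_itv/=;
    [have [] := thL _ h|have [] := thU _ h].
have cd : yl <= zu by lra.
have nu'1 : nu' `[yl, zu]%classic = 1%E.
  rewrite nu'E// -nuLU; congr (nu _); apply/seteqP; split => [y []//|y hy]; split => //.
  by have [] := thLU _ hy; rewrite /= !in_itv/= => /andP[? ?]; apply/andP; split; lra.
pose N := dfun nu'; pose a := N yu.
have nuL : nu `[yl, yu]%classic = a%:E.
  rewrite -dfunE nu'E// -nuLUI//; congr (nu _); apply/seteqP; split => y [h1 h2]; split => //.
    by move: h1; rewrite /= !in_itv/= => /thL[/andP[]].
  move: h1 h2; rewrite /= !in_itv/= => h1 []//=; rewrite in_itv/= => /thU[/andP[h3 h4] _]; lra.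
(* Between [yu] and [zl] there is no mass: quantiles above level [a] are [>= zl]. *)
have N_flat t : yu <= t -> t < zl -> N t = a.
  move=> ut tz; apply/eqP; rewrite -eqe -!dfunE !nu'E//; apply/eqP; congr (nu _).
  apply/seteqP; split => y [h1 h2]; split => //; move: h1; rewrite /= !in_itv/= => h1.
    by have [] := thLU _ h2; rewrite /= in_itv/= => /andP[? ?]//; lra.
  exact: le_trans ut.
pose Q := quantile nu' yl zu.
have QP s t : 0 < s <= 1 -> (Q s <= t) = (s <= N t) by apply: quantile_le.
have Qitv s : yl <= Q s <= zu by exact: ginv_itv.
have Qnd s t : s <= t -> Q s <= Q t by exact: ginv_nd.
exists a, (fun s => th (clamp yl yu (Q s))), (fun s => th (clamp zl zu (Q (a + s)))).
have mQ : measurable_fun setT Q by exact: measurable_ginv.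
split => //.
- split; apply: measurableT_comp => //; apply: measurableT_comp; try exact: measurable_clamp.
    exact: mQ.
  by apply: (measurableT_comp mQ); exact: measurable_funD.
- move=> s; split.
    by have [] := thL (clamp yl yu (Q s)) (clamp_itv _ _ yy _).
  by have [] := thU (clamp zl zu (Q (a + s))) (clamp_itv _ _ zz _).
- split => s t st.
    apply: monL; [by have /andP[] := clamp_itv _ _ yy (Q s)| |by have /andP[] := clamp_itv _ _ yy (Q t)].
    by apply: clamp_nd; exact: Qnd.
  apply: monU; [by have /andP[] := clamp_itv _ _ zz (Q (a + s))| |by have /andP[] := clamp_itv _ _ zz (Q (a + t))].
  by apply: clamp_nd; apply: Qnd; rewrite lerD2l.
- move=> B mB; transitivity (unif01 [set s | (th @^-1` B) (Q s)]).
    apply: unif01_eq => s s01 /=.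
    suff -> : (if s <= a then th (clamp yl yu (Q s)) else th (clamp zl zu (Q (a + (s - a))))) = th (Q s) by [].
    case: ifPn => [sa|].
      by rewrite clamp_id// QP//; have /andP[->] := Qitv s.
    rewrite -ltNge => sa; rewrite [a + _]addrC subrK clamp_id//.
    have /andP[_ ->] := Qitv s; rewrite andbT leNgt; apply/negP => Qz.
    have yuQ : yu < Q s by rewrite ltNge QP// -ltNge.
    have := QP s (Q s) s01; rewrite lexx N_flat// ?(ltW yuQ)// => /esym.
    by rewrite leNgt sa.
  rewrite (quantile_law nu' yl zu)//; last exact: mpre.
  rewrite nu'E; last exact: mpre.
  rewrite -[RHS]nuLUI//; congr (nu _); apply/seteqP; split => y [h1 h2]; split => //.
    move: h1 => /=; case: h2 => /=; rewrite in_itv/=.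
      by move=> /thL[_ ->].
    by move=> /thU[_ ->].
  move=> /=; case: h2 => /=; rewrite in_itv/=.
    by move=> /thL[_ ->].
  by move=> /thU[_ ->].
Qed.

End MonotoneParametrization.

(** * Integrals over events *)

Lemma indic_boolE {T : Type} {R : realType} (A : set T) (x : T) (b : bool) :
  (A x <-> b) -> \1_A x = b%:R :> R.
Proof. by move=> h; rewrite indicE; congr (_%:R); congr nat_of_bool; apply/idP/idP; rewrite inE => /h. Qed.

Section IndicatorIntegrals.
Context d (T : measurableType d) {R : realType} (P : probability T R).

Lemma Rint_indic (S : set T) : measurable S -> \int[P]_x (\1_S x : R) = fine (P S).
Proof. by move=> mS; rewrite /Rintegral integral_indic// setIT. Qed.

(** The bounds on [h] are only assumed on [S]; clamping [h] extends them. *)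
Lemma Rint_indic_bounds (S : set T) (h : T -> R) lo hi : measurable S -> bmeas _ _ h ->
  {ae P, forall x, S x -> lo <= h x <= hi} ->
  lo * fine (P S) <= \int[P]_x (\1_S x * h x) <= hi * fine (P S).
Proof.
move=> mS hh hae.
have hS : bmeas _ T (\1_S : T -> R) by exact: bmeas_indic.
have hSh : bmeas _ T (fun x => \1_S x * h x) by exact: bmeasM.
have hcl : bmeas _ T (fun x => \1_S x * Num.max lo (Num.min (h x) (Num.max lo hi))).
  apply: bmeasM => //; apply: (bmeas_bounded _ _ _ lo (Num.max lo hi)).
    apply: measurable_maxr => //; apply: measurable_minr => //; by case: hh.
  by move=> x; rewrite le_max lexx/= ge_max le_max lexx/= ge_min lexx orbT.
have e : \int[P]_x (\1_S x * h x) =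
    \int[P]_x (\1_S x * Num.max lo (Num.min (h x) (Num.max lo hi))).
  apply: bRint_ae => //; apply: filterS hae => x hx.
  rewrite indicE; case: (boolP (x \in S)) => xS; last by rewrite !mul0r.
  have /andP[h1 h2] := hx (set_mem xS).
  by rewrite (min_idPl _) ?(max_idPr h1)// le_max h2 orbT.
(* If [hi < lo], the hypothesis forces [S] to be null. *)
have [Sh|/negP lohi] := boolP (lo <= hi); last first.
  have S0 : {ae P, forall x, \1_S x = (0 : R)}.
    apply: filterS hae => x hx; rewrite indicE; case: (boolP (x \in S)) => // xS.
    by case: lohi; have /andP[h1] := hx (set_mem xS); exact: le_trans.
  have -> : \int[P]_x (\1_S x * h x) = \int[P]_x (cst 0 x).
    apply: bRint_ae => //; first exact: bmeas_cst.
    by apply: filterS S0 => x ->; rewrite mul0r.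
  have -> : fine (P S) = \int[P]_x (cst 0 x).
    rewrite -Rint_indic//; apply: bRint_ae => //; exact: bmeas_cst.
  by rewrite Rintegral_cst// mul0r !mulr0 lexx.
rewrite e -Rint_indic//; apply/andP; split.
  rewrite -bRintZ//; apply: bRint_le => //; first by apply: bmeasM => //; exact: bmeas_cst.
  by move=> x; rewrite mulrC ler_wpM2l// le_max lexx.
rewrite -bRintZ//; apply: bRint_le => //; first by apply: bmeasM => //; exact: bmeas_cst.
by move=> x; rewrite [leRHS]mulrC ler_wpM2l// (max_idPr Sh) ge_max Sh ge_min lexx orbT.
Qed.

End IndicatorIntegrals.

Section DensityMeasure.
Context d d' (T : measurableType d) (U : measurableType d') {R : realType}.
Variables (m : {measure set T -> \bar R}) (f : T -> R) (X : T -> U).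
Hypotheses (mf : measurable_fun setT f) (f0 : forall x, 0 <= f x) (mX : measurable_fun setT X).

(** The image by [X] of the measure with density [f] with respect to [m]. *)
Definition density_image & measurable_fun setT f & (forall x, 0 <= f x) & measurable_fun setT X :=
  fun B : set U => (\int[m]_(x in X @^-1` B) (f x)%:E)%E.
Local Notation di := (density_image mf f0 mX).

Let di0 : di set0 = 0%E. Proof. by rewrite /density_image preimage_set0 integral_set0. Qed.

Let di_ge0 B : (0 <= di B)%E.
Proof. by apply: integral_ge0 => x _; rewrite lee_fin. Qed.

Let mpre B : measurable B -> measurable (X @^-1` B).
Proof. by move=> mB; rewrite -[X in measurable X]setTI; exact: (mX measurableT). Qed.

Let di_sigma_additive : semi_sigma_additive di.
Proof.
move=> F mF tF mUF; rewrite /density_image preimage_bigcup.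
rewrite ge0_integral_bigcup//.
- apply: is_cvg_nneseries => n _ _; apply: integral_ge0 => x _; exact: f0.
- by move=> i; exact: mpre.
- by apply/measurable_funTS/measurable_EFinP.
- by move=> x _; rewrite lee_fin.
- move=> i j _ _ [x [/= Fi Fj]]; apply: tF => //; by exists (X x).
Qed.

HB.instance Definition _ := isMeasure.Build _ _ _ di di0 di_ge0 di_sigma_additive.

End DensityMeasure.

Lemma unif01_itv {R : realType} (s t : R) : 0 <= s -> s <= t -> t <= 1 ->
  unif01 `]s, t]%classic = (t - s)%:E.
Proof.
move=> s0 st t1; rewrite /unif01 (_ : _ `&` _ = `]s, t]%classic); last first.
  apply/seteqP; split => x /=; rewrite !in_itv/=; first by move=> [].
  by move=> /andP[h1 h2]; rewrite h1 h2/=; split => //; apply/andP; split; lra.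
rewrite lebesgue_measure_itv/= lte_fin; by case: ltgtP st => // -> _; rewrite subrr.
Qed.

Lemma unif01_itv_le {R : realType} (s t : R) : s <= t ->
  (unif01 `]s, t]%classic <= (t - s)%:E)%E.
Proof.
move=> st; have -> : (t - s)%:E = lebesgue_measure (`]s, t]%classic : set R).
  rewrite lebesgue_measure_itv/= lte_fin; by case: ltgtP st => // -> _; rewrite subrr.
rewrite /unif01; apply: le_measure; rewrite ?inE//=.
exact: measurableI.
Qed.

(** * Nested events and monotone sets *)

Section TauRays.
Context {R : realType}.

Definition tau_ray (tau t : R) : set R := [set y | tau * y <= tau * t].

Lemma measurable_tau_ray tau t : measurable (tau_ray tau t).
Proof. by apply: measurable_set_le => //; exact: measurable_funM. Qed.

Lemma measure_eq_upper_rays (m1 m2 : {measure set R -> \bar R}) :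
  (m1 setT < +oo)%E -> (forall t, m1 `[t, +oo[%classic = m2 `[t, +oo[%classic) ->
  forall B, measurable B -> m1 B = m2 B.
Proof.
move=> fin m12.
apply: (measure_unique (@RGenCInfty.G R) (fun n => `[- n%:R, +oo[%classic)).
- exact: RGenCInfty.measurableE.
- move=> _ _ [x ->] [y ->]; exists (Num.max x y).
  apply/seteqP; split => z/=; rewrite !in_itv/= !andbT ge_max; first by move=> [-> ->].
  by move=> /andP[-> ->].
- by move=> i; exists (- i%:R).
- apply/seteqP; split => // x _; exists (Num.truncn `|x|).+1 => //=.
  rewrite in_itv/= andbT lerNl (le_trans (ler_norm (- x)))// normrN.
  exact/ltW/truncnS_gt.
- by move=> _ [t ->].
- by move=> k; apply: le_lt_trans fin; apply: le_measure; rewrite ?inE.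
Qed.

Lemma measure_eq_tau_rays tau (m1 m2 : {measure set R -> \bar R}) :
  tau = 1 \/ tau = -1 -> (m1 setT < +oo)%E ->
  (forall t, m1 (tau_ray tau t) = m2 (tau_ray tau t)) ->
  forall B, measurable B -> m1 B = m2 B.
Proof.
move=> [->|->] fin h.
  apply: measure_eq_closed_rays => // t.
  suff -> : `]-oo, t]%classic = tau_ray 1 t by exact: h.
  by apply/seteqP; split => y /=; rewrite /tau_ray/= in_itv/= !mul1r.
apply: measure_eq_upper_rays => // t.
suff -> : `[t, +oo[%classic = tau_ray (-1) t by exact: h.
by apply/seteqP; split => y /=; rewrite /tau_ray/= in_itv/= andbT !mulN1r lerN2.
Qed.

End TauRays.

Section Nested.
Context d (T : measurableType d) {R : realType} (P : {finite_measure set T -> \bar R}).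

(** The joint mass of two events comparable up to a null set is the smaller mass;
    this is what makes monotone couplings computable from their marginals. *)
Lemma nested_measure (H D : set T) : measurable H -> measurable D ->
  P (H `\` D) = 0%E \/ P (D `\` H) = 0%E -> P (H `&` D) = mine (P H) (P D).
Proof.
move=> mH mD h.
have eH := measureDI P mH mD.
have eD := measureDI P mD mH; rewrite setIC in eD.
have le1 : (P (H `&` D) <= P H)%E by apply: le_measure; rewrite ?inE//; exact: measurableI.
have le2 : (P (H `&` D) <= P D)%E by apply: le_measure; rewrite ?inE//; exact: measurableI.
case: h => h0; apply/esym.
  have e : P H = P (H `&` D) by rewrite eH [X in (X + _)%E]h0 add0e.
  by rewrite e; apply/min_idPl.
have e : P D = P (H `&` D) by rewrite eD [X in (X + _)%E]h0 add0e.
by rewrite e; apply/min_idPr.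
Qed.

End Nested.

Section MonotoneSlice.
Context {R : realType}.
Variables (tau : R) (nu : probability R R) (pi : probability (R * R)%type R).
Variables (I J : set R) (g : R -> R).
Hypotheses (tau1 : tau = 1 \/ tau = -1) (mI : measurable I) (mJ : measurable J).
Hypothesis mg : measurable_fun setT g.
Hypothesis marg : forall B, measurable B -> pi (setT `*` B) = nu B.
Hypothesis law : forall B, measurable B -> unif01 (J `&` g @^-1` B) = nu (B `&` I).
Hypothesis gmon : forall s t, J s -> J t -> s <= t -> tau * g s <= tau * g t.

Let mgp : measurable_fun setT (fun s => (s, g s)).
Proof. exact: measurable_fun_pair. Qed.

Let graph_law : probability (R * R)%type R :=
  distribution (@unif01 R) (mfun_Sub (mem_set mgp) : {mfun R >-> (R * R)%type}).

Let mpre B : measurable B -> measurable (g @^-1` B).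
Proof. by move=> mB; rewrite -[Y in measurable Y]setTI; exact: (mg measurableT). Qed.

(** Among targets in [I], those reached from sources [<= x] precede the others in
    the direction [tau], so that their law is determined by their mass.  The same
    holds for the parameters [<= h] of [J], and the two laws agree on rays. *)
Lemma monotone_slice (x h : R) :
  (forall t, pi (`]-oo, x]%classic `*` (I `\` tau_ray tau t)) = 0%E \/
             pi ((~` `]-oo, x]%classic) `*` (I `&` tau_ray tau t)) = 0%E) ->
  pi (`]-oo, x]%classic `*` I) = unif01 (J `&` [set s | s <= h]) ->
  forall B, measurable B ->
    pi (`]-oo, x]%classic `*` (B `&` I)) = unif01 (J `&` [set s | s <= h] `&` g @^-1` B).
Proof.
move=> hpi mass B mB.
have mh : measurable [set s | s <= h] by exact: measurable_set_le.
have mx : measurable (`]-oo, x]%classic : set R) by [].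
have mJh : measurable (J `&` [set s | s <= h]) by exact: measurableI.
have mTI : measurable (setT `*` I : set (R * R)) by exact: measurableX.
pose m1 := second_slice (mrestr pi mTI) _ mx.
pose m2 := second_slice graph_law _ mJh.
have m1E C : m1 C = pi (`]-oo, x]%classic `*` (C `&` I)).
  rewrite /m1 /second_slice /mrestr; congr (pi _).
  by apply/seteqP; split => -[u v] /=; [move=> [[? ?] [_ ?]]|move=> [? [? ?]]].
have m2E C : m2 C = unif01 (J `&` [set s | s <= h] `&` g @^-1` C) by [].
rewrite -m1E -m2E; apply: (measure_eq_tau_rays tau m1 m2) => //.
  rewrite [X in (X < _)%E](m1E setT) setTI (le_lt_trans (probability_le1 _ _)) ?ltry//; exact: measurableX.
move=> t; apply: etrans (m1E _) _; apply: esym; apply: etrans (m2E _) _; apply: esym.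
set D := tau_ray tau t.
have mD : measurable D by exact: measurable_tau_ray.
have mID : measurable (I `&` D) by exact: measurableI.
have -> : `]-oo, x]%classic `*` (D `&` I) = (`]-oo, x]%classic `*` I) `&` (setT `*` (I `&` D)).
  by apply/seteqP; split => -[u v] /=; [move=> [? [? ?]]|move=> [[? ?] [_ [? ?]]]].
rewrite nested_measure; [|exact: measurableX..|]; last first.
  case: (hpi t) => h0; [left|right]; rewrite -h0; congr (pi _).
    apply/seteqP; split => -[u v] /=; first by move=> [[? ?] hh]; split => //; split => // ?; exact: hh.
    by move=> [? [? hh]]; split => // -[_ [_]].
  apply/seteqP; split => -[u v] /=.
    by move=> [[_ [? ?]] hh]; split => // ?; exact: hh.
  by move=> [hh [? ?]]; split => // -[].
have -> : J `&` [set s | s <= h] `&` g @^-1` D = (J `&` [set s | s <= h]) `&` (J `&` g @^-1` D).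
  by apply/seteqP; split => s /=; [move=> [[? ?] ?]|move=> [[? ?] [? ?]]].
rewrite (nested_measure _ _ (@unif01 R))//; last 2 first.
- by apply: measurableI => //; exact: mpre.
- have [e|] := eqVneq (J `&` [set s | s <= h] `\` (J `&` g @^-1` D)) set0.
    by left; rewrite e measure0.
  move=> /set0P[s [[Js sh] ns]]; right.
  rewrite (_ : _ `\` _ = set0) ?measure0//; apply/seteqP; split => // s' [[Js' gs'] ns'].
  have hs : h < s' by rewrite ltNge; apply/negP => ?; apply: ns'.
  apply: ns; split => //=; apply: le_trans gs'; apply: gmon => //.
  by rewrite /= in sh; rewrite (le_trans sh)// ltW.
congr (mine _ _); first exact: mass.
apply: etrans (marg _ mID) _; apply: esym; apply: etrans (law _ mD) _.
by rewrite setIC.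
Qed.

End MonotoneSlice.

Section MonotoneGraph.
Context {R : realType}.
Implicit Types (tau : R) (G : set (R * R)).

(** Both notions of monotonicity of a coupling at once. *)
Definition tau_monotone tau G :=
  (forall x y x' y', G (x, y) -> G (x', y') -> y <= x -> y' <= x' -> x < x' -> tau * y <= tau * y') /\
  (forall x y x' y', G (x, y) -> G (x', y') -> x <= y -> x' <= y' -> x < x' -> tau * y <= tau * y').

Lemma tau_monotone1 G : tau_monotone 1 G <-> nondecreasing_set G.
Proof.
split=> -[h1 h2]; split => x y x' y' G1 G2 a1 a2 a3.
- by have := h1 _ _ _ _ G1 G2 a1 a2 a3; rewrite !mul1r.
- by have := h2 _ _ _ _ G1 G2 a1 a2 a3; rewrite !mul1r.
- by rewrite !mul1r; exact: h1 G1 G2 a1 a2 a3.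
- by rewrite !mul1r; exact: h2 G1 G2 a1 a2 a3.
Qed.

Lemma tau_monotoneN1 G : tau_monotone (-1) G <-> nonincreasing_set G.
Proof.
split=> -[h1 h2]; split => x y x' y' G1 G2 a1 a2 a3.
- by have := h1 _ _ _ _ G1 G2 a1 a2 a3; rewrite !mulN1r lerN2.
- by have := h2 _ _ _ _ G1 G2 a1 a2 a3; rewrite !mulN1r lerN2.
- by rewrite !mulN1r lerN2; exact: h1 G1 G2 a1 a2 a3.
- by rewrite !mulN1r lerN2; exact: h2 G1 G2 a1 a2 a3.
Qed.

Definition side_map (yu : R) (T1 T2 : R -> R) (s v : R) := if v <= yu then T1 s else T2 s.

(** The points [(x, v)] such that [v] lies, in the direction [tau], between the left
    and right values at [x] of the map of its side.  An atom of the source is spread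
    over the vertical segment at a jump. *)
Definition mono_graph tau yu T1 T2 : set (R * R) := [set p |
  (forall s, s < p.1 -> tau * side_map yu T1 T2 s p.2 <= tau * p.2) /\
  (forall s, p.1 < s -> tau * p.2 <= tau * side_map yu T1 T2 s p.2)].

End MonotoneGraph.

(** * The monotone coupling *)

Section Parametrized.
Context {R : realType}.
Variables (mu nu : probability R R) (yl yu xl xu zl zu a : R) (yq zq : R -> R).
Hypotheses (yly : yl <= yu) (yx : yu < xl) (xlu : xl <= xu) (xz : xu < zl) (zlz : zl <= zu).
Hypothesis mu1 : mu `[xl, xu]%classic = 1%E.
Hypothesis nuL : nu `[yl, yu]%classic = a%:E.
Hypothesis myq : measurable_fun setT yq.
Hypothesis mzq : measurable_fun setT zq.
Hypothesis yzq : forall s, yl <= yq s <= yu /\ zl <= zq s <= zu.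
Definition param_w (s : R) := if s <= a then yq s else zq (s - a).
Local Notation w := param_w.
Hypothesis wlaw : forall B, measurable B -> unif01 [set s | B (w s)] = nu B.
Local Notation cl := (clamp yl zu).
Hypothesis mean : \int[mu]_x cl x = \int[nu]_x cl x.

Let hyps : [/\ yl <= yu, yu < xl, xl <= xu, xu < zl & zl <= zu].
Proof. by split. Qed.

Let clz : yl <= zu. Proof. by case: hyps; lra. Qed.

Let a01 : 0 <= a <= 1.
Proof. by rewrite -!lee_fin -nuL measure_ge0 probability_le1. Qed.

Lemma measurable_param : measurable_fun setT w.
Proof.
apply: measurable_fun_ifT => //; first exact: measurable_fun_ler.
by apply: measurableT_comp => //; exact: measurable_funB.
Qed.

Lemma param_itv s : yl <= w s <= zu.
Proof.
case: hyps => h1 h2 h3 h4 h5; have [/andP[? ?] /andP[? ?]] := yzq s.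
have [_ /andP[? ?]] := yzq (s - a).
by rewrite /param_w; case: ifP => _; apply/andP; split; lra.
Qed.

Let bw : bmeas _ R w.
Proof. by apply: bmeas_bounded param_itv; exact: measurable_param. Qed.

Definition cumW (s : R) := \int[unif01]_v (\1_[set v | v <= s] v * w v).
Local Notation W := cumW.

Let mray (s : R) : measurable [set v : R | v <= s].
Proof. exact: measurable_set_le. Qed.

Let mi (s t : R) : measurable (`]s, t]%classic : set R). Proof. by []. Qed.

Lemma cumW_incr s t : s <= t -> W t - W s = \int[unif01]_v (\1_(`]s, t]%classic) v * w v).
Proof.
move=> st; rewrite /cumW -bRintB; [|by apply: bmeasM => //; exact: bmeas_indic..].
apply: eq_Rintegral => v _; rewrite -mulrBl; congr (_ * _).
rewrite (indic_boolE _ _ (v <= t))// (indic_boolE _ _ (v <= s))//.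
rewrite (indic_boolE _ _ ((s < v) && (v <= t))); last by rewrite /= in_itv.
have [vs|sv] := leP v s; first by rewrite (le_trans vs st) subrr.
by rewrite subr0.
Qed.

Let incr_bounds lo hi s t : 0 <= s -> s <= t -> t <= 1 ->
  (forall v, s < v -> v <= t -> lo <= w v <= hi) ->
  lo * (t - s) <= W t - W s <= hi * (t - s).
Proof.
move=> s0 st t1 h; rewrite cumW_incr//.
have -> : t - s = fine (unif01 (`]s, t]%classic : set R)) by rewrite unif01_itv.
apply: Rint_indic_bounds => //; apply: aeW => v /=; rewrite in_itv/= => /andP[]; exact: h.
Qed.

Lemma cumW_low s t : 0 <= s -> s <= t -> t <= a ->
  yl * (t - s) <= W t - W s <= yu * (t - s).
Proof.
move=> s0 st ta; apply: incr_bounds => //; first by case/andP: a01 => _; exact: le_trans.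
by move=> v sv vt; rewrite /param_w (le_trans vt ta); have [] := yzq v.
Qed.

Lemma cumW_up s t : a <= s -> s <= t -> t <= 1 ->
  zl * (t - s) <= W t - W s <= zu * (t - s).
Proof.
move=> sa st ta; apply: incr_bounds => //; first by case/andP: a01 => + _ => /le_trans; exact.
move=> v sv vt; rewrite /param_w [v <= a]leNgt (le_lt_trans sa sv)/=.
by have [] := yzq (v - a).
Qed.

Let K := `|yl| + `|zu|.

Lemma cumW_lip s t : s <= t -> `|W t - W s| <= K * (t - s).
Proof.
move=> st; rewrite cumW_incr//.
have K0 : 0 <= K by rewrite addr_ge0.
have p0 : 0 <= fine (unif01 (`]s, t]%classic : set R)) by rewrite fine_ge0.
have p1 : fine (unif01 (`]s, t]%classic : set R)) <= t - s.
  rewrite -lee_fin fineK; first exact: unif01_itv_le.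
  exact: fin_num_measure.
have /andP[h1 h2] : - K * fine (unif01 (`]s, t]%classic : set R)) <=
   \int[unif01]_v (\1_(`]s, t]%classic) v * w v) <= K * fine (unif01 (`]s, t]%classic : set R)).
  apply: Rint_indic_bounds => //; apply: aeW => v _.
  have /andP[w1 w2] := param_itv v.
  rewrite /K; apply/andP; split.
    rewrite opprD; have := ler_norm (- yl); rewrite normrN => h.
    have := normr_ge0 zu; lra.
  by have := ler_norm zu; have := normr_ge0 yl; lra.
rewrite ler_norml; apply/andP; split.
  apply: le_trans h1; rewrite mulNr lerN2; exact: ler_wpM2l.
by apply: le_trans h2 _; exact: ler_wpM2l.
Qed.

Lemma cumW0 : W 0 = 0.
Proof.
have -> : W 0 = \int[unif01]_v (cst 0 v : R).
  apply: bRint_ae; [by apply: bmeasM => //; exact: bmeas_indic|exact: bmeas_cst|].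
  apply: filterS (@unif01_ae_itv R) => v /andP[v0 _].
  by rewrite (indic_boolE _ _ (v <= 0))// leNgt v0/= mul0r.
by rewrite Rintegral_cst// mul0r.
Qed.

Lemma cumW1 : W 1 = \int[mu]_x cl x.
Proof.
have bcl : bmeas _ R cl by exact: bmeas_clamp.
rewrite mean (bRint_push _ _ _ _ (@unif01 R) nu w)//; [|exact: measurable_param|].
  apply: bRint_ae; [by apply: bmeasM => //; exact: bmeas_indic| |].
    by apply: bmeas_comp => //; exact: measurable_param.
  apply: filterS (@unif01_ae_itv R) => v /andP[_ v1].
  rewrite (indic_boolE _ _ (v <= 1))// v1 mul1r clamp_id//; exact: param_itv.
by move=> B mB; exact: esym (wlaw B mB).
Qed.

Local Notation M := (dfun mu).
Definition cumA (x : R) := \int[mu]_t (\1_[set t | t <= x] t * cl t).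
Local Notation A := cumA.

Let bcl : bmeas _ R cl. Proof. exact: bmeas_clamp. Qed.

Let mu_itv : {ae mu, forall t, xl <= cl t <= xu}.
Proof.
have := prob1_ae _ _ mu _ (measurable_itv `[xl, xu]) mu1.
apply: filterS => t /=; rewrite in_itv/= => h; rewrite clamp_id//.
by move/andP: h => [h1 h2]; case: hyps => *; apply/andP; split; lra.
Qed.

Lemma cumA_bounds x : xl * M x <= A x <= xu * M x.
Proof.
have -> : M x = fine (mu [set t | t <= x]).
  by rewrite /dfun; congr (fine (mu _)); apply/seteqP; split => t /=; rewrite in_itv.
by apply: Rint_indic_bounds => //; apply: filterS mu_itv => t.
Qed.

Lemma cumA_incr x x' : x <= x' -> xl * (M x' - M x) <= A x' - A x <= xu * (M x' - M x).
Proof.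
move=> xx'; have -> : M x' - M x = fine (mu `]x, x']%classic) by rewrite dfun_itv.
have -> : A x' - A x = \int[mu]_t (\1_(`]x, x']%classic) t * cl t).
  rewrite /cumA -bRintB; [|by apply: bmeasM => //; exact: bmeas_indic..].
  apply: eq_Rintegral => v _; rewrite -mulrBl; congr (_ * _).
  rewrite (indic_boolE _ _ (v <= x'))// (indic_boolE _ _ (v <= x))//.
  rewrite (indic_boolE _ _ ((x < v) && (v <= x'))); last by rewrite /= in_itv.
  have [vs|sv] := leP v x; first by rewrite (le_trans vs xx') subrr.
  by rewrite subr0.
by apply: Rint_indic_bounds => //; apply: filterS mu_itv => t.
Qed.

(** Equality of the means of [mu] and [nu] enters here: the sources [> x] have the
    first moment [W 1 - A x]. *)
Lemma cumA_upper x : xl * (1 - M x) <= W 1 - A x <= xu * (1 - M x).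
Proof.
rewrite cumW1.
have mC : measurable (~` [set t : R | t <= x]) by exact: measurableC.
have -> : 1 - M x = fine (mu (~` [set t | t <= x])).
  rewrite probability_setC// (_ : mu [set t | t <= x] = (M x)%:E)//.
  by rewrite -dfunE; congr (mu _); apply/seteqP; split => t /=; rewrite in_itv.
have -> : \int[mu]_x cl x - A x = \int[mu]_t (\1_(~` [set t | t <= x]) t * cl t).
  rewrite /cumA -bRintB//; [|by apply: bmeasM => //; exact: bmeas_indic].
  apply: eq_Rintegral => v _; rewrite -{1}[cl v]mul1r -mulrBl; congr (_ * _).
  rewrite (indic_boolE _ _ (v <= x))// (indic_boolE _ _ (~~ (v <= x))); last first.
    by split => [/negP|/negP].
  by case: (v <= x); rewrite ?subrr ?subr0.
by apply: Rint_indic_bounds => //; apply: filterS mu_itv => t.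
Qed.

Lemma split_exists x :
  exists q, [/\ 0 <= q <= a, 0 <= M x - q <= 1 - a & W q + (W (a + (M x - q)) - W a) = A x].
Proof.
case: hyps => h1 h2 h3 h4 h5; have /andP[A1 A2] := cumA_bounds x.
apply: (splitting_exists yl yu xl xu zl zu a K W) => //.
- exact: cumW_lip.
- exact: cumW_low.
- exact: cumW_up.
- exact: cumW0.
- exact: dfun01.
- exact: cumA_upper.
Qed.

Lemma split_mono x x' q q' :
  0 <= q <= a -> 0 <= M x - q <= 1 - a -> W q + (W (a + (M x - q)) - W a) = A x ->
  0 <= q' <= a -> 0 <= M x' - q' <= 1 - a -> W q' + (W (a + (M x' - q')) - W a) = A x' ->
  x <= x' -> q <= q' /\ M x - q <= M x' - q'.
Proof.
move=> e1 e2 e3 e4 e5 e6 xx'; case: hyps => h1 h2 h3 h4 h5.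
apply: (splitting_mono yl yu xl xu zl zu a W _ _ _ _ _ (M x) (A x) q (M x') (A x') q') => //.
- exact: cumW_low.
- exact: cumW_up.
- exact: dfun_nd.
- exact: cumA_incr.
Qed.

Definition low_mass x := sval (cid (split_exists x)).
Definition up_mass x := M x - low_mass x.
Local Notation q := low_mass.
Local Notation r := up_mass.

Lemma low_massP x : [/\ 0 <= q x <= a, 0 <= r x <= 1 - a & W (q x) + (W (a + r x) - W a) = A x].
Proof. by rewrite /up_mass /low_mass; case: cid. Qed.

Lemma mass_nd x x' : x <= x' -> q x <= q x' /\ r x <= r x'.
Proof.
have [e1 e2 e3] := low_massP x; have [e4 e5 e6] := low_massP x'.
exact: split_mono.
Qed.

(** Right-continuity of the sum [q + r] passes to both terms, as they are
    nondecreasing. *)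
Lemma low_mass_rc s t : (forall t', t < t' -> s <= q t') -> s <= q t.
Proof.
move=> h; have : s + r t <= M t.
  apply: dfun_rc => t' tt'; have := h _ tt'; have [_ +] := mass_nd _ _ (ltW tt').
  by rewrite /up_mass; lra.
by rewrite /up_mass; lra.
Qed.

Lemma up_mass_rc s t : (forall t', t < t' -> s <= r t') -> s <= r t.
Proof.
move=> h; have : s + q t <= M t.
  apply: dfun_rc => t' tt'; have := h _ tt'; have [+ _] := mass_nd _ _ (ltW tt').
  by rewrite /up_mass; lra.
by rewrite /up_mass; lra.
Qed.

Lemma mass_max : q xu = a /\ r xu = 1 - a.
Proof.
have [/andP[_ e1] /andP[_ e2] _] := low_massP xu.
have := dfun_max mu xl xu mu1; move: e1 e2; rewrite /up_mass; lra.
Qed.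

Lemma mass_min x : x < xl -> q x = 0 /\ r x = 0.
Proof.
move=> xxl; have [/andP[e1 _] /andP[e2 _] _] := low_massP x.
have := dfun_min mu xl xu mu1 _ xxl; move: e1 e2; rewrite /up_mass; lra.
Qed.

(** The source from which the target at parameter [s] is reached. *)
Definition param_X (s : R) := if s <= a then ginv xl xu q s else ginv xl xu r (s - a).
Local Notation X := param_X.

Lemma param_X_itv s : xl <= X s <= xu.
Proof. by rewrite /param_X; case: ifP => _; exact: ginv_itv. Qed.

Lemma measurable_param_X : measurable_fun setT X.
Proof.
apply: measurable_fun_ifT => //; first exact: measurable_fun_ler.
  by apply: measurable_ginv.
by apply: (measurableT_comp (measurable_ginv _ _ _ _)) => //; exact: measurable_funB.
Qed.

Lemma param_X_le s t : 0 < s <= 1 ->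
  (X s <= t) = (s <= a) && (s <= q t) || (a < s) && (s <= a + r t).
Proof.
move=> /andP[s0 s1]; have [qa rb] := mass_max.
rewrite /param_X; have [sa|a_s] := leP s a; rewrite /= ?orbF.
  have [ct|tc] := leP xl t.
    apply: ginv_le => //; [by move=> x y /mass_nd[]|exact: low_mass_rc|by rewrite qa].
  have [-> _] := mass_min _ tc; rewrite [RHS]leNgt s0/=; apply/negbTE; rewrite -ltNge.
  by apply: lt_le_trans tc _; have /andP[] := ginv_itv xl xu q xlu s.
have -> : (s <= a + r t) = (s - a <= r t) by rewrite lerBlDl.
have [ct|tc] := leP xl t.
  by apply: ginv_le => //; [by move=> x y /mass_nd[]|exact: up_mass_rc|rewrite rb; lra].
have [_ ->] := mass_min _ tc; rewrite [RHS]leNgt subr_gt0 a_s/=; apply/negbTE; rewrite -ltNge.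
by apply: lt_le_trans tc _; have /andP[] := ginv_itv xl xu r xlu (s - a).
Qed.

Lemma param_X_integral (f : R -> R) t : bmeas _ _ f ->
  \int[unif01]_s (\1_[set s | X s <= t] s * f s) =
  \int[unif01]_s (\1_[set v | v <= q t] s * f s) +
  (\int[unif01]_s (\1_[set v | v <= a + r t] s * f s) - \int[unif01]_s (\1_[set v | v <= a] s * f s)).
Proof.
move=> hf; have hi S : measurable S -> bmeas _ R (fun s => \1_S s * f s).
  by move=> mS; apply: bmeasM => //; exact: bmeas_indic.
have mXt : measurable [set s | X s <= t].
  by apply: measurable_set_le => //; exact: measurable_param_X.
rewrite -bRintB; [|exact: hi..]; rewrite -bRintD; [|exact: hi|by apply: bmeasB; exact: hi].
apply: bRint_ae; [exact: hi|by apply: bmeasD; [|apply: bmeasB]; exact: hi|].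
apply: filterS (@unif01_ae_itv R) => s s01.
have [/andP[_ qa] /andP[r0 _] _] := low_massP t.
rewrite (indic_boolE _ _ (X s <= t))// (indic_boolE _ _ (s <= q t))//.
rewrite (indic_boolE _ _ (s <= a + r t))// (indic_boolE _ _ (s <= a))//.
rewrite param_X_le//; have [sa|a_s] := leP s a; rewrite /= ?orbF.
  have -> : s <= a + r t by lra.
  by rewrite subrr addr0.
have -> : (s <= q t) = false by apply/negbTE; rewrite -ltNge; lra.
by rewrite mul0r subr0 add0r.
Qed.

Let brayM (f : R -> R) (s : R) : bmeas _ _ f -> bmeas _ R (fun v => \1_[set v | v <= s] v * f v).
Proof. by move=> hf; apply: bmeasM => //; exact: bmeas_indic. Qed.

Lemma unif01_param_X_le t : unif01 [set s | X s <= t] = (M t)%:E.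
Proof.
have [/andP[q0 qa] /andP[r0 ra] _] := low_massP t; case/andP: a01 => a0 a1.
have mXt : measurable [set s | X s <= t].
  by apply: measurable_set_le => //; exact: measurable_param_X.
have fin A : measurable A -> unif01 A = (fine (unif01 A))%:E :> \bar R.
  by move=> mA; rewrite fineK// fin_num_measure.
have uE (s : R) : 0 <= s <= 1 -> \int[unif01]_v (\1_[set v | v <= s] v * cst 1 v) = s.
  move=> s01; transitivity (\int[unif01]_v (\1_[set v | v <= s] v : R)).
    by apply: eq_Rintegral => v _; rewrite mulr1.
  rewrite Rint_indic// [X in fine X](_ : _ = s%:E)//; exact: unif01_le.
rewrite fin//; congr (_%:E).
rewrite -Rint_indic//; transitivity (\int[unif01]_s (\1_[set s | X s <= t] s * cst 1 s)).
  by apply: eq_Rintegral => v _; rewrite mulr1.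
rewrite param_X_integral; last exact: bmeas_cst.
by rewrite !uE; [rewrite /up_mass; ring|apply/andP; split; lra..].
Qed.

Lemma param_X_law B : measurable B -> unif01 [set s | B (X s)] = mu B.
Proof.
pose Xm : {mfun R >-> R} := mfun_Sub (mem_set measurable_param_X).
apply: (measure_eq_closed_rays (distribution (@unif01 R) Xm) mu).
  by rewrite (_ : _ setT = 1%E) ?ltry//; exact: probability_setT.
move=> t; apply: etrans (esym (dfunE mu t)).
rewrite -unif01_param_X_le; apply: unif01_eq => s _ /=.
by rewrite in_itv.
Qed.

(** The two sides are measures of [S] after a shift by [yl] that makes the densities
    nonnegative; on rays they agree by the equation defining [low_mass]. *)
Lemma param_moment S : measurable S ->
  \int[unif01]_s (\1_S (X s) * w s) = \int[mu]_x (\1_S x * cl x).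
Proof.
have mX := measurable_param_X; have mw := measurable_param.
have mf1 : measurable_fun setT (fun s => w s - yl) by exact: measurable_funB.
have f10 s : 0 <= w s - yl by rewrite subr_ge0; have /andP[] := param_itv s.
have mf2 : measurable_fun setT (fun x => cl x - yl).
  by apply: measurable_funB => //; exact: measurable_clamp.
have f20 x : 0 <= cl x - yl by rewrite subr_ge0; have /andP[] := clamp_itv _ _ clz x.
have b1 : bmeas _ R (fun s => w s - yl) by apply: bmeasB => //; exact: bmeas_cst.
have b2 : bmeas _ R (fun x => cl x - yl) by apply: bmeasB => //; exact: bmeas_cst.
have mpre B : measurable B -> measurable (X @^-1` B).
  by move=> mB; rewrite -[Y in measurable Y]setTI; exact: (mX measurableT).
pose m1 := @density_image _ _ _ _ R (@unif01 R) _ _ mf1 f10 mX.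
pose m2 := @density_image _ _ _ _ R mu _ _ mf2 f20 (@measurable_id _ R setT).
have m1E B : measurable B -> m1 B = (\int[unif01]_s (\1_B (X s) * (w s - yl)))%:E.
  move=> mB; rewrite /m1 /density_image.
  rewrite -[RHS](_ : (\int[unif01]_s (\1_(X @^-1` B) s * (w s - yl)))%:E = _)//.
  rewrite bRint_indic; [|by []|exact: mpre].
  rewrite /Rintegral fineK//; apply: integrable_fin_num; first exact: mpre.
  by apply: integrableS (bmeas_integrable _ _ unif01 _ b1) => //; exact: mpre.
have m2E B : measurable B -> m2 B = (\int[mu]_x (\1_B x * (cl x - yl)))%:E.
  move=> mB; rewrite /m2 /density_image preimage_id bRint_indic//.
  rewrite /Rintegral fineK//; apply: integrable_fin_num => //.
  by apply: integrableS (bmeas_integrable _ _ mu _ b2).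
have sub1 B : measurable B -> \int[unif01]_s (\1_B (X s) * (w s - yl)) =
    \int[unif01]_s (\1_B (X s) * w s) - yl * fine (mu B).
  move=> mB; rewrite -param_X_law//.
  have mXB : measurable [set s | B (X s)] by exact: mpre.
  have bi : bmeas _ R (\1_[set s | B (X s)] : R -> R) by exact: bmeas_indic.
  rewrite -Rint_indic// -bRintZ// -bRintB.
  - by apply: eq_Rintegral => s _; rewrite mulrBr [yl * _]mulrC.
  - exact: bmeasM bi bw.
  - by apply: bmeasM => //; exact: bmeas_cst.
have sub2 B : measurable B -> \int[mu]_x (\1_B x * (cl x - yl)) =
    \int[mu]_x (\1_B x * cl x) - yl * fine (mu B).
  move=> mB; have bi : bmeas _ R (\1_B : R -> R) by exact: bmeas_indic.
  rewrite -Rint_indic// -bRintZ// -bRintB.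
  - by apply: eq_Rintegral => s _; rewrite mulrBr [yl * _]mulrC.
  - exact: bmeasM.
  - by apply: bmeasM => //; exact: bmeas_cst.
move=> mS; suff : m1 S = m2 S by rewrite m1E// m2E// sub1// sub2// => -[/addIr].
apply: (measure_eq_closed_rays m1 m2) => //.
  by rewrite [X in (X < _)%E](m1E setT)// ltry.
move=> t; apply: etrans (m1E _ _) _ => //; apply: esym; apply: etrans (m2E _ _) _ => //.
congr (_%:E); rewrite sub1// sub2//; congr (_ - _).
have rayE (x : R) : \1_(`]-oo, t]%classic) x = \1_[set v | v <= t] x :> R.
  by rewrite !(indic_boolE _ _ (x <= t))//= in_itv.
transitivity (A t); first by apply: eq_Rintegral => x _; rewrite rayE.
have [_ _ <-] := low_massP t.
by rewrite -param_X_integral.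
Qed.

Let mXw : measurable_fun setT (fun s => (X s, w s)).
Proof. by apply: measurable_fun_pair; [exact: measurable_param_X|exact: measurable_param]. Qed.

Definition param_map : {mfun R >-> (R * R)%type} := mfun_Sub (mem_set mXw).

Definition param_coupling : probability (R * R)%type R := distribution (@unif01 R) param_map.

Lemma param_couplingE C : param_coupling C = unif01 [set s | C (X s, w s)].
Proof. by []. Qed.

Lemma param_coupling_coupling : coupling mu nu param_coupling.
Proof.
split => B mB; rewrite param_couplingE -?wlaw -?param_X_law//.
  by apply: unif01_eq => s _ /=; split => // -[].
by apply: unif01_eq => s _ /=; split => // -[].
Qed.

Let muc : mu `[yl, zu]%classic = 1%E.
Proof.
apply: ae_prob1 => //; have := prob1_ae _ _ mu _ (measurable_itv `[xl, xu]) mu1.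
apply: filterS => t /=; rewrite !in_itv/= => /andP[h1 h2].
by case: hyps => *; apply/andP; split; lra.
Qed.

Let nuc : nu `[yl, zu]%classic = 1%E.
Proof.
rewrite -wlaw// (_ : [set s | _] = setT) ?probability_setT//.
by apply/seteqP; split => // s _ /=; rewrite in_itv/= param_itv.
Qed.

Lemma param_coupling_martingale : martingale_coupling mu nu param_coupling.
Proof.
apply: (martingale_of_moment yl zu) => //; first exact: param_coupling_coupling.
move=> S mS; rewrite -param_moment//.
rewrite (bRint_push _ _ _ _ (@unif01 R) param_coupling (fun s => (X s, w s)))//.
  apply: eq_Rintegral => s _; rewrite clamp_id//; exact: param_itv.
apply: bmeasM; first by apply: bmeas_fst; exact: bmeas_indic.
by apply: bmeas_snd.
Qed.

Section Directed.
Variable tau : R.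
Hypothesis tau1 : tau = 1 \/ tau = -1.
Hypothesis yq_mono : forall s t, s <= t -> tau * yq s <= tau * yq t.
Hypothesis zq_mono : forall s t, s <= t -> tau * zq s <= tau * zq t.

Definition low_map (x : R) := yq (q x).
Definition up_map (x : R) := zq (r x).

Let box : set (R * R) := `[xl, xu]%classic `*` (`[yl, yu]%classic `|` `[zl, zu]%classic).
Let mLU : measurable (`[yl, yu]%classic `|` `[zl, zu]%classic : set R).
Proof. exact: measurableU. Qed.

Let mbox : measurable box. Proof. exact: measurableX. Qed.

Lemma param_box s : box (X s, w s).
Proof.
split; first by rewrite /= in_itv/= param_X_itv.
rewrite /= /param_w; case: ifP => _; [left|right]; rewrite /= in_itv/=.
  by have [] := yzq s.
by have [] := yzq (s - a).
Qed.

Lemma param_graph s : 0 < s <= 1 -> mono_graph tau yu low_map up_map (X s, w s).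
Proof.
move=> s01; have Xle t := param_X_le s t s01.
case: hyps => g1 g2 g3 g4 g5.
have [/andP[y1 y2] _] := yzq s; have [_ /andP[z1 z2]] := yzq (s - a).
have [sa|a_s] := leP s a.
  have we : w s = yq s by rewrite /param_w sa.
  have Xq t : (X s <= t) = (s <= q t) by rewrite Xle sa/= [a < s]ltNge sa orbF.
  split => t; rewrite /side_map /= we y2 /low_map => h; apply: yq_mono.
    by apply/ltW; rewrite ltNge -Xq -ltNge.
  by rewrite -Xq ltW.
have we : w s = zq (s - a) by rewrite /param_w [s <= a]leNgt a_s.
have Xr t : (X s <= t) = (s - a <= r t) by rewrite Xle [s <= a]leNgt a_s/= lerBlDl.
have yz : (zq (s - a) <= yu) = false by apply/negbTE; rewrite -ltNge; lra.
split => t; rewrite /side_map /= we yz /up_map => h; apply: zq_mono.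
  by apply/ltW; rewrite ltNge -Xr -ltNge.
by rewrite -Xr ltW.
Qed.

Lemma measurable_low_map : measurable_fun setT low_map.
Proof.
apply: measurableT_comp myq _; apply: nondecreasing_measurable => // s t st.
by have [] := mass_nd _ _ st.
Qed.

Lemma measurable_up_map : measurable_fun setT up_map.
Proof.
apply: measurableT_comp mzq _; apply: nondecreasing_measurable => // s t st.
by have [] := mass_nd _ _ st.
Qed.

Lemma param_coupling_support C :
  (forall p, mono_graph tau yu low_map up_map p -> box p -> C p) -> param_coupling C = 1%E.
Proof.
move=> hC; rewrite param_couplingE (unif01_eq _ setT) ?probability_setT// => s s01.
by split => // _; apply: hC; [exact: param_graph|exact: param_box].
Qed.

Lemma coupling_box (pi : probability (R * R)%type R) : coupling mu nu pi -> pi box = 1%E.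
Proof.
move=> cpl; apply: coupling_prod_support cpl _ mLU mu1 _; first exact: measurable_itv.
rewrite -wlaw// (_ : [set s | _] = setT) ?probability_setT//.
by apply/seteqP; split => // s _; have [_] := param_box s.
Qed.

Section Uniqueness.
Variables (pi : probability (R * R)%type R) (G : set (R * R)).
Hypotheses (cpl : coupling mu nu pi) (mart : martingale_coupling mu nu pi).
Hypotheses (mG : measurable G) (G1 : pi G = 1%E) (Gmono : tau_monotone tau G).

Let L : set R := `[yl, yu]%classic.
Let U : set R := `[zl, zu]%classic.
Let JL : set R := [set s | s <= a].
Let JU : set R := [set s | a < s].

Let piGB C : measurable C -> pi C = pi (C `&` (G `&` box)).
Proof.
move=> mC; have mGb : measurable (G `&` box) by exact: measurableI.
by rewrite (prob1_setI _ _ pi)// (prob1_setI _ _ pi)//; exact: coupling_box.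
Qed.

Let pi_null C : measurable C -> (forall p, C p -> G p -> box p -> False) -> pi C = 0%E.
Proof.
move=> mC h; rewrite piGB// (_ : _ `&` _ = set0) ?measure0//.
by apply/seteqP; split => // p [Cp [Gp bp]]; exact: h Cp Gp bp.
Qed.

(** If some point of [G] has source [<= x] and target beyond [t], then by
    monotonicity no point of [G] has source [> x] and target up to [t]. *)
Let slice_alternative (x : R) (I : set R) : measurable I ->
  (forall x1 y1 x2 y2, G (x1, y1) -> G (x2, y2) -> box (x1, y1) -> box (x2, y2) ->
     I y1 -> I y2 -> x1 < x2 -> tau * y1 <= tau * y2) ->
  forall t, pi (`]-oo, x]%classic `*` (I `\` tau_ray tau t)) = 0%E \/
            pi ((~` `]-oo, x]%classic) `*` (I `&` tau_ray tau t)) = 0%E.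
Proof.
move=> mI h t; have mt := measurable_tau_ray tau t.
have mC1 : measurable (`]-oo, x]%classic `*` (I `\` tau_ray tau t) : set (R * R)).
  by apply: measurableX => //; exact: measurableD.
have mC2 : measurable ((~` `]-oo, x]%classic) `*` (I `&` tau_ray tau t) : set (R * R)).
  by apply: measurableX; [exact: measurableC|exact: measurableI].
have [[p1 [[/= x1 [I1 n1]] [g1 b1]]]|none] :=
  pselect (exists p, (`]-oo, x]%classic `*` (I `\` tau_ray tau t)) p /\ G p /\ box p).
  right; apply: pi_null => // p2 [/= x2 [I2 r2]] g2 b2; apply: n1.
  case: p1 p2 => [u1 v1] [u2 v2] /= in x1 I1 g1 b1 x2 I2 r2 g2 b2 *.
  apply: le_trans r2; apply: h g1 g2 b1 b2 I1 I2 _.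
  move: x1 x2; rewrite !in_itv/= => u1x /negP; rewrite -ltNge; exact: le_lt_trans.
by left; apply: pi_null => // p Cp Gp bp; apply: none; exists p.
Qed.

Let mL : measurable L. Proof. exact: measurable_itv. Qed.
Let mU : measurable U. Proof. exact: measurable_itv. Qed.

Let nuLU1 : nu (L `|` U) = 1%E.
Proof.
rewrite -wlaw// (_ : [set s | _] = setT) ?probability_setT//.
by apply/seteqP; split => // s _; have [_] := param_box s.
Qed.

Let LU0 : L `&` U = set0.
Proof.
case: hyps => *; apply/seteqP; split => // y [] /=.
by rewrite /L /U /= !in_itv/= => /andP[? ?] /andP[? ?]; lra.
Qed.

Let nuU : nu U = (1 - a)%:E.
Proof.
have : nu (L `|` U) = (nu L + nu U)%E by exact: measureU.
rewrite nuLU1 nuL; have : nu U \is a fin_num by exact: fin_num_measure.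
by case: (nu U) => // u _ [->]; congr (_%:E); ring.
Qed.

Let w_low s : L (w s) <-> s <= a.
Proof.
case: hyps => *; have [/andP[? ?] _] := yzq s; have [_ /andP[? ?]] := yzq (s - a).
rewrite /L /param_w /= in_itv/=; case: ifP => _; split => //; first by move=> _; apply/andP.
by move=> /andP[]; lra.
Qed.

Let w_up s : U (w s) <-> a < s.
Proof.
case: hyps => *; have [/andP[? ?] _] := yzq s; have [_ /andP[? ?]] := yzq (s - a).
rewrite /U /param_w /= in_itv/= ltNge; case: ifP => _; split => //; last by move=> _; apply/andP.
by move=> /andP[]; lra.
Qed.

Let law_low B : measurable B -> unif01 (JL `&` w @^-1` B) = nu (B `&` L).
Proof.
move=> mB; rewrite -wlaw; last exact: measurableI.
by apply: unif01_eq => s _; split => -[/= h1 h2]; split => //; apply/w_low.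
Qed.

Let law_up B : measurable B -> unif01 (JU `&` w @^-1` B) = nu (B `&` U).
Proof.
move=> mB; rewrite -wlaw; last exact: measurableI.
by apply: unif01_eq => s _; split => -[/= h1 h2]; split => //; apply/w_up.
Qed.

Variable x : R.
Let ray : set R := `]-oo, x]%classic.
Let ql := fine (pi (ray `*` L)).
Let rl := fine (pi (ray `*` U)).

Let mrayB B : measurable B -> measurable (ray `*` B : set (R * R)).
Proof. by move=> mB; apply: measurableX => //; exact: measurable_itv. Qed.

Let qlE : pi (ray `*` L) = ql%:E.
Proof. by rewrite /ql fineK// fin_num_measure//; exact: mrayB. Qed.

Let rlE : pi (ray `*` U) = rl%:E.
Proof. by rewrite /rl fineK// fin_num_measure//; exact: mrayB. Qed.

Let ql_bounds : 0 <= ql <= a.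
Proof.
rewrite -!lee_fin -qlE -nuL measure_ge0/= -(cpl.2 _ mL); apply: le_measure; rewrite ?inE.
- exact: mrayB.
- exact: measurableX.
- by move=> p [].
Qed.

Let rl_bounds : 0 <= rl <= 1 - a.
Proof.
rewrite -!lee_fin -rlE -nuU measure_ge0/= -(cpl.2 _ mU); apply: le_measure; rewrite ?inE.
- exact: mrayB.
- exact: measurableX.
- by move=> p [].
Qed.

Let raysplit B : measurable B ->
  pi (ray `*` B) = (pi (ray `*` (B `&` L)) + pi (ray `*` (B `&` U)))%E.
Proof.
move=> mB; rewrite -measureU; [|by apply: mrayB; exact: measurableI|by apply: mrayB; exact: measurableI|]; last first.
  apply/seteqP; split => // -[u v] [[/= _ [_ h1]] [/= _ [_ h2]]].
  by have : (L `&` U) v by []; rewrite LU0.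
rewrite -(prob1_setI _ _ pi box mbox (coupling_box _ cpl)); last exact: mrayB.
rewrite -[RHS](prob1_setI _ _ pi box mbox (coupling_box _ cpl)); last first.
  by apply: measurableU; apply: mrayB; exact: measurableI.
congr (pi _); apply/seteqP; split => -[u v] [h1 [/= h2 h3]]; split => //.
  by case: h1 => /= *; case: h3 => h3; [left|right].
by case: h1 => -[/= ? []].
Qed.

Let mass_sum : ql + rl = M x.
Proof.
have := raysplit setT measurableT; rewrite !setTI qlE rlE => h.
apply/EFin_inj; rewrite EFinD -h -dfunE; exact: (cpl.1 _ (measurable_itv _)).
Qed.

Let inK (s : R) := (s <= ql) || (a < s) && (s <= a + rl).

(** The targets of the sources [<= x] fill an initial segment of the parameters on
    each side; its length is the mass sent there. *)
Let ray_law B : measurable B -> pi (ray `*` B) = unif01 [set s | inK s && `[< B (w s) >]].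
Proof.
move=> mB; have /andP[q0 qa] := ql_bounds; have /andP[r0 ra] := rl_bounds.
case/andP: a01 => a0 a1; case: hyps => g1 g2 g3 g4 g5.
have mJL : measurable JL by exact: mray.
have mJU : measurable JU by exact: measurable_set_lt.
have mw := measurable_param.
have hL := monotone_slice tau nu pi L JL w tau1 mL mJL mw cpl.2 law_low.
rewrite raysplit// (hL _ x ql)//; last 3 first.
- move=> s t /= sa ta st; rewrite /param_w sa ta; exact: yq_mono.
- apply: slice_alternative => // x1 y1 x2 y2 G1' G2' [/= b1 _] [/= b2 _] L1 L2 x12.
  move: b1 b2 L1 L2; rewrite /L /= !in_itv/= => /andP[? ?] /andP[? ?] /andP[? ?] /andP[? ?].
  by apply: (Gmono.1 _ _ _ _ G1' G2') => //; lra.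
- rewrite [LHS]qlE -unif01_le; last by apply/andP; split; lra.
  apply: unif01_eq => s _ /=; split => [h|[]//]; split => //; exact: le_trans qa.
have hU := monotone_slice tau nu pi U JU w tau1 mU mJU mw cpl.2 law_up.
rewrite (hU _ x (a + rl))//; last 3 first.
- move=> s t /= sa ta st; rewrite /param_w [s <= a]leNgt sa [t <= a]leNgt ta/=.
  by apply: zq_mono; lra.
- apply: slice_alternative => // x1 y1 x2 y2 G1' G2' [/= b1 _] [/= b2 _] L1 L2 x12.
  move: b1 b2 L1 L2; rewrite /U /= !in_itv/= => /andP[? ?] /andP[? ?] /andP[? ?] /andP[? ?].
  by apply: (Gmono.2 _ _ _ _ G1' G2') => //; lra.
- rewrite [LHS]rlE; transitivity ((a + rl - a)%:E); first by congr (_%:E); ring.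
  rewrite -unif01_itv; [|lra|lra|lra].
  by apply: unif01_eq => s _ /=; rewrite in_itv/=; split => [/andP[]|[-> ->]].
have mwB : measurable (w @^-1` B).
  by rewrite -[Y in measurable Y]setTI; exact: (mw measurableT).
rewrite -measureU.
- apply: unif01_eq => s s01 /=; rewrite /inK; split.
    move=> [[[/= h1 h2] h3]|[[/= h1 h2] h3]]; apply/andP; split; try exact/asboolP.
      by rewrite h2.
    by rewrite h1 h2 orbT.
  move=> /andP[/orP[h|/andP[h1 h2]] /asboolP h3]; [left|right]; split => //; split => //.
  exact: le_trans qa.
- by apply: measurableI => //; apply: measurableI => //; exact: mray.
- by apply: measurableI => //; apply: measurableI => //; exact: mray.
- apply/seteqP; split => // s [[[/= h1 _] _] [[/= h2 _] _]].
  by rewrite /JL/= in h1; rewrite /JU/= in h2; lra.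
Qed.

(** Restrictions to the ray are turned into images of probabilities by sending all
    the rest to the point [cem], above all targets. *)
Let cem := zu + 1.
Let Z1 (p : R * R) := if p.1 <= x then p.2 else cem.
Let Z2 (s : R) := if inK s then w s else cem.

Let mZ1 : measurable_fun setT Z1.
Proof.
apply: measurable_fun_ifT; [|exact: measurable_snd|exact: measurable_cst].
by apply: measurable_fun_ler => //; exact: measurable_fst.
Qed.

Let minK : measurable_fun setT inK.
Proof.
apply: measurable_or; first exact: measurable_fun_ler.
by apply: measurable_and; [exact: measurable_fun_ltr|exact: measurable_fun_ler].
Qed.

Let mZ2 : measurable_fun setT Z2.
Proof. by apply: measurable_fun_ifT => //; exact: measurable_param. Qed.

Let law1 : probability R R := distribution pi (mfun_Sub (mem_set mZ1) : {mfun (R * R)%type >-> R}).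
Let law2 : probability R R := distribution (@unif01 R) (mfun_Sub (mem_set mZ2) : {mfun R >-> R}).

Let law12 B : measurable B -> law1 B = law2 B.
Proof.
have nocem B' : measurable B' -> ~ B' cem -> law1 B' = law2 B'.
  move=> mB' nB'; transitivity (pi (ray `*` B')).
    congr (pi _); apply/seteqP; split => -[u v] /=; rewrite /Z1 /ray /= in_itv/=.
      by case: ifP.
    by move=> [->].
  rewrite ray_law//; apply: unif01_eq => s _ /=; rewrite /Z2.
  by case: (inK s) => /=; split => // /asboolP.
move=> mB; have [Bc|] := pselect (B cem); last exact: nocem.
have mC := measurableC mB.
have := nocem _ mC; rewrite !probability_setC// => /(_ (fun h => h Bc)).
have : law1 B \is a fin_num by exact: fin_num_measure.
have : law2 B \is a fin_num by exact: fin_num_measure.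
case: (law1 B) => // u; case: (law2 B) => // v _ _ [/addrI/oppr_inj ->] //.
Qed.

(** So the mass sent low by [pi] solves the equation that defines [low_mass]. *)
Let ray_mean : W ql + (W (a + rl) - W a) = A x.
Proof.
have /andP[q0 qa] := ql_bounds; have /andP[r0 ra] := rl_bounds.
have mrx : measurable [set t : R | t <= x] by [].
pose f (z : R) := if z <= zu then cl z else 0.
have mf : measurable_fun setT f.
  by apply: measurable_fun_ifT => //; [exact: measurable_fun_ler|exact: measurable_clamp].
have bf : bmeas _ R f.
  split => //; have [_ [N hN]] := bcl; exists N => z; rewrite /f; case: ifP => _ //.
  by rewrite normr0 (le_trans _ (hN 0)).
have b1 : bmeas _ R (\1_[set t : R | t <= x] : R -> R) by exact: bmeas_indic.
rewrite -[RHS](martingale_moment yl zu clz mu nu pi muc nuc _ mart b1).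
transitivity (\int[law1]_z f z).
  rewrite (bRint_push _ _ _ _ (@unif01 R) law1 Z2)//.
    rewrite /cumW -bRintB; [|exact: brayM..].
    rewrite -bRintD; [|exact: brayM|by apply: bmeasB; exact: brayM].
    apply: eq_Rintegral => s _.
    rewrite (indic_boolE _ _ (s <= ql))// (indic_boolE _ _ (s <= a + rl))// (indic_boolE _ _ (s <= a))//.
    have /andP[w1 w2] := param_itv s.
    have cemf : f cem = 0 by rewrite /f /cem leNgt ltrDl ltr01.
    have wf : f (w s) = w s by rewrite /f w2 clamp_id// w1.
    rewrite /Z2 /inK; have [sq|qs] := leP s ql; rewrite /=.
      by rewrite wf (le_trans sq qa) (_ : s <= a + rl); [rewrite subrr addr0 mul1r|lra].
    have [sa|a_s] := leP s a; rewrite /= ?cemf.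
      by rewrite (_ : s <= a + rl); [rewrite subrr addr0 mul0r|lra].
    by case: ifP => _; rewrite ?wf ?cemf !mul0r subr0 add0r ?mul1r.
rewrite (bRint_push _ _ _ _ pi law1 Z1)//.
apply: bRint_ae.
- exact: bmeas_comp bf mZ1.
- by apply: bmeasM; [exact: bmeas_fst|exact: bmeas_snd].
- apply: filterS (prob1_ae _ _ pi _ mbox (coupling_box _ cpl)) => -[u v] [_ /= hv].
  case: hyps => *; rewrite (indic_boolE _ _ (u <= x))// /Z1 /=.
  case: ifP => _; last by rewrite mul0r /f /cem leNgt ltrDl ltr01.
  rewrite mul1r /f; suff -> : v <= zu by [].
  by case: hv => /=; rewrite in_itv/= => /andP[]; lra.
Qed.

Lemma ray_coupling_eq B : measurable B -> pi (ray `*` B) = param_coupling (ray `*` B).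
Proof.
move=> mB; have [e1 e2 e3] := low_massP x.
have rlq : rl = M x - ql by rewrite -mass_sum; ring.
have f2 := rl_bounds; rewrite rlq in f2; have f3 := ray_mean; rewrite rlq in f3.
have [h1 _] := split_mono x x ql (q x) ql_bounds f2 f3 e1 e2 e3 (lexx x).
have [h2 _] := split_mono x x (q x) ql e1 e2 e3 ql_bounds f2 f3 (lexx x).
have qlq : ql = q x by apply/eqP; rewrite eq_le h1 h2.
rewrite ray_law// param_couplingE; apply: unif01_eq => s s01.
rewrite /ray /= in_itv/= param_X_le// /inK rlq qlq -/(r x).
have [/andP[_ qa] _ _] := low_massP x.
have -> : (s <= a) && (s <= q x) = (s <= q x).
  by apply/andb_idl => h; exact: le_trans qa.
by split => [/andP[-> /asboolP]|[-> h]] //; exact/asboolP.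
Qed.

End Uniqueness.

(** On each ray of sources, the mean determines how much mass goes to each side, and
    monotonicity which targets it reaches. *)
Lemma monotone_coupling_unique (pi : probability (R * R)%type R) (G : set (R * R)) :
  martingale_coupling mu nu pi -> measurable G -> pi G = 1%E -> tau_monotone tau G ->
  forall C, measurable C -> pi C = param_coupling C.
Proof.
move=> mart mG G1 Gm; have cpl := mart.1.
apply: product_measure_eq => [|B D mB mD].
  by rewrite (_ : _ setT = 1%E) ?ltry//; exact: probability_setT.
apply: (measure_eq_closed_rays (slice pi D mD) (slice param_coupling D mD)) => //.
  rewrite (le_lt_trans (_ : _ <= 1)%E) ?ltry//; apply: probability_le1.
  exact: measurableX.
by move=> t; apply: (ray_coupling_eq pi G cpl mart mG G1 Gm t D mD).
Qed.

End Directed.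

End Parametrized.

Lemma exists_monotone_coupling {R : realType} (mu nu : probability R R) (yl yu xl xu zl zu tau : R) :
  yl <= yu -> yu < xl -> xl <= xu -> xu < zl -> zl <= zu -> tau = 1 \/ tau = -1 ->
  mu `[xl, xu]%classic = 1%E -> nu (`[yl, yu]%classic `|` `[zl, zu]%classic) = 1%E ->
  \int[mu]_x clamp yl zu x = \int[nu]_x clamp yl zu x ->
  exists (pi0 : probability (R * R)%type R) (T1 T2 : R -> R),
  [/\ martingale_coupling mu nu pi0,
      measurable_fun setT T1 /\ measurable_fun setT T2,
      forall s, yl <= T1 s <= yu /\ zl <= T2 s <= zu,
      forall C, (forall p, mono_graph tau yu T1 T2 p ->
          (`[xl, xu]%classic `*` (`[yl, yu]%classic `|` `[zl, zu]%classic)) p -> C p) ->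
        pi0 C = 1%E &
      forall (pi : probability (R * R)%type R) G, martingale_coupling mu nu pi ->
        measurable G -> pi G = 1%E -> tau_monotone tau G ->
        forall C, measurable C -> pi C = pi0 C].
Proof.
move=> yly yx xlu xz zlz tau1 mu1 nu1 mean.
have yz : yu < zl by lra.
have [a [yq [zq [nuL [myq mzq] yzq [ymono zmono] wlaw]]]] :=
  exists_monotone_param nu yl yu zl zu tau yly yz zlz tau1 nu1.
exists (param_coupling _ _ _ _ _ _ _ _ _ _ _ yly yx xlu xz zlz mu1 nuL myq mzq yzq wlaw mean).
exists (low_map _ _ _ _ _ _ _ _ _ _ _ yly yx xlu xz zlz mu1 nuL myq mzq yzq wlaw mean).
exists (up_map _ _ _ _ _ _ _ _ _ _ _ yly yx xlu xz zlz mu1 nuL myq mzq yzq wlaw mean).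
split.
- exact: param_coupling_martingale.
- by split; [exact: measurable_low_map|exact: measurable_up_map].
- by move=> s; split; [exact: (yzq _).1|exact: (yzq _).2].
- by move=> C hC; exact: (param_coupling_support _ _ _ _ _ _ _ _ _ _ _ _ _ _ _ _ _ _ _ _ _ _ _ _ ymono zmono).
- by move=> pi G mart mG G1 Gm; exact: (monotone_coupling_unique _ _ _ _ _ _ _ _ _ _ _ _ _ _ _ _ _ _ _ _ _ _ _ _ tau1 ymono zmono pi G).
Qed.

(** * Integrating the cost in the source *)

Section LebI.
Context {R : realType} (a b : R).
(** Lebesgue measure on an interval, again on the measurable structure of [R] that
    [mu] and [nu] use. *)
Definition leb_itv : set R -> \bar R := fun A => lebesgue_measure (A `&` `[a, b]).

Let leb_itv_0 : leb_itv set0 = 0%E. Proof. by rewrite /leb_itv set0I measure0. Qed.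

Let leb_itv_ge0 A : (0 <= leb_itv A)%E. Proof. exact: measure_ge0. Qed.

Let leb_itv_sigma_additive : semi_sigma_additive leb_itv.
Proof.
exact: (@measure_semi_sigma_additive _ _ _
  (mrestr lebesgue_measure (measurable_itv `[a, b]))).
Qed.

HB.instance Definition _ :=
  isMeasure.Build _ _ _ leb_itv leb_itv_0 leb_itv_ge0 leb_itv_sigma_additive.

Let leb_itv_fin : fin_num_fun leb_itv.
Proof.
move=> A mA; rewrite /leb_itv ge0_fin_numE//.
apply: (@le_lt_trans _ _ (lebesgue_measure (`[a, b]%classic : set R))).
  by apply: le_measure; rewrite ?inE//=; exact: measurableI.
by rewrite lebesgue_measure_itv/=; case: ifP => // _; rewrite -EFinB ltry.
Qed.

HB.instance Definition _ := Measure_isFinite.Build _ _ _ leb_itv leb_itv_fin.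

Lemma Rintegral_leb_itv (A : set R) (f : R -> R) : bmeas _ _ f ->
  measurable A -> A `<=` `[a, b] ->
  \int[leb_itv]_(x in A) f x = \int[lebesgue_measure]_(x in A) f x.
Proof.
move=> bf mA Aab; rewrite /Rintegral; congr fine.
have mid : measurable_fun [set: measurableTypeR R] (idfun : measurableTypeR R -> R).
  by move=> _ B mB; rewrite setTI.
have mf : measurable_fun setT (EFin \o f) by apply/measurable_EFinP; case: bf.
have ih : (mrestr lebesgue_measure (measurable_itv `[a, b])).-integrable (idfun @^-1` A) ((EFin \o f) \o idfun).
  have -> : idfun @^-1` A = A by rewrite preimage_id.
  have [_ [N fN]] := bf; apply: measurable_bounded_integrable => //.
  - rewrite /= /mrestr; apply: (@le_lt_trans _ _ (lebesgue_measure (`[a, b]%classic : set R))).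
      by apply: le_measure; rewrite ?inE//=; exact: measurableI.
    by rewrite lebesgue_measure_itv/=; case: ifP => // _; rewrite -EFinB ltry.
  - by apply: measurable_funTS; case: bf => mff _; apply: measurableT_comp mff mid.
  - by exists N; split => [|y Ny z _ /=]; [exact: num_real|rewrite (le_trans (fN z))// ltW].
have h := @integral_pushforward _ _ (measurableTypeR R) R R idfun mid
  (mrestr lebesgue_measure (measurable_itv `[a, b])) A (EFin \o f) mf ih mA.
transitivity (\int[mrestr lebesgue_measure (measurable_itv `[a, b])]_(x in idfun @^-1` A) ((EFin \o f) \o idfun) x)%E.
  rewrite -h; apply: eq_measure_integral => B mB BA; by [].
rewrite preimage_id; apply: eq_measure_integral => B mB BA.
by rewrite /= /mrestr setIidl//; apply: subset_trans Aab.
Qed.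

Lemma bmeas_integrable_itv (A : set R) (f : R -> R) : bmeas _ _ f ->
  measurable A -> A `<=` `[a, b] -> lebesgue_measure.-integrable A (EFin \o f).
Proof.
move=> [mf [N fN]] mA Aab; apply: measurable_bounded_integrable => //.
- apply: (@le_lt_trans _ _ (lebesgue_measure (`[a, b]%classic : set R))).
    by apply: le_measure; rewrite ?inE.
  by rewrite lebesgue_measure_itv/=; case: ifP => // _; rewrite -EFinB ltry.
- apply: measurable_funTS.
  have mid : measurable_fun [set: measurableTypeR R] (idfun : measurableTypeR R -> R).
    by move=> _ B mB; rewrite setTI.
  exact: measurableT_comp mf mid.
- by exists N; split => [|y Ny z _ /=]; [exact: num_real|rewrite (le_trans (fN z))// ltW].
Qed.

End LebI.

Section PowerPrimitive.
Context {R : realType}.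
Implicit Types (a x v rho : R) (F f : R -> R).

Lemma FTC_is_derive F f a x : a <= x ->
  (forall s, a <= s <= x -> is_derive s 1 F (f s)) ->
  (forall s, a <= s <= x -> {for s, continuous f}) ->
  \int[lebesgue_measure]_(s in `[a, x]) f s = F x - F a.
Proof.
rewrite le_eqVlt => /predU1P[<-|ax] dF cf.
  by rewrite set_itv1 Rintegral_set1 subrr.
have cF s : a <= s <= x -> {for s, continuous F}.
  move=> /dF[d _]; exact: (differentiable_continuous ((derivable1_diffP _ _).1 d)).
rewrite /Rintegral (@continuous_FTC2 _ f F a x ax)//.
- by apply: continuous_in_subspaceT => s; rewrite inE/= in_itv/= => /cf.
- split.
  + by move=> s; rewrite in_itv/= => /andP[h1 h2]; have [] := dF s (introT andP (conj (ltW h1) (ltW h2))).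
  + by apply: cvg_at_right_filter; apply: cF; rewrite lexx ltW.
  + by apply: cvg_at_left_filter; apply: cF; rewrite lexx ltW.
- move=> s; rewrite in_itv/= => /andP[h1 h2]; rewrite derive1E.
  by have [_ ] := dF s (introT andP (conj (ltW h1) (ltW h2))).
Qed.

Lemma is_derive_powR_lin rho (e : R) v s : 0 < e * s + v ->
  is_derive s 1 (fun s => (e * s + v) `^ rho) (e * (rho * (e * s + v) `^ (rho - 1))).
Proof.
move=> h; have d1 : is_derive s 1 (fun s => e * s + v) e.
  have : is_derive s (1:R) ((e \*: (@id R)) + cst v) (e *: (1:R) + 0) by exact: is_deriveD.
  by rewrite addr0 /GRing.scale /= mulr1.
have := @is_derive1_comp R (@powR R ^~ rho) (fun s => e * s + v) s _ _ (is_derive_powR rho _ h) d1.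
by rewrite mulrC.
Qed.

Lemma is_derive_continuous F (df s : R) : is_derive s 1 F df -> {for s, continuous F}.
Proof. by move=> [d _]; exact: (differentiable_continuous ((derivable1_diffP _ _).1 d)). Qed.

Lemma powR_lin_FTC rho (e : R) v a x : a <= x -> (forall s, a <= s <= x -> 0 < e * s + v) ->
  \int[lebesgue_measure]_(s in `[a, x]) (e * (rho * (e * s + v) `^ (rho - 1))) =
  (e * x + v) `^ rho - (e * a + v) `^ rho.
Proof.
move=> ax h.
apply: (FTC_is_derive (fun s => (e * s + v) `^ rho) (fun s => e * (rho * (e * s + v) `^ (rho - 1))) a x ax).
  by move=> s /h; exact: is_derive_powR_lin.
move=> s /h hs; apply: cvgM; first exact: cvg_cst.
apply: cvgM; first exact: cvg_cst.
exact: is_derive_continuous (is_derive_powR_lin (rho - 1) e v s hs).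
Qed.

End PowerPrimitive.

Section MoreBounded.
Context {R : realType}.

Lemma bmeas_powR d (T : measurableType d) (f : T -> R) N r : measurable_fun setT f ->
  (forall x, 0 <= f x <= N) -> 0 <= r -> bmeas _ _ (fun x => f x `^ r).
Proof.
move=> mf fN r0; apply: (bmeas_bounded _ _ _ 0 (N `^ r)).
  exact: (measurableT_comp (measurable_powR r)).
move=> x; have /andP[h1 h2] := fN x; rewrite powR_ge0/=.
by apply: ge0_ler_powR => //; rewrite nnegrE//; exact: le_trans h2.
Qed.

Lemma bmeas_inv d (T : measurableType d) (f : T -> R) lo : 0 < lo -> measurable_fun setT f ->
  (forall x, lo <= f x) -> bmeas _ _ (fun x => (f x)^-1).
Proof.
move=> lo0 mf flo; have f0 x : 0 < f x by exact: lt_le_trans (flo x).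
apply: (bmeas_bounded _ _ _ 0 lo^-1).
  have -> : (fun x => (f x)^-1) = (fun x => f x `^ (-1)).
    by apply/funext => x; rewrite powR_inv1// ltW.
  exact: (measurableT_comp (measurable_powR _)).
by move=> x; rewrite invr_ge0 ltW//= lef_pV2 ?posrE.
Qed.

Lemma bmeas_if d (T : measurableType d) (b : T -> bool) (f g : T -> R) :
  measurable_fun setT b -> bmeas _ _ f -> bmeas _ _ g ->
  bmeas _ _ (fun x => if b x then f x else g x).
Proof.
move=> mb [mf [M fM]] [mg [N gN]]; split; first exact: measurable_fun_ifT.
by exists (Num.max M N) => x; case: ifP => _; rewrite le_max ?fM ?gN ?orbT.
Qed.

Lemma bmeas_max0 d (T : measurableType d) (f : T -> R) : bmeas _ _ f ->
  bmeas _ _ (fun x => Num.max 0 (f x)).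
Proof.
move=> [mf [M fM]]; split; first exact: measurable_maxr.
exists M => x; rewrite ger0_norm ?le_max ?lexx// ge_max (le_trans (ler_norm _) (fM x)) andbT.
by rewrite (le_trans _ (fM x)).
Qed.

Lemma bmeas_partial d d' (T : measurableType d) (U : measurableType d')
  (m : {finite_measure set U -> \bar R}) (k : T * U -> R) : bmeas _ _ k ->
  bmeas _ _ (fun t => \int[m]_u k (t, u)).
Proof.
move=> bk; have [mk [N kN]] := bk.
have bku t : bmeas _ _ (fun u => k (t, u)).
  by apply: (bmeas_comp _ _ _ _ _ (fun u => (t, u)) bk); exact: measurable_pair1.
have kN0 q : 0 <= k q + N by have := kN q; rewrite ler_norml => /andP[]; lra.
have bc : bmeas _ U (cst N) by exact: bmeas_cst.
have E t : \int[m]_u k (t, u) = fine (\int[m]_u (k (t, u) + N)%:E)%E - N * fine (m setT).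
  rewrite -[fine (\int[m]_u _)%E]/(\int[m]_u (k (t, u) + N)) bRintD// Rintegral_cst//; ring.
have [M hM] : exists M, forall t, `|\int[m]_u k (t, u)| <= M.
  exists (N * fine (m setT)) => t; rewrite (le_trans (le_normr_Rintegral _ _))//.
    exact: bmeas_integrable.
  rewrite -Rintegral_cst//; apply: bRint_le => //.
  by split; [apply: measurableT_comp => //; case: (bku t)|exists N => u; rewrite normr_id].
split; last by exists M.
under eq_fun do rewrite E.
apply: measurable_funB => //; apply: measurableT_comp => //.
apply: (@measurable_fun_fubini_tonelli_F _ _ T U R m (fun q => (k q + N)%:E)) => //.
by apply/measurable_EFinP; apply: measurable_funD.
Qed.

End MoreBounded.

(** * The cost slope and its chords *)

Section ChordSign.
Context {R : realType}.

(** The derivative of [|s - v|^rho] in [s], for [s] between the two sides. *)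
Definition cost_slope (rho yu s v : R) :=
  if v <= yu then rho * (s - v) `^ (rho - 1) else - (rho * (v - s) `^ (rho - 1)).

(** Each case is an instance of [bracket_gt0]: directly when [v] is low, and after
    the reflection [u |-> - u] when [v] is high. *)
Lemma chord_sign (rho ts yl yu xl xu zl zu s y z v : R) : 1 < rho -> rho != 2 ->
  (forall t, 0 <= t <= ts -> Num.sg (rho - 2) * hfun (rho - 1) t <= 0) -> 0 < ts ->
  yu < xl -> xu < zl -> zu - xl <= ts * (xl - yu) -> xu - yl <= ts * (zl - xu) ->
  xl <= s <= xu -> yl <= y <= yu -> zl <= z <= zu ->
  (yl <= v <= yu) \/ (zl <= v <= zu) ->
  let t := if v <= yu then y else z in
  let E := cost_slope rho yu s v - cost_slope rho yu s y -
           (v - y) * ((cost_slope rho yu s z - cost_slope rho yu s y) / (z - y)) in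
  [/\ v < t -> 0 < Num.sg (rho - 2) * E, t < v -> Num.sg (rho - 2) * E < 0 & v = t -> E = 0].
Proof.
move=> rho1 rho2 hts ts0 yx xz c1 c2 /andP[s1 s2] /andP[y1 y2] /andP[z1 z2] vLU t E.
have p0 : 0 < rho - 1 by lra.
have p1 : rho - 1 != 1 by rewrite subr_eq -[1 + 1]/(2 : R).
have e2 : rho - 1 - 1 = rho - 2 by ring.
have yz : 0 < z - y by lra.
have b1 u u' w : yl <= u -> u < u' -> u' <= yu -> zl <= w <= zu ->
   0 < Num.sg (rho - 2) * ((w - u') * (s - u) `^ (rho - 1) - (u' - u) * (w - s) `^ (rho - 1)
                        - (w - u) * (s - u') `^ (rho - 1)).
  move=> h1 h2 h3 /andP[h4 h5]; rewrite -e2.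
  apply: (bracket_gt0 (rho - 1) ts) => //; [by rewrite e2|lra|lra|].
  have : 0 <= ts * ((s - u') - (xl - yu)) by rewrite mulr_ge0//; lra.
  lra.
have b2 u u' w : zl <= u -> u < u' -> u' <= zu -> yl <= w <= yu ->
   0 < Num.sg (rho - 2) * ((u - w) * (u' - s) `^ (rho - 1) - (u' - u) * (s - w) `^ (rho - 1)
                        - (u' - w) * (u - s) `^ (rho - 1)).
  move=> h1 h2 h3 /andP[h4 h5].
  have k : - s - (- u) = u - s by ring.
  have k' : - s - (- u') = u' - s by ring.
  have k3 : - w - (- u) = u - w by ring.
  have k4 : - w - (- s) = s - w by ring.
  have k5 : - w - (- u') = u' - w by ring.
  have k6 : - u - (- u') = u' - u by ring.
  have := bracket_gt0 (rho - 1) ts (- u') (- u) (- s) (- w) p0 p1.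
  rewrite e2 k k' k3 k4 k5 k6; apply => //; [lra|lra|lra|].
  have : 0 <= ts * ((u - s) - (zl - xu)) by rewrite mulr_ge0//; lra.
  lra.
have zyu : (z <= yu) = false by apply/negbTE; rewrite -ltNge; lra.
rewrite /E /t /cost_slope y2 zyu {E t}.
set A := (s - y) `^ _; set C := (z - s) `^ _.
case: vLU => /andP[v1 v2].
  rewrite v2; set B := (s - v) `^ _; split => [vy|yv|e]; last by rewrite /B e -/A; ring.
    have := b1 v y z v1 vy y2 (introT andP (conj z1 z2)); rewrite -/A -/B -/C.
    set e := Num.sg _ => h.
    have -> : e * (rho * B - rho * A - (v - y) * ((- (rho * C) - rho * A) / (z - y))) =
      rho * (z - y)^-1 * (e * ((z - y) * B - (y - v) * C - (z - v) * A)).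
      by field; rewrite gt_eqF.
    by rewrite mulr_gt0// mulr_gt0 ?invr_gt0//; lra.
  have := b1 y v z y1 yv v2 (introT andP (conj z1 z2)); rewrite -/A -/B -/C.
  set e := Num.sg _ => h; rewrite -oppr_gt0.
  have -> : - (e * (rho * B - rho * A - (v - y) * ((- (rho * C) - rho * A) / (z - y)))) =
    rho * (z - y)^-1 * (e * ((z - v) * A - (v - y) * C - (z - y) * B)).
    by field; rewrite gt_eqF.
  by rewrite mulr_gt0// mulr_gt0 ?invr_gt0//; lra.
have vyu : (v <= yu) = false by apply/negbTE; rewrite -ltNge; lra.
rewrite vyu; set B := (v - s) `^ _; split => [vz|zv|e]; last by rewrite /B e -/C; field; rewrite gt_eqF.
  have := b2 v z y v1 vz z2 (introT andP (conj y1 y2)); rewrite -/A -/B -/C.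
  set e := Num.sg _ => h.
  have -> : e * (- (rho * B) - rho * A - (v - y) * ((- (rho * C) - rho * A) / (z - y))) =
    rho * (z - y)^-1 * (e * ((v - y) * C - (z - v) * A - (z - y) * B)).
    by field; rewrite gt_eqF.
  by rewrite mulr_gt0// mulr_gt0 ?invr_gt0//; lra.
have := b2 z v y z1 zv v2 (introT andP (conj y1 y2)); rewrite -/A -/B -/C.
set e := Num.sg _ => h; rewrite -oppr_gt0.
have -> : - (e * (- (rho * B) - rho * A - (v - y) * ((- (rho * C) - rho * A) / (z - y)))) =
  rho * (z - y)^-1 * (e * ((z - y) * B - (v - z) * A - (v - y) * C)).
  by field; rewrite gt_eqF.
by rewrite mulr_gt0// mulr_gt0 ?invr_gt0//; lra.
Qed.

End ChordSign.

(** * Dual potentials and the gap *)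

Section Dual.
Context {R : realType}.
Variables (rho ts tau yl yu xl xu zl zu : R) (T1 T2 : R -> R).
Hypotheses (rho1 : 1 < rho) (rho2 : rho != 2).
Hypothesis hts : forall t, 0 <= t <= ts -> Num.sg (rho - 2) * hfun (rho - 1) t <= 0.
Hypothesis ts0 : 0 < ts.
Hypotheses (yly : yl <= yu) (yx : yu < xl) (xlu : xl <= xu) (xz : xu < zl) (zlz : zl <= zu).
Hypotheses (c1 : zu - xl <= ts * (xl - yu)) (c2 : xu - yl <= ts * (zl - xu)).
Hypothesis tau1 : tau = 1 \/ tau = -1.
Hypotheses (mT1 : measurable_fun setT T1) (mT2 : measurable_fun setT T2).
Hypotheses (T1i : forall s, yl <= T1 s <= yu) (T2i : forall s, zl <= T2 s <= zu).

Local Notation cl := (clamp yl zu).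
Local Notation xs := (clamp xl xu).
Local Notation lam := (leb_itv xl xu).
Let sgn := tau * Num.sg (rho - 2).

Let hyps : [/\ yl <= yu, yu < xl, xl <= xu, xu < zl & zl <= zu].
Proof. by split. Qed.

(** Keeps targets away from the sources, so that the slope is bounded everywhere. *)
Definition side_clamp v := if v <= yu then clamp yl yu v else clamp zl zu v.
Local Notation cv := side_clamp.

Let cv_le v : (cv v <= yu) = (v <= yu).
Proof.
case: hyps => *; rewrite /side_clamp; case: ifP => h; first by have /andP[] := clamp_itv _ _ yly v.
by apply/negbTE; rewrite -ltNge; have /andP[? _] := clamp_itv _ _ zlz v; lra.
Qed.

Let cv_id v : (yl <= v <= yu) \/ (zl <= v <= zu) -> cv v = v.
Proof.
move=> hv; case: hyps => *; rewrite /side_clamp; case: hv => h; first by rewrite (_ : v <= yu) ?clamp_id//; case/andP: h.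
have -> : (v <= yu) = false by apply/negbTE; rewrite -ltNge; case/andP: h => *; lra.
by rewrite clamp_id.
Qed.

Let cv_itv v : (yl <= cv v <= yu) \/ (zl <= cv v <= zu).
Proof. by rewrite /side_clamp; case: ifP => _; [left|right]; exact: clamp_itv. Qed.

Definition bslope (s v : R) := cost_slope rho yu (xs s) (cv v).
Definition bcost (x v : R) := `|xs x - cv v| `^ rho.

Let m1 : measurable_fun setT (fun q : R * R => q.1). Proof. exact: measurable_fst. Qed.
Let m2 : measurable_fun setT (fun q : R * R => q.2). Proof. exact: measurable_snd. Qed.

Let mcv : measurable_fun setT cv.
Proof.
by apply: measurable_fun_ifT; [exact: measurable_fun_ler|exact: measurable_clamp|exact: measurable_clamp].
Qed.

Let mxs : measurable_fun setT xs. Proof. exact: measurable_clamp. Qed.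

Let bbslope : bmeas _ (R * R)%type (fun q => bslope q.1 q.2).
Proof.
move: rho1 => r1; case: hyps => h1 h2 h3 h4 h5.
have -> : (fun q : R * R => bslope q.1 q.2) = (fun q => if q.2 <= yu
   then rho * (xs q.1 - clamp yl yu q.2) `^ (rho - 1)
   else - (rho * (clamp zl zu q.2 - xs q.1) `^ (rho - 1))).
  apply/funext => q; rewrite /bslope /cost_slope cv_le /side_clamp.
  by case: ifP => ->.
apply: bmeas_if; first exact: measurable_fun_ler.
- apply: bmeasM; first exact: bmeas_cst.
  apply: (bmeas_powR _ _ _ (xu - yl)); last lra.
    by apply: measurable_funB; apply: measurableT_comp => //; exact: measurable_clamp.
  move=> q; have /andP[? ?] := clamp_itv _ _ yly q.2; have /andP[? ?] := clamp_itv _ _ xlu q.1.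
  by apply/andP; split; lra.
- apply: bmeasN; apply: bmeasM; first exact: bmeas_cst.
  apply: (bmeas_powR _ _ _ (zu - xl)); last lra.
    by apply: measurable_funB; apply: measurableT_comp => //; exact: measurable_clamp.
  move=> q; have /andP[? ?] := clamp_itv _ _ zlz q.2; have /andP[? ?] := clamp_itv _ _ xlu q.1.
  by apply/andP; split; lra.
Qed.

Lemma bmeas_bcost : bmeas _ (R * R)%type (fun p => bcost p.1 p.2).
Proof.
move: rho1 => r1; case: hyps => h1 h2 h3 h4 h5.
apply: (bmeas_powR _ _ _ (zu - yl)); last lra.
  apply: measurableT_comp => //; apply: measurable_funB.
    exact: (measurableT_comp mxs).
  exact: (measurableT_comp mcv).
move=> q; rewrite normr_ge0/= ler_norml; have /andP[? ?] := clamp_itv _ _ xlu q.1.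
by case: (cv_itv q.2) => /andP[? ?]; apply/andP; split; lra.
Qed.

(** The chord through [T1 s] and [T2 s] of the signed slope, as a function of the
    target: being affine in the target, it contributes the same to all martingale
    couplings. *)
Definition chord (s : R) := sgn * ((bslope s (T2 s) - bslope s (T1 s)) / (T2 s - T1 s)).
Definition level (s : R) := sgn * bslope s (T1 s) - chord s * T1 s.
Definition dgap (s v : R) := sgn * bslope s v - (level s + chord s * cl v).

Let bcomp (T : R -> R) : measurable_fun setT T -> bmeas _ R (fun s => bslope s (T s)).
Proof.
move=> mT; apply: (bmeas_comp _ _ _ _ _ (fun s => (s, T s)) bbslope).
exact: measurable_fun_pair.
Qed.

Let bT1 : bmeas _ R T1. Proof. exact: bmeas_bounded mT1 T1i. Qed.

Lemma bmeas_chord : bmeas _ R chord.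
Proof.
case: hyps => h1 h2 h3 h4 h5.
apply: bmeasM; first exact: bmeas_cst.
apply: bmeasM; first by apply: bmeasB; exact: bcomp.
apply: (bmeas_inv _ _ _ (zl - yu)); first lra.
  exact: measurable_funB.
by move=> s; have /andP[? ?] := T1i s; have /andP[? ?] := T2i s; lra.
Qed.

Lemma bmeas_level : bmeas _ R level.
Proof.
apply: bmeasB; last by apply: bmeasM => //; exact: bmeas_chord.
by apply: bmeasM; [exact: bmeas_cst|exact: bcomp].
Qed.

Let clz : yl <= zu. Proof. by case: hyps => *; lra. Qed.

Let bcl : bmeas _ R cl. Proof. exact: bmeas_clamp. Qed.

Lemma bmeas_dgap : bmeas _ (R * R)%type (fun q => dgap q.1 q.2).
Proof.
apply: bmeasB; first by apply: bmeasM => //; exact: bmeas_cst.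
apply: bmeasD; first by apply: bmeas_fst; exact: bmeas_level.
by apply: bmeasM; [apply: bmeas_fst; exact: bmeas_chord|exact: bmeas_snd].
Qed.

Lemma dgap_sign s v : xl <= s <= xu -> (yl <= v <= yu) \/ (zl <= v <= zu) ->
  [/\ tau * v < tau * side_map yu T1 T2 s v -> 0 < dgap s v,
      tau * side_map yu T1 T2 s v < tau * v -> dgap s v < 0 &
      side_map yu T1 T2 s v = v -> dgap s v = 0].
Proof.
move=> hs hv; have := chord_sign rho ts yl yu xl xu zl zu s (T1 s) (T2 s) v rho1 rho2 hts ts0 yx xz c1 c2
  hs (T1i s) (T2i s) hv; rewrite -/(side_map yu T1 T2 s v) /=.
set E := cost_slope _ _ _ _ - _ - _.
have -> : dgap s v = tau * (Num.sg (rho - 2) * E).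
  have vcl : cl v = v.
    by case: hyps => *; apply: clamp_id; case: hv => /andP[? ?]; apply/andP; split; lra.
  rewrite /dgap /level /chord /bslope vcl cv_id// (clamp_id _ _ _ hs).
  rewrite !cv_id; [|by right|by left].
  rewrite /E /sgn; ring.
move=> [e1 e2 e3]; split; last by move=> /esym/e3 ->; rewrite !mulr0.
  by case: tau1 => ->; rewrite ?mul1r// !mulN1r ltrN2 oppr_gt0; exact: e2.
by case: tau1 => ->; rewrite ?mul1r// !mulN1r ltrN2 oppr_lt0; exact: e1.
Qed.

Lemma dgap_le0 s v : xl <= s <= xu -> (yl <= v <= yu) \/ (zl <= v <= zu) ->
  (dgap s v <= 0) = (tau * side_map yu T1 T2 s v <= tau * v).
Proof.
move=> hs hv; have [e1 e2 e3] := dgap_sign s v hs hv.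
have tau0 : tau != 0 by case: tau1 => ->; rewrite ?oppr_eq0 oner_neq0.
case: (ltgtP (tau * side_map yu T1 T2 s v) (tau * v)) => h.
- by rewrite ltW// e2.
- by apply/negbTE; rewrite -ltNge e1.
- by rewrite e3 ?lexx//; exact: mulfI tau0 _ _ h.
Qed.

Lemma dgap_ge0 s v : xl <= s <= xu -> (yl <= v <= yu) \/ (zl <= v <= zu) ->
  (0 <= dgap s v) = (tau * v <= tau * side_map yu T1 T2 s v).
Proof.
move=> hs hv; have [e1 e2 e3] := dgap_sign s v hs hv.
have tau0 : tau != 0 by case: tau1 => ->; rewrite ?oppr_eq0 oner_neq0.
case: (ltgtP (tau * v) (tau * side_map yu T1 T2 s v)) => h.
- by rewrite ltW// e1.
- by apply/negbTE; rewrite -ltNge e2.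
- by rewrite e3 ?lexx//; apply/esym; exact: mulfI tau0 _ _ h.
Qed.

Let lam_ae : {ae lam, forall s, xl <= s <= xu}.
Proof.
exists (~` `[xl, xu]); split; first exact: measurableC.
  by rewrite /leb_itv setICl measure0.
by move=> s /= h; rewrite in_itv/=.
Qed.

Let lam_neq (x : R) : {ae lam, forall s, s != x}.
Proof.
exists [set x]; split => //; last by move=> s /= /negP; rewrite negbK => /eqP.
apply/eqP; rewrite -measure_le0.
apply: (@le_trans _ _ (lebesgue_measure [set x])); last by rewrite lebesgue_measure_set1.
by apply: le_measure; rewrite ?inE//=; exact: measurableI.
Qed.

Let blt : measurable_fun setT (fun q : R * R => q.2 < q.1).
Proof. exact: measurable_fun_ltr. Qed.

Let bcut (f : R * R -> R) : bmeas _ _ f -> bmeas _ (R * R)%type (fun q => if q.2 < q.1 then f q else 0).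
Proof. by move=> bf; apply: bmeas_if => //; exact: bmeas_cst. Qed.

Let bcut1 (f : R -> R) x : bmeas _ _ f -> bmeas _ R (fun s => if s < x then f s else 0).
Proof. by move=> bf; apply: bmeas_if; [exact: measurable_fun_ltr|by []|exact: bmeas_cst]. Qed.

Lemma bcost_FTC x v : xl <= x <= xu -> (yl <= v <= yu) \/ (zl <= v <= zu) ->
  \int[lam]_s (if s < x then bslope s v else 0) = bcost x v - bcost xl v.
Proof.
move=> /andP[lx xu'] hv; case: hyps => h1 h2 h3 h4 h5.
have bs : bmeas _ R (fun s => bslope s v).
  by apply: (bmeas_comp _ _ _ _ _ (fun s => (s, v)) bbslope); exact: measurable_pair2.
have mi : measurable (`[xl, x[%classic : set R) by [].
have sub : `[xl, x[ `<=` `[xl, xu].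
  by move=> s /=; rewrite !in_itv/= => /andP[-> sx]; rewrite ltW// (lt_le_trans sx).
transitivity (\int[lam]_s (\1_(`[xl, x[%classic) s * bslope s v)).
  apply: bRint_ae; [exact: bcut1|by apply: bmeasM => //; exact: bmeas_indic|].
  apply: filterS lam_ae => s /andP[xls _].
  rewrite (indic_boolE _ _ (s < x)); last by rewrite /= in_itv/= xls.
  by case: ifP => _; rewrite ?mul1r ?mul0r.
rewrite (bRint_indic _ _ lam)// (Rintegral_leb_itv _ _ _ _ bs mi sub).
rewrite Rintegral_itv_bndo_bndc; last first.
  exact: bmeas_integrable_itv bs mi sub.
have cE u : bcost u v = `|xs u - v| `^ rho by rewrite /bcost cv_id.
rewrite !cE !clamp_id ?lexx ?lx//.
case: hv => /andP[v1 v2].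
  rewrite !ger0_norm; [|lra|lra].
  transitivity (\int[lebesgue_measure]_(s in `[xl, x]) (1 * (rho * (1 * s + (- v)) `^ (rho - 1)))).
    apply: eq_Rintegral => s; rewrite inE/= in_itv/= => /andP[s1 s2].
    rewrite /bslope cv_id ?v1 ?v2//; last by left.
    by rewrite /cost_slope v2 !mul1r clamp_id// s1 (le_trans s2).
  rewrite powR_lin_FTC//; first by rewrite !mul1r.
  by move=> s /andP[s1 s2]; lra.
rewrite !ler0_norm; [|lra|lra].
transitivity (\int[lebesgue_measure]_(s in `[xl, x]) ((-1) * (rho * ((-1) * s + v) `^ (rho - 1)))).
  apply: eq_Rintegral => s; rewrite inE/= in_itv/= => /andP[s1 s2].
  rewrite /bslope cv_id ?v1 ?v2//; last by right.
  have vy : (v <= yu) = false by apply/negbTE; rewrite -ltNge; lra.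
  rewrite /cost_slope vy !mulN1r clamp_id ?s1 ?(le_trans s2)//.
  by rewrite [v - s]addrC.
rewrite powR_lin_FTC//; first by rewrite !mulN1r !opprB ![_ - _]addrC.
by move=> s /andP[s1 s2]; lra.
Qed.

Definition dual_const (x : R) := \int[lam]_s (if s < x then level s else 0).
Definition dual_slope (x : R) := \int[lam]_s (if s < x then chord s else 0).
(** Subtracting the negative part of [dgap] over all [s], which depends on [v] only,
    leaves a nonnegative [gap]. *)
Definition dual_target (v : R) := sgn * bcost xl v - \int[lam]_s Num.max 0 (- dgap s v).
Definition gap (p : R * R) := \int[lam]_s (if s < p.1 then Num.max 0 (dgap s p.2) else Num.max 0 (- dgap s p.2)).

Lemma bmeas_dual_const : bmeas _ R dual_const.
Proof.
apply: (bmeas_partial _ _ _ _ lam (fun q : R * R => if q.2 < q.1 then level q.2 else 0)).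
by apply: bcut; apply: bmeas_snd; exact: bmeas_level.
Qed.

Lemma bmeas_dual_slope : bmeas _ R dual_slope.
Proof.
apply: (bmeas_partial _ _ _ _ lam (fun q : R * R => if q.2 < q.1 then chord q.2 else 0)).
by apply: bcut; apply: bmeas_snd; exact: bmeas_chord.
Qed.

Let mswap : measurable_fun setT (fun q : R * R => (q.2, q.1)).
Proof. exact: measurable_fun_pair. Qed.

Lemma bmeas_dual_target : bmeas _ R dual_target.
Proof.
apply: bmeasB.
  apply: bmeasM; first exact: bmeas_cst.
  by apply: (bmeas_comp _ _ _ _ _ (fun v => (xl, v)) bmeas_bcost); exact: measurable_pair1.
apply: (bmeas_partial _ _ _ _ lam (fun q : R * R => Num.max 0 (- dgap q.2 q.1))).
apply: bmeas_max0; apply: bmeasN.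
exact: (bmeas_comp _ _ _ _ _ (fun q => (q.2, q.1)) bmeas_dgap).
Qed.

Let bdg v : bmeas _ R (fun s => dgap s v).
Proof.
by apply: (bmeas_comp _ _ _ _ _ (fun s => (s, v)) bmeas_dgap); exact: measurable_pair2.
Qed.

Lemma bmeas_gap : bmeas _ (R * R)%type gap.
Proof.
apply: (bmeas_partial _ _ _ _ lam (fun q : (R * R) * R =>
  if q.2 < q.1.1 then Num.max 0 (dgap q.2 q.1.2) else Num.max 0 (- dgap q.2 q.1.2))).
have ma : measurable_fun setT (fun q : (R * R) * R => (q.2, q.1.2)).
  apply: measurable_fun_pair; first exact: measurable_snd.
  by apply: (measurableT_comp m2); exact: measurable_fst.
have bd : bmeas _ _ (fun q : (R * R) * R => dgap q.2 q.1.2).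
  exact: (bmeas_comp _ _ _ _ _ _ bmeas_dgap ma).
apply: bmeas_if; last 2 first.
- exact: bmeas_max0.
- by apply: bmeas_max0; exact: bmeasN.
apply: measurable_fun_ltr; first exact: measurable_snd.
by apply: (measurableT_comp m1); exact: measurable_fst.
Qed.

Lemma gap_ge0 p : 0 <= gap p.
Proof. by apply: Rintegral_ge0 => s _; case: ifP => _; rewrite le_max lexx. Qed.

Let bgi (p : R * R) : bmeas _ R (fun s => if s < p.1 then Num.max 0 (dgap s p.2) else Num.max 0 (- dgap s p.2)).
Proof.
apply: bmeas_if; first exact: measurable_fun_ltr.
  exact: bmeas_max0.
by apply: bmeas_max0; exact: bmeasN.
Qed.

(** The fundamental theorem of calculus in the source, with the slope written as
    its chord plus [dgap]. *)
Lemma duality x v : xl <= x <= xu -> (yl <= v <= yu) \/ (zl <= v <= zu) ->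
  sgn * bcost x v = dual_const x + dual_slope x * cl v + dual_target v + gap (x, v).
Proof.
move=> hx hv; have ftc := bcost_FTC x v hx hv.
have bs : bmeas _ R (fun s => bslope s v).
  by apply: (bmeas_comp _ _ _ _ _ (fun s => (s, v)) bbslope); exact: measurable_pair2.
have bneg : bmeas _ R (fun s => Num.max 0 (- dgap s v)) by apply: bmeas_max0; exact: bmeasN.
have bL : bmeas _ R (fun s => if s < x then level s else 0) by apply: bcut1; exact: bmeas_level.
have bC : bmeas _ R (fun s => if s < x then chord s else 0) by apply: bcut1; exact: bmeas_chord.
have bS : bmeas _ R (fun s => if s < x then bslope s v else 0) by apply: bcut1.
have bCv : bmeas _ R (fun s => cl v * (if s < x then chord s else 0)) by apply: bmeasM => //; exact: bmeas_cst.
have bLC := bmeasD _ _ _ _ bL bCv.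
have bg := bgi (x, v).
have bgn := bmeasB _ _ _ _ bg bneg.
have e : sgn * \int[lam]_s (if s < x then bslope s v else 0) =
   (dual_const x + cl v * dual_slope x) + (gap (x, v) - \int[lam]_s Num.max 0 (- dgap s v)).
  rewrite /dual_const /dual_slope /gap.
  rewrite -(bRintZ _ _ lam sgn _ bS) -(bRintZ _ _ lam (cl v) _ bC).
  rewrite -(bRintD _ _ lam _ _ bL bCv) -(bRintB _ _ lam _ _ bg bneg) -(bRintD _ _ lam _ _ bLC bgn).
  apply: eq_Rintegral => s _ /=; case: ifP => _; last by rewrite !mulr0 subrr !addr0.
  have -> : Num.max 0 (dgap s v) - Num.max 0 (- dgap s v) = dgap s v.
    have [h|h] := leP 0 (dgap s v).
      by rewrite (max_idPl _) ?subr0// oppr_le0.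
    by rewrite (max_idPr _) ?oppr_ge0 1?ltW// add0r opprK.
  rewrite /dgap; ring.
rewrite ftc mulrBr in e.
rewrite /dual_target -[LHS](subrK (sgn * bcost xl v)) e; ring.
Qed.

Local Notation Tm := (side_map yu T1 T2).
Definition support_box : set (R * R) := `[xl, xu]%classic `*` (`[yl, yu]%classic `|` `[zl, zu]%classic).
Local Notation box := support_box.
Definition contact_set : set (R * R) := [set p | gap p = 0] `&` box.

Let mbox : measurable box.
Proof. by apply: measurableX => //; exact: measurableU. Qed.

Lemma measurable_contact_set : measurable contact_set.
Proof.
apply: measurableI => //; rewrite (_ : [set p | _] = gap @^-1` [set 0]) //.
by rewrite -[X in measurable X]setTI; case: bmeas_gap => mg _; exact: mg.
Qed.

Let boxE p : box p -> xl <= p.1 <= xu /\ ((yl <= p.2 <= yu) \/ (zl <= p.2 <= zu)).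
Proof. by move=> [/=]; rewrite !in_itv. Qed.

Lemma contact_ae x v : contact_set (x, v) ->
  {ae lam, forall s, (s < x -> tau * Tm s v <= tau * v) /\ (x <= s -> tau * v <= tau * Tm s v)}.
Proof.
move=> [/= g0 /boxE[/= hx hv]].
have g_ge0 s : 0 <= (if s < x then Num.max 0 (dgap s v) else Num.max 0 (- dgap s v)).
  by case: ifP => _; rewrite le_max lexx.
have g_eq0 := bRint_eq0 _ _ lam _ (bgi (x, v)) g_ge0 g0.
apply: filterS2 lam_ae g_eq0 => s hs /= e; split => sx; move: e.
  by rewrite -dgap_le0// sx => /max_idPl.
by rewrite -dgap_ge0// ltNge sx => /max_idPl; rewrite oppr_le0.
Qed.

Let ae_between (P : R -> Prop) x x' : xl <= x -> x < x' -> x' <= xu ->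
  {ae lam, forall s, P s} -> exists2 s, x < s < x' & P s.
Proof.
move=> hx xx' hx' [N [mN N0 PN]]; apply: contrapT => hno.
have mI : measurable (`]x, x'[%classic : set R) by exact: measurable_itv.
have sub : `]x, x'[ `<=` N.
  move=> s /=; rewrite in_itv/= => xsx'; apply: PN => Ps; apply: hno; by exists s.
have : (lam `]x, x'[%classic <= 0)%E by rewrite -N0; apply: le_measure; rewrite ?inE.
rewrite /= /leb_itv setIidl; last first.
  by move=> s /=; rewrite !in_itv/= => /andP[/ltW h /ltW h']; rewrite (le_trans hx h) (le_trans h' hx').
by rewrite lebesgue_measure_itv/= lte_fin xx' -EFinD lee_fin subr_le0 leNgt xx'.
Qed.

(** Compare both targets with the map of their side at a common source [s] strictly
    between the two sources. *)
Lemma contact_set_monotone : tau_monotone tau contact_set.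
Proof.
case: hyps => h1 h2 h3 h4 h5.
have key x v x' v' : contact_set (x, v) -> contact_set (x', v') -> x < x' ->
    (v <= yu) = (v' <= yu) -> tau * v <= tau * v'.
  move=> G G' xx' side; have [[_ /boxE[/= /andP[xl1 _] _]] [_ /boxE[/= /andP[_ xu1] _]]] := (G, G').
  have : {ae lam, forall s, x <= s -> s < x' -> tau * v <= tau * v'}.
    apply: filterS2 (contact_ae _ _ G) (contact_ae _ _ G') => s [_ k1] [k2 _] xs' sx'.
    by apply: le_trans (k1 xs') _; apply: le_trans (k2 sx'); rewrite /side_map -side.
  by move=> /(ae_between _ _ _ xl1 xx' xu1)[s /andP[xs' sx']]; apply => //; exact: ltW.
split => x v x' v' G G' a1 a2 xx'; apply: (key x v x' v') => //;
  have [_ /boxE[/= /andP[g1 g2] g3]] := G; have [_ /boxE[/= /andP[g1' g2'] g3']] := G'.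
  case: g3 => /andP[k1 k2]; last by lra.
  case: g3' => /andP[k1' k2']; last by lra.
  by rewrite k2 k2'.
case: g3 => /andP[k1 k2]; first by lra.
case: g3' => /andP[k1' k2']; first by lra.
by rewrite !leNgt (lt_le_trans _ k1) 1?(lt_le_trans _ k1')//; lra.
Qed.

Lemma mono_graph_contact p : mono_graph tau yu T1 T2 p -> box p -> contact_set p.
Proof.
case: p => x v [/= m1' m2'] bp; split => //; have [/= hx hv] := boxE _ bp.
rewrite /= /gap (bRint_ae _ _ lam _ (cst 0) (bgi (x, v)) (bmeas_cst _ _ _)).
  by rewrite /Rintegral; under eq_integral do rewrite /=; rewrite integral0.
apply: filterS2 lam_ae (lam_neq x) => s hs sx /=.
case: ltP => [lt|ge]; apply/max_idPl; first by rewrite dgap_le0//; exact: m1'.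
by rewrite oppr_le0 dgap_ge0//; apply: m2'; rewrite lt_neqAle eq_sym sx.
Qed.

Section TotalCost.
Variables (mu nu : probability R R) (pi : probability (R * R)%type R).
Hypothesis mu1 : mu `[xl, xu]%classic = 1%E.
Hypothesis nu1 : nu (`[yl, yu]%classic `|` `[zl, zu]%classic) = 1%E.
Hypothesis boxpi : pi box = 1%E.

Lemma cost_bcost : cost rho pi = (\int[pi]_p bcost p.1 p.2)%:E.
Proof.
rewrite -(bmeas_EFin _ _ pi _ bmeas_bcost) /cost; apply: ae_eq_integral => //.
- apply/measurable_EFinP; apply: (measurableT_comp (measurable_powR rho)).
  by apply: measurableT_comp => //; exact: measurable_funB.
- by apply/measurable_EFinP; case: bmeas_bcost.
- apply: filterS (prob1_ae _ _ pi _ mbox boxpi) => p /boxE[h1 h2] _ /=.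
  by rewrite /bcost clamp_id// cv_id.
Qed.

(** The martingale property makes the product term depend on [mu] only. *)
Lemma total_cost : martingale_coupling mu nu pi ->
  sgn * \int[pi]_p bcost p.1 p.2 =
    \int[mu]_x dual_const x + \int[mu]_x (dual_slope x * cl x) + \int[nu]_v dual_target v
    + \int[pi]_p gap p.
Proof.
case: hyps => h1 h2 h3 h4 h5 mart; have [cpl _] := mart.
have mux : mu `[yl, zu]%classic = 1%E.
  apply: (superset_prob1 _ _ _ _ (measurable_itv _) mu1) => s /=; rewrite !in_itv/= => /andP[s1 s2].
  by apply/andP; split; lra.
have nux : nu `[yl, zu]%classic = 1%E.
  apply: (superset_prob1 _ _ _ _ _ nu1); first exact: measurableU.
  by move=> s /=; rewrite !in_itv/= => -[|] /andP[s1 s2]; apply/andP; split; lra.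
have bC := bmeas_fst _ bmeas_dual_const; have bS := bmeas_fst _ bmeas_dual_slope.
have bT := bmeas_snd _ bmeas_dual_target; have bcl2 := bmeas_snd _ bcl.
have bSc := bmeasM _ _ _ _ bS bcl2.
have bCS := bmeasD _ _ _ _ bC bSc.
have bCST := bmeasD _ _ _ _ bCS bT.
have ball := bmeasD _ _ _ _ bCST bmeas_gap.
rewrite -(martingale_moment _ _ clz _ _ _ mux nux _ mart bmeas_dual_slope).
rewrite -(coupling_fst _ _ _ _ cpl bmeas_dual_const) -(coupling_snd _ _ _ _ cpl bmeas_dual_target).
rewrite -(bRintD _ _ pi _ _ bC bSc) -(bRintD _ _ pi _ _ bCS bT) -(bRintD _ _ pi _ _ bCST bmeas_gap).
rewrite -(bRintZ _ _ pi _ _ bmeas_bcost).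
apply: bRint_ae => //; first by apply: bmeasM; [exact: bmeas_cst|exact: bmeas_bcost].
by apply: filterS (prob1_ae _ _ pi _ mbox boxpi) => -[x v] /boxE[/= hx hv]; exact: duality.
Qed.

Lemma gap_contact : \int[pi]_p gap p = 0 <-> pi contact_set = 1%E.
Proof.
have mC := measurable_contact_set; split => [|C1].
  move=> /(bRint_eq0 _ _ pi _ bmeas_gap gap_ge0) g0.
  apply: ae_prob1 => //; apply: filterS2 g0 (prob1_ae _ _ pi _ mbox boxpi) => p g0 bp; by split.
rewrite (bRint_ae _ _ pi _ (cst 0) bmeas_gap (bmeas_cst _ _ _)).
  by rewrite /Rintegral; under eq_integral do rewrite /=; rewrite integral0.
by apply: filterS (prob1_ae _ _ pi _ mC C1) => p [].
Qed.

End TotalCost.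

End Dual.

(** * Optimality *)

Lemma convex_function_lin {R : realType} (c : R) : convex_function [set: R] (fun x : R => c * x).
Proof.
move=> t x y _ _.
change (c * (t%:inum * x + (1 - t%:inum) * y) <= t%:inum * (c * x) + (1 - t%:inum) * (c * y)).
by rewrite mulrDr !(mulrCA c).
Qed.

(** Test the convex order with the identity and with its opposite. *)
Lemma le_cx_mean {R : realType} (mu nu : probability R R) (c e : R) : c <= e ->
  le_cx mu nu ->
  mu `[c, e]%classic = 1%E -> nu `[c, e]%classic = 1%E ->
  \int[mu]_x clamp c e x = \int[nu]_x clamp c e x.
Proof.
move=> ce cx mu1 nu1.
have E (P : probability R R) (r : R) : P `[c, e]%classic = 1%E ->
    (\int[P]_x (r * x)%:E = (r * \int[P]_x clamp c e x)%:E)%E.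
  move=> P1; have bc := bmeas_clamp c e ce.
  rewrite -(bRintZ _ _ P r _ bc) -bmeas_EFin; last by apply: bmeasM => //; exact: bmeas_cst.
  apply: ae_eq_integral => //.
  - by apply/measurable_EFinP; exact: measurable_funM.
  - by apply/measurable_EFinP; apply: measurable_funM => //; exact: measurable_clamp.
  - apply: filterS (prob1_ae _ _ P _ (measurable_itv _) P1) => x /=.
    by rewrite in_itv/= => xce _; rewrite clamp_id.
have h1 := cx _ (convex_function_lin 1); have h2 := cx _ (convex_function_lin (-1)).
move: h1 h2; rewrite !E// !lee_fin !mul1r !mulN1r lerN2 => h1 h2.
by apply/eqP; rewrite eq_le h1.
Qed.

Section OptimalCoupling.
Context {R : realType}.
Variables (rho ts tau yl yu xl xu zl zu : R) (mu nu : probability R R).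
Hypotheses (rho1 : 1 < rho) (rho2 : rho != 2).
Hypothesis hts : forall t, 0 <= t <= ts -> Num.sg (rho - 2) * hfun (rho - 1) t <= 0.
Hypothesis ts0 : 0 < ts.
Hypotheses (yly : yl <= yu) (yx : yu < xl) (xlu : xl <= xu) (xz : xu < zl) (zlz : zl <= zu).
Hypotheses (c1 : zu - xl <= ts * (xl - yu)) (c2 : xu - yl <= ts * (zl - xu)).
Hypothesis tau1 : tau = 1 \/ tau = -1.
Hypothesis mu1 : mu `[xl, xu]%classic = 1%E.
Hypothesis nu1 : nu (`[yl, yu]%classic `|` `[zl, zu]%classic) = 1%E.
Hypothesis mean : \int[mu]_x clamp yl zu x = \int[nu]_x clamp yl zu x.

Definition tau_monotone_coupling (pi : probability (R * R)%type R) :=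
  martingale_coupling mu nu pi /\ exists G, [/\ measurable G, pi G = 1%E & tau_monotone tau G].

Definition signed_cost_minimizer (sgn : R) (pi0 : probability (R * R)%type R) :=
  forall pi, martingale_coupling mu nu pi -> exists k k0 : R,
   [/\ cost rho pi = k%:E, cost rho pi0 = k0%:E, sgn * k0 <= sgn * k &
       k = k0 -> forall C, measurable C -> pi C = pi0 C].

(** The signed cost of a coupling is a constant plus the integral of its gap, and
    the latter vanishes exactly on couplings concentrated on the contact set. *)
Lemma exists_optimal_coupling : exists pi0 : probability (R * R)%type R,
  the_unique tau_monotone_coupling pi0 /\
  signed_cost_minimizer (tau * Num.sg (rho - 2)) pi0.
Proof.
have [pi0 [T1 [T2 [mart0 [mT1 mT2] T12 supp uniq]]]] :=
  exists_monotone_coupling mu nu yl yu xl xu zl zu tau yly yx xlu xz zlz tau1 mu1 nu1 mean.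
have T1i s : yl <= T1 s <= yu by have [] := T12 s.
have T2i s : zl <= T2 s <= zu by have [] := T12 s.
pose K := contact_set rho tau yl yu xl xu zl zu T1 T2.
have mK : measurable K by exact: measurable_contact_set.
have Kmono : tau_monotone tau K by apply: (contact_set_monotone rho ts).
have K0 : pi0 K = 1%E by apply: supp => p m b; exact: (mono_graph_contact rho ts).
have boxpi (pi : probability (R * R)%type R) : martingale_coupling mu nu pi ->
    pi (support_box yl yu xl xu zl zu) = 1%E.
  move=> [cpl _]; apply: coupling_prod_support cpl _ _ mu1 nu1; first exact: measurable_itv.
  by apply: measurableU; exact: measurable_itv.
exists pi0; split.
  split; first by split => //; exists K.
  by move=> pi [mart [G [mG G1 Gm]]]; exact: (uniq pi G).
move=> pi mart; exists (\int[pi]_p bcost rho yl yu xl xu zl zu p.1 p.2).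
exists (\int[pi0]_p bcost rho yl yu xl xu zl zu p.1 p.2).
have [bp bp0] := (boxpi _ mart, boxpi _ mart0).
have tc := total_cost rho tau yl yu xl xu zl zu T1 T2 rho1 yly yx xlu xz zlz mT1 mT2 T1i T2i mu nu _ mu1 nu1 _ _.
have gc := gap_contact rho tau yl yu xl xu zl zu T1 T2 rho1 yly yx xlu xz zlz mT1 mT2 T1i T2i.
split; [exact: cost_bcost|exact: cost_bcost| |].
  rewrite (tc _ bp mart) (tc _ bp0 mart0) ((gc _ bp0).2 K0) lerD2l.
  by apply: Rintegral_ge0 => p _; exact: gap_ge0.
move=> e; apply: (uniq pi K) => //; apply/(gc _ bp).
have := tc _ bp mart; rewrite e (tc _ bp0 mart0) ((gc _ bp0).2 K0).
by move=> /addrI/esym.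
Qed.

Lemma attains_min pi0 : martingale_coupling mu nu pi0 ->
  signed_cost_minimizer 1 pi0 -> the_unique (attains_Mdown rho mu nu) pi0.
Proof.
move=> m0 opt.
have min0 : cost rho pi0 = Mdown rho mu nu.
  apply/eqP; rewrite eq_le; apply/andP; split; last by apply: ereal_inf_lbound; exists pi0.
  apply: le_ereal_inf_tmp => _ [pi mpi <-]; have [k [k0 [-> ->]]] := opt _ mpi.
  by rewrite !mul1r lee_fin.
split => // pi [mpi epi]; have [k [k0 [ek ek0 _]]] := opt _ mpi; apply.
by apply: EFin_inj; rewrite -ek -ek0 epi min0.
Qed.

Lemma attains_max pi0 : martingale_coupling mu nu pi0 ->
  signed_cost_minimizer (-1) pi0 -> the_unique (attains_Mup rho mu nu) pi0.
Proof.
move=> m0 opt.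
have max0 : cost rho pi0 = Mup rho mu nu.
  apply/eqP; rewrite eq_le; apply/andP; split; first by apply: ereal_sup_ubound; exists pi0.
  apply: ge_ereal_sup => _ [pi mpi <-]; have [k [k0 [-> ->]]] := opt _ mpi.
  by rewrite !mulN1r lerN2 lee_fin.
split => // pi [mpi epi]; have [k [k0 [ek ek0 _]]] := opt _ mpi; apply.
by apply: EFin_inj; rewrite -ek -ek0 epi max0.
Qed.

End OptimalCoupling.

Theorem proposition2p19 (R : realType) (rho : R)
    (hrho : 1 < rho < 2 \/ 2 < rho) :
  exists alpha : R,
    [/\ 0 < alpha < 2^-1,
        psi rho alpha = 0,
        (forall beta : R, 0 < beta <= 1 -> psi rho beta = 0 -> beta = alpha) &
        forall (mu nu : probability R R) (yl yu xl xu zl zu : R),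
          finite_first_moment mu -> finite_first_moment nu ->
          le_cx mu nu ->
          yl < yu -> yu < xl -> xl < xu -> xu < zl -> zl < zu ->
          mu `[xl, xu]%classic = 1%E ->
          nu (`[yl, yu]%classic `|` `[zl, zu]%classic) = 1%E ->
          alpha * (zu - yu) <= xl - yu ->
          alpha * (zl - yl) <= zl - xu ->
          exists pi_up pi_down : probability (R * R)%type R,
            [/\ the_unique (nondecreasing_coupling mu nu) pi_up,
                the_unique (nonincreasing_coupling mu nu) pi_down,
                (rho < 2 -> the_unique (attains_Mup rho mu nu) pi_up /\
                            the_unique (attains_Mdown rho mu nu) pi_down) &
                (2 < rho -> the_unique (attains_Mdown rho mu nu) pi_up /\
                            the_unique (attains_Mup rho mu nu) pi_down)]].
Proof.
have rho1 : 1 < rho by case: hrho => [/andP[]|h] //; lra.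
have rho2 : rho != 2 by case: hrho => [/andP[_]|]; [move/lt_eqF ->|move/gt_eqF ->].
have e2 : rho - 1 - 1 = rho - 2 by ring.
have p0 : 0 < rho - 1 by lra.
have p1 : rho - 1 != 1 by rewrite subr_eq -[1 + 1]/(2 : R).
have [ts [ts1 hts0 tsuniq]] := hfun_root _ p0 p1; rewrite e2 => hts.
have ts0 : 0 < ts by lra.
have ts0' : 0 < 1 + ts by lra.
have a0 : 0 < (1 + ts)^-1 by rewrite invr_gt0.
have a1 : (1 + ts)^-1 < 2^-1 by rewrite ltf_pV2 ?posrE//; lra.
have at1 : (1 - (1 + ts)^-1) / (1 + ts)^-1 = ts by field; rewrite gt_eqF.
(* The root of [psi], from [ts = (1 - alpha) / alpha]. *)
exists (1 + ts)^-1; split.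
- exact/andP.
- by rewrite psi_hfun ?at1 ?hts0 ?mulr0// a0 (le_trans (ltW a1))// invf_le1 ?ler1n.
- move=> beta /andP[b0 b1]; rewrite psi_hfun ?b0// => /eqP.
  rewrite mulf_eq0 gt_eqF//= => /eqP /tsuniq <-.
    by rewrite mulrBl mul1r divff ?gt_eqF// addrCA subrr addr0 invrK.
  by rewrite divr_ge0 ?subr_ge0// ltW.
move=> mu nu yl yu xl xu zl zu _ _ cx yly yx xlu xz zlz mu1 nu1 h1 h2.
have c1 : zu - xl <= ts * (xl - yu).
  have : 0 <= (1 + ts) * (xl - yu - (1 + ts)^-1 * (zu - yu)) by rewrite mulr_ge0// ?subr_ge0// ltW.
  by rewrite mulrBr mulrA mulfV ?gt_eqF//; lra.
have c2 : xu - yl <= ts * (zl - xu).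
  have : 0 <= (1 + ts) * (zl - xu - (1 + ts)^-1 * (zl - yl)) by rewrite mulr_ge0// ?subr_ge0// ltW.
  by rewrite mulrBr mulrA mulfV ?gt_eqF//; lra.
have mean : \int[mu]_x clamp yl zu x = \int[nu]_x clamp yl zu x.
  apply: le_cx_mean => //; first lra.
    apply: (superset_prob1 _ _ _ _ (measurable_itv _) mu1) => s /=; rewrite !in_itv/= => /andP[s1 s2].
    by apply/andP; split; lra.
  apply: (superset_prob1 _ _ _ _ _ nu1); first by apply: measurableU; exact: measurable_itv.
  by move=> s /=; rewrite !in_itv/= => -[|] /andP[s1 s2]; apply/andP; split; lra.
have opt tau (t1 : tau = 1 \/ tau = -1) := exists_optimal_coupling rho ts tau yl yu xl xu zl zu mu nu
  rho1 rho2 hts ts0 (ltW yly) yx (ltW xlu) xz (ltW zlz) c1 c2 t1 mu1 nu1 mean.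
have [up [[[mup [Gup [mG G1 Gm]]] uup] oup]] := opt 1 (or_introl erefl).
have [dn [[[mdn [Gdn [mG' G1' Gm']]] udn] odn]] := opt (-1) (or_intror erefl).
exists up, dn; split.
- split; first by split => //; exists Gup; split => //; exact/tau_monotone1.
  move=> pi [mpi [G [? ? ?]]]; apply: uup; split => //.
  by exists G; split => //; exact/tau_monotone1.
- split; first by split => //; exists Gdn; split => //; exact/tau_monotoneN1.
  move=> pi [mpi [G [? ? ?]]]; apply: udn; split => //.
  by exists G; split => //; exact/tau_monotoneN1.
- move=> r2; have sg : Num.sg (rho - 2) = -1 by rewrite ltr0_sg// subr_lt0.
  rewrite sg mul1r in oup; rewrite sg mulrNN mulr1 in odn.
  by split; [exact: attains_max mup oup|exact: attains_min mdn odn].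
- move=> r2; have sg : Num.sg (rho - 2) = 1 by rewrite gtr0_sg// subr_gt0.
  rewrite sg mul1r in oup; rewrite sg mulr1 in odn.
  by split; [exact: attains_min mup oup|exact: attains_max mdn odn].
Qed.
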